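(* Let $d\ge 2$ and let $w=(w_1,\dots,w_d)$ be a $d$-tuple of positive real numbers with $\sum_{i=1}^d w_i=1$ and $w_1\ge\cdots\ge w_d$. The Hausdorff dimension of the set $$\{\Lambda\in\mathcal{L}_{d+1}:\ (a_t\Lambda)_{t\ge0}\ \text{is divergent}\}$$ is at least $\dim \mathrm{SL}_{d+1}(\mathbb{R})-\frac{1}{1+w_1}=(d+1)^2-1-\frac{1}{1+w_1}$.
   Context: $\mathcal{L}_{d+1}$ denotes the space of unimodular (covolume one) lattices in $\mathbb{R}^{d+1}$, identified with the homogeneous space $\mathrm{SL}_{d+1}(\mathbb{R})/\mathrm{SL}_{d+1}(\mathbb{Z})$. For $t\in\mathbb{R}$, $a_t=\operatorname{diag}(e^{w_1t},\dots,e^{w_dt},e^{-t})\in \mathrm{SL}_{d+1}(\mathbb{R})$. A trajectory $(y_t)_{t\ge0}$ in $\mathcal{L}_{d+1}$ is divergent if it eventually leaves every compact subset of $\mathcal{L}_{d+1}$. *)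

(* Defs.v *)
From HB Require Import structures.
From mathcomp Require Import all_boot all_order all_algebra.
From mathcomp Require Import all_classical all_reals all_analysis.
From mathcomp Require Import ring lra.

Set Implicit Arguments.
Unset Strict Implicit.
Unset Printing Implicit Defensive.
Import Order.TTheory GRing.Theory Num.Theory.
Import numFieldNormedType.Exports.
Local Open Scope classical_set_scope.
Local Open Scope ring_scope.

Section Hausdorff.
Context {R : realType} {T : metricType R}.
Local Open Scope ereal_scope.

(* The adjoined 0 makes the diameter of the empty set 0 (and not -oo). *)
Definition diameter (U : set T) : \bar R :=
  ereal_sup (0 |` [set (mdist p.1 p.2)%:E | p in U `*` U]).

Definition hausdorff_premeasure (s delta : R) (A : set T) : \bar R :=
  ereal_inf [set \sum_(0 <= k <oo) diameter (U k) `^ s | U in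
    [set U : (set T)^nat | A `<=` \bigcup_k U k /\
                           forall k, diameter (U k) <= delta%:E]].

Definition hausdorff_measure (s : R) (A : set T) : \bar R :=
  ereal_sup [set hausdorff_premeasure s delta A | delta in [set e | (0 < e)%R]].

(* Only exponents s > 0 are used, so the value of 0 `^ 0 plays no role. *)
Definition hausdorff_dim (A : set T) : \bar R :=
  ereal_inf [set s%:E | s in
    [set s : R | (0 < s)%R /\ hausdorff_measure s A = 0]].

End Hausdorff.

Definition divergent {R : realType} {T : topologicalType} (y : R -> T) : Prop :=
  forall K : set T, compact K -> \forall t \near +oo, ~ K (y t).

Section Lattices.
Context {R : realType} {n : nat}.
Implicit Types (g h k : 'M[R]_n).

(* The lattice g Z^n, spanned by the columns of g. *)
Definition zspan g : set 'cV[R]_n :=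
  [set g *m map_mx intr z | z in [set: 'cV[int]_n]].

(* The covolume of the lattice g Z^n is `|\det g|. *)
Definition unimodular (L : set 'cV[R]_n) : Prop :=
  exists2 g : 'M[R]_n, `|\det g| = 1 & L = zspan g.

End Lattices.

Record ulattice (R : realType) (n : nat) := ULattice {
  ulattice_set :> set 'cV[R]_n ;
  ulatticeP : unimodular ulattice_set }.

HB.instance Definition _ (R : realType) (n : nat) := gen_eqMixin (ulattice R n).
HB.instance Definition _ (R : realType) (n : nat) :=
  gen_choiceMixin (ulattice R n).

Section LatticeMetric.
Context {R : realType} {n : nat}.
Implicit Types (g h k : 'M[R]_n) (L M : ulattice R n).

Lemma ulattice_inj L M : L = M :> set _ -> L = M.
Proof.
by case: L M => [L uL] [M uM] /= LM; subst M; congr ULattice; exact: Prop_irrelevance.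
Qed.

Lemma zspan_mul g h : zspan (g *m h) = [set g *m v | v in zspan h].
Proof.
rewrite /zspan; apply/seteqP; split=> [_ [z _ <-]|_ [_ [z _ <-] <-]].
  by exists (h *m map_mx intr z); [exists z|rewrite mulmxA].
by exists z => //; rewrite mulmxA.
Qed.

Lemma zspan_cancel g h k : g \in unitmx ->
  zspan (g *m h) = zspan (g *m k) -> zspan h = zspan k.
Proof.
move=> ug; have E f : zspan f = [set invmx g *m v | v in zspan (g *m f)].
  by rewrite -zspan_mul mulKmx.
by rewrite (E h) (E k) => ->.
Qed.

Lemma det1_unitmx g : \det g = 1 -> g \in unitmx.
Proof. by rewrite unitmxE => ->; exact: unitr1. Qed.

Lemma unimodular_act g (L : ulattice R n) :
  \det g = 1 -> unimodular [set g *m v | v in (L : set _)].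
Proof.
move=> dg; have [h dh ->] := ulatticeP L; exists (g *m h); last by rewrite zspan_mul.
by rewrite det_mulmx dg mul1r.
Qed.

Definition ulattice_act g (dg : \det g = 1) (L : ulattice R n) : ulattice R n :=
  ULattice (unimodular_act L dg).

Lemma zspan_sub g h : zspan h `<=` zspan g ->
  exists c : 'M[int]_n, h = g *m map_mx intr c.
Proof.
move=> hg; have /choice[c hc] j : exists z : 'cV[int]_n,
    col j h = g *m map_mx intr z.
  have [|z _ zE] := hg (col j h); last by exists z.
  exists (delta_mx j 0) => //; rewrite colE; congr (_ *m _).
  by apply/matrixP => a b; rewrite !mxE; case: (_ && _).
exists (\matrix_(i, j) c j i 0); apply/matrixP => i j.
have /matrixP /(_ i 0) := hc j; rewrite !mxE => ->.
by apply: eq_bigr => k _; rewrite !mxE.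
Qed.

(* This and ulattice_SL identify ulattice R n with SL_n(R) / SL_n(Z). *)
Lemma eq_zspanP g h : \det g = 1 -> \det h = 1 ->
  zspan g = zspan h <->
  exists2 c : 'M[int]_n, \det c = 1 & h = g *m map_mx intr c.
Proof.
move=> dg dh; split=> [gh|[c dc ->]].
  have [|c hE] := @zspan_sub g h; first by rewrite gh.
  exists c => //; move: dh; rewrite hE det_mulmx dg mul1r det_map_mx.
  by move/eqP; rewrite -[1]/(1%:~R) eqr_int => /eqP.
have uc : c \in unitmx by rewrite unitmxE dc unitr1.
apply/seteqP; split => _ [z _ <-].
  exists (invmx c *m z) => //; rewrite -mulmxA -map_mxM mulmxA mulmxV//.
  by rewrite mul1mx.
by exists (c *m z) => //; rewrite map_mxM mulmxA.
Qed.

Lemma ulattice_SL L : exists2 g : 'M[R]_n, \det g = 1 & (L : set _) = zspan g.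
Proof.
have [g dg ->] := ulatticeP L.
have [dg1|dg1] := eqVneq (\det g) 1; first by exists g.
have dgN1 : \det g = -1.
  by move/eqP: dg; rewrite eqr_norml (negbTE dg1) /= => /andP[/eqP].
case: n g dg dg1 dgN1 => [|m] g dg dg1 dgN1.
  by move: dg1; rewrite det_mx00 eqxx.
pose e : 'rV[int]_m.+1 := \row_j (if j == 0 then -1 else 1).
pose D : 'M[int]_m.+1 := diag_mx e.
have DD : D *m D = 1%:M.
  rewrite /D mulmx_diag; apply/matrixP => i j; rewrite !mxE.
  by case: (_ == 0); rewrite ?mulrNN mulr1.
pose DR : 'M[R]_m.+1 := map_mx intr D.
exists (g *m DR).
  rewrite det_mulmx dgN1 /DR det_map_mx det_diag big_ord_recl !mxE eqxx big1.
    by rewrite mulr1 rmorphN1 mulrNN mulr1.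
  by move=> i _; rewrite !mxE.
apply/seteqP; split => _ [z _ <-].
  exists (D *m z) => //; rewrite -mulmxA -map_mxM mulmxA DD mul1mx //.
by exists (D *m z) => //; rewrite map_mxM mulmxA.
Qed.

Definition mxnorm1 g : R := \sum_i \sum_j `|g i j|.

(* A right-invariant distance on SL_n(R) (mxnorm1 is submultiplicative),      *)
(* locally bi-Lipschitz to any Riemannian distance.                           *)
Definition SLdist g h : R :=
  ln (1 + Num.max (mxnorm1 (g *m invmx h - 1%:M)) (mxnorm1 (h *m invmx g - 1%:M))).

(* The quotient distance on SL_n(R) / SL_n(Z): the distance between the       *)
(* cosets of matrices whose columns are a basis of L, resp. M.                *)
Definition ulattice_dist L M : R :=
  inf [set SLdist p.1 p.2 | p in
    [set p : 'M[R]_n * 'M[R]_n |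
      [/\ \det p.1 = 1, \det p.2 = 1, (L : set _) = zspan p.1
        & (M : set _) = zspan p.2]]].

Lemma mxnorm1_ge0 g : 0 <= mxnorm1 g.
Proof. by apply: sumr_ge0 => i _; apply: sumr_ge0. Qed.

Lemma mxnorm1_entry g i j : `|g i j| <= mxnorm1 g.
Proof.
rewrite /mxnorm1 (bigD1 i)//= (bigD1 j)//= -addrA lerDl addr_ge0 ?sumr_ge0//.
by move=> *; apply: sumr_ge0.
Qed.

Lemma mxnorm1_eq0 g : mxnorm1 g = 0 -> g = 0.
Proof.
move=> g0; apply/matrixP => i j; rewrite mxE; apply/eqP; rewrite -normr_le0 -g0.
exact: mxnorm1_entry.
Qed.

Lemma mxnorm10 : mxnorm1 0 = 0.
Proof. by rewrite /mxnorm1 big1// => i _; rewrite big1// => j _; rewrite mxE normr0. Qed.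

Lemma mxnorm1N g : mxnorm1 (- g) = mxnorm1 g.
Proof. by apply: eq_bigr => i _; apply: eq_bigr => j _; rewrite mxE normrN. Qed.

Lemma mxnorm1D g h : mxnorm1 (g + h) <= mxnorm1 g + mxnorm1 h.
Proof.
rewrite /mxnorm1 -big_split/=; apply: ler_sum => i _.
by rewrite -big_split/=; apply: ler_sum => j _; rewrite mxE ler_normD.
Qed.

Lemma mxnorm1M g h : mxnorm1 (g *m h) <= mxnorm1 g * mxnorm1 h.
Proof.
rewrite {2}/mxnorm1 mulr_suml; apply: ler_sum => i _.
apply: (@le_trans _ _ (\sum_j \sum_k `|g i k| * `|h k j|)).
  apply: ler_sum => j _; rewrite mxE (le_trans (ler_norm_sum _ _ _))//.
  by apply: ler_sum => k _; rewrite normrM.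
rewrite exchange_big/= mulr_suml; apply: ler_sum => k _.
rewrite -mulr_sumr ler_wpM2l// /mxnorm1 [leRHS](bigD1 k)//= lerDl.
by apply: sumr_ge0 => ? _; apply: sumr_ge0.
Qed.

Let mulmx_telescope g h k : h \in unitmx ->
  g *m invmx k - 1%:M =
  (g *m invmx h - 1%:M) *m (h *m invmx k - 1%:M)
  + (g *m invmx h - 1%:M) + (h *m invmx k - 1%:M).
Proof.
move=> uh; rewrite mulmxBl !mulmxBr !mulmx1 !mul1mx mulmxA mulmxKV//.
move: (g *m invmx k) (g *m invmx h) (h *m invmx k) => a b c.
by apply/matrixP => i j; rewrite !mxE; ring.
Qed.

Let ln1max_arg g h :
  0 < 1 + Num.max (mxnorm1 (g *m invmx h - 1%:M)) (mxnorm1 (h *m invmx g - 1%:M)).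
Proof. by rewrite ltr_pwDl// le_max mxnorm1_ge0. Qed.

Lemma SLdist_ge0 g h : 0 <= SLdist g h.
Proof. by rewrite /SLdist ln_ge0// lerDl le_max mxnorm1_ge0. Qed.

Lemma SLdist_sym g h : SLdist g h = SLdist h g.
Proof. by rewrite /SLdist maxC. Qed.

Lemma SLdistxx g : g \in unitmx -> SLdist g g = 0.
Proof. by move=> ug; rewrite /SLdist mulmxV// subrr mxnorm10 maxxx addr0 ln1. Qed.

Lemma SLdist_triangle h g k : h \in unitmx ->
  SLdist g k <= SLdist g h + SLdist h k.
Proof.
move=> uh; rewrite /SLdist -lnM ?posrE// ler_ln ?posrE ?mulr_gt0//.
set a := Num.max _ _; set b := Num.max (mxnorm1 (g *m _ - _)) _.
set c := Num.max _ _.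
have key u v (x y : 'M[R]_n) : 0 <= u -> 0 <= v -> mxnorm1 x <= u ->
    mxnorm1 y <= v -> 1 + mxnorm1 (x *m y + x + y) <= (1 + u) * (1 + v).
  move=> u0 v0 xu yv; have := mxnorm1D (x *m y + x) y.
  have := mxnorm1D (x *m y) x; have := mxnorm1M x y.
  have := ler_pM (mxnorm1_ge0 x) (mxnorm1_ge0 y) xu yv; lra.
have b0 : 0 <= b by rewrite le_max mxnorm1_ge0.
have c0 : 0 <= c by rewrite le_max mxnorm1_ge0.
suff : 1 + a <= (1 + b) * (1 + c) by [].
rewrite -lerBrDl ge_max !lerBrDl; apply/andP; split.
  by rewrite (mulmx_telescope _ _ uh); apply: key => //; rewrite le_max lexx ?orbT.
rewrite (mulmx_telescope _ _ uh) [leRHS]mulrC.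
by apply: key => //; rewrite le_max lexx ?orbT.
Qed.

Lemma SLdistMr g h k : g \in unitmx -> h \in unitmx -> k \in unitmx ->
  SLdist (g *m k) (h *m k) = SLdist g h.
Proof.
move=> ug uh uk; rewrite /SLdist.
have E f f' : f' \in unitmx -> f *m k *m invmx (f' *m k) = f *m invmx f'.
  move=> uf'; have ufk : f' *m k \in unitmx by rewrite unitmx_mul uf'.
  by apply: (canLR (mulmxK ufk)); rewrite mulmxA mulmxKV.
by rewrite !E.
Qed.

Lemma ltln1 (a r : R) : 0 <= a -> 0 < r -> ln (1 + a) < ln (1 + r) -> a < r.
Proof. by move=> a0 r0; rewrite ltr_ln ?posrE ?ltrD2l ?ltr_pwDl// ltW. Qed.

Lemma SLdist_lt g h (r : R) : 0 < r -> SLdist g h < ln (1 + r) ->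
  mxnorm1 (g *m invmx h - 1%:M) < r /\ mxnorm1 (h *m invmx g - 1%:M) < r.
Proof.
move=> r0 /ltln1; rewrite le_max mxnorm1_ge0 => /(_ isT r0).
by rewrite gt_max => /andP.
Qed.

Lemma SLdist_eq0 g h : h \in unitmx -> SLdist g h = 0 -> g = h.
Proof.
move=> uh gh; have N0 : mxnorm1 (g *m invmx h - 1%:M) = 0.
  apply/eqP; rewrite eq_le mxnorm1_ge0 andbT; apply/ler_addgt0Pl => e e0.
  rewrite addr0; have [|+ _] := @SLdist_lt g h e e0; last exact: ltW.
  by rewrite gh ln_gt0// ltrDl.
move/mxnorm1_eq0/eqP: N0; rewrite subr_eq0 => /eqP gh1.
by rewrite -[g](mulmxKV uh) gh1 mul1mx.
Qed.

Lemma SLdist_rigid h : h \in unitmx -> exists2 e : R, 0 < e &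
  forall g k, \det g = 1 -> \det k = 1 -> zspan g = zspan k ->
    SLdist g h < e -> SLdist k h < e -> g = k.
Proof.
move=> uh.
pose C := mxnorm1 (invmx h) * (1 + mxnorm1 (1%:M : 'M[R]_n)) * mxnorm1 h.
have C0 : 0 <= C by rewrite !mulr_ge0 ?addr_ge0 ?mxnorm1_ge0.
pose r := (1 + 2 * C)^-1.
have r0 : 0 < r by rewrite invr_gt0; lra.
have r1 : r <= 1 by rewrite invf_le1 ?lerDl; lra.
have rC : 2 * C * r < 1 by rewrite ltr_pdivrMr; lra.
exists (ln (1 + r)); first by rewrite ln_gt0// ltrDl.
move=> g k dg dk gk /(SLdist_lt r0)[gh hg] /(SLdist_lt r0)[kh _].
have ug := det1_unitmx dg.
have [|c kE] := @zspan_sub g k; first by rewrite gk.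
suff c1 : c = 1%:M by rewrite kE c1 map_mx1 mulmx1.
have cE : map_mx intr c - 1%:M = invmx h *m (h *m invmx g) *m
    ((k *m invmx h - 1%:M) - (g *m invmx h - 1%:M)) *m h :> 'M[R]_n.
  rewrite mulKmx// opprB addrA subrK -mulmxBl -!mulmxA mulVmx// mulmx1.
  by rewrite mulmxBr mulVmx// kE mulKmx.
have cN : mxnorm1 (map_mx intr c - 1%:M : 'M[R]_n) < 1.
  rewrite cE; apply: le_lt_trans rC; rewrite /C.
  apply: le_trans (mxnorm1M _ _) _.
  rewrite [leRHS](_ : _ = mxnorm1 (invmx h) * (1 + mxnorm1 (1%:M : 'M[R]_n))
    * (r + r) * mxnorm1 h); last by ring.
  apply: ler_wpM2r; first exact: mxnorm1_ge0.
  apply: le_trans (mxnorm1M _ _) _; apply: ler_pM; rewrite ?mxnorm1_ge0//.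
    apply: le_trans (mxnorm1M _ _) _; apply: ler_wpM2l; rewrite ?mxnorm1_ge0//.
    rewrite -[h *m _](subrK 1%:M); apply: le_trans (mxnorm1D _ _) _.
    by rewrite lerD2r ltW// (lt_le_trans hg).
  by apply: le_trans (mxnorm1D _ _) _; rewrite mxnorm1N lerD// ltW.
apply/matrixP => i j; apply/eqP; rewrite -subr_eq0 -normr_le0 leNgt gtz0_ge1.
rewrite -ltNge; have := le_lt_trans (mxnorm1_entry _ i j) cN.
rewrite !mxE (_ : (i == j)%:R = ((i == j)%:R : int)%:~R); last by case: (i == j).
by rewrite -intrB -intr_norm ltrz1.
Qed.

Lemma ulattice_dist_le L M g h : \det g = 1 -> \det h = 1 ->
  (L : set _) = zspan g -> (M : set _) = zspan h ->
  ulattice_dist L M <= SLdist g h.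
Proof.
move=> dg dh Lg Mh; apply: ge_inf; last by exists (g, h).
by exists 0 => _ [p _ <-]; exact: SLdist_ge0.
Qed.

Let dist_nonempty L M : [set SLdist p.1 p.2 | p in
    [set p : 'M[R]_n * 'M[R]_n |
      [/\ \det p.1 = 1, \det p.2 = 1, (L : set _) = zspan p.1
        & (M : set _) = zspan p.2]]] !=set0.
Proof.
have [g dg Lg] := ulattice_SL L; have [h dh Mh] := ulattice_SL M.
by exists (SLdist g h), (g, h).
Qed.

Lemma ulattice_dist_lt L M h (e : R) : \det h = 1 -> (M : set _) = zspan h ->
  ulattice_dist L M < e ->
  exists g, [/\ \det g = 1, (L : set _) = zspan g & SLdist g h < e].
Proof.
move=> dh Mh /(inf_lt (dist_nonempty L M))[_ [[g k] /= [dg dk Lg Mk] <-] gk].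
have [ug uh uk] : [/\ g \in unitmx, h \in unitmx & k \in unitmx].
  by split; exact: det1_unitmx.
have uc : invmx k *m h \in unitmx by rewrite unitmx_mul unitmx_inv uk.
exists (g *m (invmx k *m h)); split.
- by rewrite !det_mulmx det_inv dg dk dh invr1 !mulr1.
- rewrite Lg zspan_mul (_ : zspan (invmx k *m h) = zspan 1%:M).
    by rewrite -zspan_mul mulmx1.
  by apply: (zspan_cancel uk); rewrite mulKVmx// mulmx1 -Mh.
- by rewrite -{2}(mulKVmx uk h) SLdistMr.
Qed.

Lemma ulattice_dist_ge0 L M : 0 <= ulattice_dist L M.
Proof.
by apply: lb_le_inf => // _ [p _ <-]; exact: SLdist_ge0.
Qed.

Lemma ulattice_distxx L : ulattice_dist L L = 0.
Proof.
apply/eqP; rewrite eq_le ulattice_dist_ge0 andbT.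
have [g dg Lg] := ulattice_SL L.
by rewrite -(SLdistxx (det1_unitmx dg)); exact: ulattice_dist_le.
Qed.

Lemma ulattice_dist_sym L M : ulattice_dist L M = ulattice_dist M L.
Proof.
congr inf; apply/seteqP; split => _ [[g h] /= [dg dh Lg Mh] <-].
  by exists (h, g) => //; rewrite SLdist_sym.
by exists (h, g) => //; rewrite SLdist_sym.
Qed.

Lemma ulattice_dist_triangle M L N :
  ulattice_dist L N <= ulattice_dist L M + ulattice_dist M N.
Proof.
apply/ler_addgt0Pr => e e0; have e20 : 0 < e / 2 by rewrite divr_gt0.
have [k dk Nk] := ulattice_SL N.
have [|h [dh Mh hk]] := @ulattice_dist_lt M N k (ulattice_dist M N + e / 2) dk Nk.
  by rewrite ltrDl.
have [|g [dg Lg gh]] := @ulattice_dist_lt L M h (ulattice_dist L M + e / 2) dh Mh.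
  by rewrite ltrDl.
have := ulattice_dist_le dg dk Lg Nk.
have := SLdist_triangle g k (det1_unitmx dh); lra.
Qed.

Lemma ulattice_dist_eq0 L M : ulattice_dist L M = 0 -> L = M.
Proof.
move=> LM0; have [h dh Mh] := ulattice_SL M; have uh := det1_unitmx dh.
have [e e0 he] := SLdist_rigid uh.
have near_ (r : R) : 0 < r ->
    exists g, [/\ \det g = 1, (L : set _) = zspan g & SLdist g h < r].
  by rewrite -LM0 => /(ulattice_dist_lt dh Mh).
have [g [dg Lg ge]] := near_ e e0.
apply: ulattice_inj; rewrite Lg Mh; congr zspan; apply: SLdist_eq0 => //.
apply/eqP; rewrite eq_le SLdist_ge0 andbT; apply/ler_addgt0Pl => r r0.
have [|k [dk Lk]] := near_ (Num.min e r); first by rewrite lt_min e0.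
rewrite lt_min addr0 => /andP[ke kr].
by rewrite (he g k)// ?ltW// -Lg.
Qed.

HB.instance Definition _ := isMetric.Build R (ulattice R n)
  ulattice_distxx ulattice_dist_eq0 ulattice_dist_sym ulattice_dist_triangle.

(* The projection SL_n(R) -> ulattice R n is a local isometry. *)
Lemma ulattice_dist_local h : \det h = 1 -> exists2 e : R, 0 < e &
  forall g k L M, \det g = 1 -> \det k = 1 ->
    (L : set _) = zspan g -> (M : set _) = zspan k ->
    SLdist g h < e -> SLdist k h < e -> mdist L M = SLdist g k.
Proof.
move=> dh; have uh := det1_unitmx dh; have [e e0 he] := SLdist_rigid uh.
exists (e / 4); first by rewrite divr_gt0.
move=> g k L M dg dk Lg Mk gh kh; apply/eqP.
rewrite eq_le (ulattice_dist_le dg dk Lg Mk) leNgt; apply/negP.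
move=> /(ulattice_dist_lt dk Mk)[g' [dg' Lg' g'k]].
have := SLdist_triangle g' h (det1_unitmx dk).
have := SLdist_triangle g k uh; rewrite (SLdist_sym h k) => gk g'h.
have gg' : g = g' by apply: he => //; [rewrite -Lg | lra | lra].
by move: g'k; rewrite gg' ltxx.
Qed.

End LatticeMetric.

Section Flow.
Context {R : realType} {d : nat}.

Definition a_flow (w : 'I_d -> R) (t : R) : 'M[R]_(d + 1) :=
  diag_mx (row_mx (\row_i expR (w i * t)) (const_mx (expR (- t)))).

Lemma det_a_flow (w : 'I_d -> R) (t : R) :
  \sum_i w i = 1 -> \det (a_flow w t) = 1.
Proof.
move=> w1; rewrite det_diag big_split_ord/= big_ord1 row_mxEr mxE.
rewrite (eq_bigr (fun i => expR (w i * t))); last first.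
  by move=> i _; rewrite row_mxEl mxE.
by rewrite -expR_sum -mulr_suml w1 mul1r -expRD subrr expR0.
Qed.

End Flow.

(* Main.v *)
(** Let y_i(v) be the coordinates of v A^-1 for v in Z^d.  In the chart
    g = [A z; b c'], where c' is determined by det g = 1, the trajectory of
    g Z^(d+1) diverges as soon as for every eps and all large t some nonzero
    (v, k) satisfies |y_i(v)| <= eps e^(w_i t) and |y(v).z - k| <= eps e^(-t):
    otherwise the corresponding dual vector, paired with a basis of a_t g Z^(d+1)
    of bounded norm, would be a nonzero integer vector of norm less than 1.

    For fixed A near 1, the z with this property contain a Cantor set.  Its level n
    consists of slabs around pieces of the hyperplanes y(m).z = k with |y_i(m)| of
    order 2^(w_i S_n); the children of the slab of m are slabs of vectors
    eta + j m, where eta is given by Dirichlet's theorem at most points of a grid.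
    A cube of side rho meets a proportion of at most about rho^d 2^(S_j) of the
    slabs of any deep level, where rho is about 2^(-(1+w_1) S_j), the spacing of
    sibling slabs of level j along the first coordinate.  This is a Frostman
    estimate for every exponent below d - 1/(1+w_1), uniform in A.

    If the Hausdorff measure of exponent s of the divergent set were 0, it would
    have covers with arbitrarily small sum of diam^s.  Choosing the d(d+1) entries
    of A and b one after the other by averaging over an interval, one obtains a
    slice in which the sum of diam^(s - d(d+1)) over the sets that meet it is still
    small, against the Frostman estimate. *)

From HB Require Import structures.
From mathcomp Require Import all_boot all_order all_algebra.
From mathcomp Require Import boolp reals sequences exp.
From mathcomp Require Import ring lra zify.

Set Implicit Arguments.
Unset Strict Implicit.
Unset Printing Implicit Defensive.
Import Order.TTheory GRing.Theory Num.Theory.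
Local Open Scope ring_scope.

(** * One step of the construction *)

(** Dirichlet's theorem bounds [eta] only from above, while the spacing of the slabs also needs its
    coordinate [i1] from below. Hence a node carries a nondegeneracy clause, and [eta] is kept only
    where it is nearly minimal in the coordinate [i1]. Discarding the points with a vector below
    [lc n], equal to 2^(-C1 n^2), times the Dirichlet bound costs little: the ratio of consecutive
    factors, 2^(-C1 (2n + 1)), outweighs the constants 2^O(n) of one step. All losses add up to
    exponents of order n^3, negligible against S_n of order n^4.

    The coordinate [e] has the smallest weight, so that multiplying [m] by about 2^(w_e (S_(n+1) -
    S_n)) keeps every other coordinate within its bound. The coordinate [i1] has the largest weight,
    which makes 1/(1 + w_(i1)) smallest. The slice is chosen after the cover, so the constants may
    not depend on A. The parameter [t] shrinks the root slab until it fits into the chart. *)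

Section Counting.
Context {R : realType}.

Lemma card_fiber_le (T U : finType) (A : {set T}) (B : {set U}) (f : T -> U) (r : R) :
  (forall a, a \in A -> f a \in B) ->
  (forall u, u \in B -> (#|[set a in A | f a == u]|)%:R <= r) ->
  (#|A|)%:R <= (#|B|)%:R * r.
Proof.
move=> fAB fib; rewrite -sum1_card (partition_big f (mem B))//= natr_sum.
rewrite mulr_natl -sumr_const; apply: ler_sum => u uB.
by rewrite (le_trans _ (fib u uB))// ler_nat -sum1dep_card.
Qed.

Lemma card_fun_box (d P : nat) (lo n : 'I_d -> nat) :
  (#|[set l : {ffun 'I_d -> 'I_P} | [forall i, (lo i <= l i < lo i + n i)%N]]|
    <= \prod_i n i)%N.
Proof.
pose F (i : 'I_d) := [pred v : 'I_P | (lo i <= v < lo i + n i)%N].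
rewrite (_ : #|_| = #|family F|); last first.
  by apply: eq_card => l; rewrite inE; apply/forallP/familyP.
rewrite card_family foldrE big_map big_enum/=; apply: leq_prod => i _.
have [n0|n0] := posnP (n i).
  rewrite [leqRHS]n0 leqn0; apply/eqP/eq_card0 => v.
  rewrite unfold_in /= n0 addn0; apply/negbTE/negP => /andP[a b]; have := leq_trans b a; by rewrite ltnn.
rewrite -[leqRHS]card_ord.
pose h (v : 'I_P) := Ordinal (ltn_pmod (v - lo i) n0).
rewrite -(card_in_imset (f := h)) ?max_card// => u v.
rewrite !unfold_in /= => /andP[lu un] /andP[lv vn] [].
rewrite !modn_small ?ltn_subLR// => uv; apply: val_inj => /=.
by rewrite -(subnKC lu) -(subnKC lv) uv.
Qed.

Lemma card_fun_box0 (d P : nat) (n : 'I_d -> nat) : (forall i, n i <= P)%N ->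
  #|[set l : {ffun 'I_d -> 'I_P} | [forall i, (l i < n i)%N]]| = (\prod_i n i)%N.
Proof.
move=> nP; pose F (i : 'I_d) := [pred v : 'I_P | (v < n i)%N].
rewrite (_ : #|_| = #|family F|); last first.
  by apply: eq_card => l; rewrite inE; apply/forallP/familyP.
rewrite card_family foldrE big_map big_enum/=; apply: eq_bigr => i _.
have winj : injective (widen_ord (nP i)) by move=> u v [] /val_inj.
rewrite -[RHS]card_ord -(card_imset _ winj).
apply: eq_card => v; rewrite unfold_in /=; apply/idP/imsetP => [vn|[u _ ->]].
  by exists (Ordinal vn); last exact: val_inj.
exact: (ltn_ord u).
Qed.

(** Buckets of width [D2]: two values in one bucket differ by less than [D2], hence by at most [D1],
    so a bucket holds at most [D1 + 1] distinct integers. *)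
Lemma card_sparse (T : finType) (A : {set T}) (h : T -> nat) (K : nat) (D1 D2 : R) :
  0 <= D1 -> 0 < D2 -> {in A &, injective h} -> (forall a, a \in A -> h a < K)%N ->
  (forall a b, a \in A -> b \in A ->
     `|(h a)%:R - (h b)%:R| <= D1 \/ D2 <= `|(h a)%:R - (h b)%:R| :> R) ->
  (#|A|)%:R <= (K%:R / D2 + 1) * (D1 + 1).
Proof.
move=> D10 D20 hinj hK hD.
pose W := Num.truncn (K%:R / D2).
have KD0 : 0 <= K%:R / D2 by rewrite divr_ge0// ltW.
pose f a : 'I_W.+1 := inord (Num.truncn ((h a)%:R / D2)).
have fE a : a \in A -> f a = Num.truncn ((h a)%:R / D2) :> nat.
  move=> aA; rewrite inordK// ltnS le_truncn// ler_pM2r ?invr_gt0//.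
  by rewrite ler_nat ltnW// hK.
apply: (@le_trans _ _ (#|[set: 'I_W.+1]|%:R * (D1 + 1))); last first.
  rewrite ler_wpM2r ?addr_ge0// cardsT card_ord -natr1 lerD2r.
  by rewrite truncn_le.
apply: (card_fiber_le (f := f)) => [a _|u _]; first by rewrite inE.
set B := [set _ in A | _].
have BD a b : a \in B -> b \in B -> `|(h a)%:R - (h b)%:R| <= D1.
  rewrite !inE => /andP[aA /eqP fa] /andP[bA /eqP fb].
  have [//|] := hD _ _ aA bA; rewrite leNgt => /negP[].
  have /= ta := fE _ aA; have /= tb := fE _ bA.
  have : Num.truncn ((h a)%:R / D2) = Num.truncn ((h b)%:R / D2).
    by rewrite -ta -tb fa fb.
  have /truncn_itv/andP[a1 a2] : 0 <= (h a)%:R / D2 by rewrite divr_ge0// ltW.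
  have /truncn_itv/andP[b1 b2] : 0 <= (h b)%:R / D2 by rewrite divr_ge0// ltW.
  move=> E; rewrite E in a1 a2; rewrite -natr1 in a2 b2.
  have : `|((h a)%:R - (h b)%:R) / D2| < 1 by rewrite mulrBl ltr_norml; lra.
  by rewrite normrM normfV (gtr0_norm D20) ltr_pdivrMr// mul1r.
have [->|[a0 a0B]] := set_0Vmem B; first by rewrite cards0 addr_ge0.
have [a aB amin] := arg_minnP h a0B.
pose g b : 'I_(Num.truncn D1).+1 := inord (h b - h a).
have gE b : b \in B -> g b = (h b - h a)%N :> nat.
  move=> bB; rewrite inordK// ltnS truncn_ge_nat//.
  have := BD _ _ bB aB; rewrite -natrB ?amin//.
  by rewrite ger0_norm.
apply: (@le_trans _ _ #|[set: 'I_(Num.truncn D1).+1]|%:R); last first.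
  by rewrite cardsT card_ord -natr1 lerD2r truncn_le.
rewrite ler_nat -(card_in_imset (f := g)) ?subset_leq_card ?subsetT//.
move=> b c bB cB /(congr1 val) /=; rewrite !gE// => bc.
have bA : b \in A by move: bB; rewrite inE => /andP[].
have cA : c \in A by move: cB; rewrite inE => /andP[].
apply: hinj => //.
by rewrite -(subnKC (amin _ bB)) -(subnKC (amin _ cB)) bc.
Qed.

End Counting.

(** * Linear forms modulo a node vector *)

Section Forms.
Context {R : realType} {V : zmodType} {d : nat}.
Context (y : 'I_d -> {additive V -> R}) (k : {additive V -> R}) (e : 'I_d).
Implicit Types (m v u : V) (x : 'I_d -> R).

(* [phi v] is the affine form defining the hyperplane of [v]; [gam m v] and
   [th m v] are the linear and affine parts of [v] after subtracting the multiple
   of [m] that cancels the coordinate [e], hence depend only on [v] modulo [m]. *)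
Definition phi v x := \sum_i y i v * x i - k v.
Definition gam m v i := y i v - y e v / y e m * y i m.
Definition th m v x := phi v x - y e v / y e m * phi m x.
Definition inZ m v := exists p : int, v = m *~ p.

Lemma phiB u v x : phi (u - v) x = phi u x - phi v x.
Proof.
rewrite /phi raddfB/= (eq_bigr (fun i => y i u * x i - y i v * x i)).
  by rewrite sumrB; ring.
by move=> i _; rewrite raddfB/= mulrBl.
Qed.

Lemma addMz (f : {additive V -> R}) v p : f (v *~ p) = p%:~R * f v.
Proof. by rewrite raddfMz/= mulrzl. Qed.

Lemma phiMz v p x : phi (v *~ p) x = p%:~R * phi v x.
Proof.
rewrite /phi addMz mulrBr mulr_sumr; congr (_ - _).
by apply: eq_bigr => i _; rewrite addMz mulrA.
Qed.

Lemma phi_sub v x x' : phi v x - phi v x' = \sum_i y i v * (x i - x' i).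
Proof.
rewrite /phi opprB addrA subrK -sumrB; apply: eq_bigr => i _.
by rewrite mulrBr.
Qed.

Lemma th_sub m v x x' : th m v x - th m v x' = \sum_i gam m v i * (x i - x' i).
Proof.
rewrite /th (_ : _ - _ = (phi v x - phi v x')
  - y e v / y e m * (phi m x - phi m x')); last by ring.
rewrite !phi_sub mulr_sumr -sumrB; apply: eq_bigr => i _.
by rewrite /gam mulrBl mulrA.
Qed.

Lemma gamB m u v i : gam m (u - v) i = gam m u i - gam m v i.
Proof. by rewrite /gam !raddfB/=; ring. Qed.

Lemma thB m u v x : th m (u - v) x = th m u x - th m v x.
Proof. by rewrite /th phiB !raddfB/=; ring. Qed.

Section NonVertical.
Context (m : V) (q0 : y e m != 0).

Lemma gam_last v : gam m v e = 0.
Proof. by rewrite /gam divfK// subrr. Qed.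

Lemma gamMz p i : gam m (m *~ p) i = 0.
Proof. by rewrite /gam !addMz mulfK// subrr. Qed.

Lemma thMz p x : th m (m *~ p) x = 0.
Proof. by rewrite /th phiMz addMz mulfK// subrr. Qed.

(** Passing from the quotient by [m] to the quotient by [m']: together with [th_change] it transfers
    estimates between parent and child. *)
Lemma gam_change m' v i : y e m' != 0 ->
  gam m v i = gam m' v i + y e v / y e m' * gam m m' i.
Proof. by move=> q'0; rewrite /gam; field; rewrite q0 q'0. Qed.

Lemma th_change m' v x : y e m' != 0 ->
  th m v x = th m' v x + y e v / y e m' * th m m' x.
Proof. by move=> q'0; rewrite /th; field; rewrite q0 q'0. Qed.

Lemma th_swap m' x : y e m' != 0 -> th m' m x = - (y e m / y e m') * th m m' x.
Proof. by move=> q'0; rewrite /th; field; rewrite q0 q'0. Qed.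

(** Used with [m'] a child: [phi m'] is tiny on its slab, so there [phi m] is, up to sign,
    essentially [th m m'] scaled down. *)
Lemma phi_th m' x : y e m' != 0 ->
  phi m x = y e m / y e m' * (phi m' x - th m m' x).
Proof. by move=> q'0; rewrite /th; field; rewrite q0 q'0. Qed.

End NonVertical.

Lemma inZ0 m : inZ m 0.
Proof. by exists 0; rewrite mulr0z. Qed.

Lemma inZB m u v : inZ m u -> inZ m v -> inZ m (u - v).
Proof. by move=> [p ->] [p' ->]; exists (p - p'); rewrite mulrzBr. Qed.

Lemma inZN m v : inZ m v -> inZ m (- v).
Proof. by rewrite -[- v]sub0r; apply: inZB; exact: inZ0. Qed.

End Forms.

(** * Grid points with an exceptionally short vector *)

Section BadPoints.
Context {R : realType} {V : zmodType} {d : nat}.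
Context (y : 'I_d -> {additive V -> R}) (k : {additive V -> R}) (e : 'I_d).
Local Notation gam := (gam y e).
Local Notation th := (th y k e).
Local Notation inZ := (@inZ V).

Definition inbox (y0 b x : 'I_d -> R) := forall i, i != e -> y0 i <= x i <= y0 i + b i.

Definition gridpt P (y0 step : 'I_d -> R) (l : {ffun 'I_d -> 'I_P}) (i : 'I_d) : R :=
  y0 i + (l i)%:R * step i.

(* Two bad vectors with nearly equal [gam] either agree modulo [m] or have values
   of [th] that differ by [Psi] (nondegeneracy), so along a grid line in a direction
   [i] with [U i < |gam i|] the bad points come in few, well separated clusters. *)
Lemma bad_count (m : V) (y0 b U G step : 'I_d -> R) (K : 'I_d -> nat) (P : nat)
    (Psi Del : R) :
  y e m != 0 ->
  (forall x, inbox y0 b x -> forall v, (forall i, i != e -> `|gam m v i| <= U i) ->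
     `|th m v x| < Psi -> inZ m v) ->
  (forall i, 0 < U i <= G i) -> (forall i, 0 < step i) ->
  (forall i, (K i)%:R * step i <= b i) -> (forall i, K i <= P.+1)%N ->
  0 < Del -> 4 * Del <= Psi ->
  (forall i, i != e -> G i * step i <= 2 * Del) ->
  (forall i, i != e -> Psi <= 3 * U i * (K i)%:R * step i) ->
  (#|[set l : {ffun 'I_d -> 'I_P.+1} | [forall i, (l i < K i)%N] &&
      `[< exists v, [/\ ~ inZ m v, forall i, i != e -> `|gam m v i| <= G i
           & `|th m v (gridpt y0 step l)| <= Del] >]]|)%:R
    <= (\prod_i (5 * G i / U i)) * ((\prod_i K i)%:R * (48 * Del / Psi)) :> R.
Proof.
have tri (a a' D : R) : `|a| <= D -> `|a'| <= D -> `|a - a'| <= 2 * D.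
  by rewrite !ler_norml => /andP[? ?] /andP[? ?]; apply/andP; split; lra.
have succM (x z : R) : 1 <= x -> 1 <= z -> (x + 1) * (z + 1) <= 2 * x * (2 * z).
  by move=> ? ?; apply: ler_pM; lra.
have far (a1 a2 a3 D p : R) : `|a1| <= D -> `|a3| <= D -> 4 * D <= p ->
    p <= `|a1 - a2| -> p / 2 <= `|a2 - a3|.
  move=> h1 h3 h4 h5; have := ler_normB a1 a2; have := ler_normD (a2 - a3) a3.
  by rewrite subrK; lra.
have third (p u h x : R) : p / 2 <= 3 * u * h * x -> p <= x * (6 * u * h) by lra.
have scale (a g g0 : R) : 0 < a -> a < `|g0| -> `|g - g0| <= a / 2 ->
    `|g0| - a / 2 <= `|g| <= 3 * (`|g0| - a / 2).
  move=> a0 ag h; have := ler_normD (g - g0) g0; have := ler_normB g (g - g0).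
  by rewrite subrK opprB addrC subrK => h1 h2; apply/andP; split; lra.
have half_u (a c x : R) : 0 <= x -> a < c -> 3 * a * x <= 6 * (c - a / 2) * x.
  by move=> x0 h; apply: ler_wpM2r => //; lra.
move=> q0 nd UG step0 Kb KP Del0 DelPsi Gs UKs.
have U0 i : 0 < U i by case/andP: (UG i).
have UleG i : U i <= G i by case/andP: (UG i).
have Psi0 : 0 < Psi by lra.
set bad := [set _ | _].
have /choice[v vP] l : exists v, l \in bad -> [/\ ~ inZ m v,
    forall i, i != e -> `|gam m v i| <= G i & `|th m v (gridpt y0 step l)| <= Del].
  have [|lb] := boolP (l \in bad); last by exists 0.
  by rewrite inE => /andP[_ /asboolP[v vP]]; exists v.
have gam_e l : gam m (v l) e = 0 by rewrite gam_last.
have vG l i : l \in bad -> `|gam m (v l) i| <= G i.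
  move=> /vP[_ vG _]; have [->|/vG//] := eqVneq i e.
  by rewrite gam_e normr0 (le_trans (ltW (U0 e))).
have in_box l : l \in bad -> inbox y0 b (gridpt y0 step l).
  rewrite inE => /andP[/forallP lK _] i ie; rewrite /gridpt lerDl lerD2l.
  rewrite mulr_ge0 ?(ltW (step0 i))//=; apply: le_trans (Kb i).
  by rewrite ler_pM2r// ler_nat ltnW.
(* Cells of side [U i / 2] in the space of [gam] values, so that the difference of two vectors of
   one cell satisfies the bound in the nondegeneracy hypothesis. *)
pose cn i := Num.truncn (4 * G i / U i).
pose cidx l i := Num.truncn ((gam m (v l) i + G i) / (U i / 2)).
have cidx_lt l i : l \in bad -> (cidx l i < (cn i).+1)%N.
  move=> lb; rewrite ltnS le_truncn//.
  rewrite (_ : 4 * _ / _ = (G i + G i) / (U i / 2)); last first.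
    by field; rewrite gt_eqF.
  rewrite ler_pM2r ?invr_gt0 ?divr_gt0// lerD2r.
  by have := vG l i lb; rewrite ler_norml => /andP[].
have cidx_near l l' i : l \in bad -> l' \in bad -> cidx l i = cidx l' i ->
    `|gam m (v l) i - gam m (v l') i| <= U i / 2.
  move=> lb l'b; rewrite /cidx => E; have U20 : 0 < U i / 2 by rewrite divr_gt0.
  have ge0 l0 : l0 \in bad -> 0 <= (gam m (v l0) i + G i) / (U i / 2).
    move=> l0b; rewrite divr_ge0 ?(ltW U20)//.
    by have := vG l0 i l0b; rewrite ler_norml => /andP[]; lra.
  have /truncn_itv/andP[a1 a2] := ge0 _ lb.
  have /truncn_itv/andP[b1 b2] := ge0 _ l'b.
  rewrite E in a1 a2; rewrite -natr1 in a2 b2.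
  have : `|((gam m (v l) i + G i) / (U i / 2) - (gam m (v l') i + G i) / (U i / 2))| < 1.
    by rewrite ltr_norml; lra.
  rewrite -mulrBl normrM normfV (gtr0_norm U20) ltr_pdivrMr// mul1r => H.
  by apply: ltW; rewrite (_ : _ - _ = gam m (v l) i + G i - (gam m (v l') i + G i));
    last by ring.
pose Pc := \max_i cn i.
pose cell l : {ffun 'I_d -> 'I_Pc.+1} := [ffun i => inord (cidx l i)].
have cellE l i : l \in bad -> cell l i = cidx l i :> nat.
  move=> lb; rewrite ffunE inordK// ltnS (leq_trans _ (leq_bigmax i))//.
  by have := cidx_lt l i lb; rewrite ltnS.
pose cells := [set c : {ffun 'I_d -> 'I_Pc.+1} | [forall i, (0 <= c i < 0 + (cn i).+1)%N]].
have cellsn : (#|cells|)%:R <= \prod_i (5 * G i / U i) :> R.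
  apply: (@le_trans _ _ (\prod_i (cn i).+1)%:R).
    by rewrite ler_nat; apply: card_fun_box.
  rewrite natr_prod; apply: ler_prod => i _; rewrite ler0n/=.
  rewrite -natr1; have h1 : 1 <= G i / U i by rewrite ler_pdivlMr// mul1r.
  have : (cn i)%:R <= 4 * G i / U i by rewrite truncn_le; lra.
  lra.
have r0 : 0 <= (\prod_i K i)%:R * (48 * Del / Psi) :> R.
  by rewrite mulr_ge0// divr_ge0 ?(ltW Psi0)// mulr_ge0// ltW.
apply: (@le_trans _ _ (#|cells|%:R * ((\prod_i K i)%:R * (48 * Del / Psi)))); last first.
  exact: ler_wpM2r.
apply: (card_fiber_le (f := cell)) => [l lb|c _].
  rewrite inE; apply/forallP => i; rewrite cellE//= add0n.
  exact: cidx_lt.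
set bc := [set _ in bad | _].
have [->|[l0]] := set_0Vmem bc; first by rewrite cards0.
rewrite inE => /andP[l0b /eqP l0c].
have near l l' i : l \in bc -> l' \in bc -> `|gam m (v l) i - gam m (v l') i| <= U i / 2.
  rewrite !inE => /andP[lb /eqP lc] /andP[l'b /eqP l'c].
  apply: cidx_near; rewrite ?inE//.
  by rewrite -!cellE ?lc ?l'c ?inE.
have l0bc : l0 \in bc by rewrite inE l0b l0c eqxx.
have bcb l : l \in bc -> l \in bad by rewrite inE => /andP[].
(* By nondegeneracy a bad vector exceeds [U] in some coordinate of [gam]. The same [i] serves the
   whole cell, in which this coordinate varies by at most [U i / 2]. *)
have [i ie Ugam] : exists2 i, i != e & U i < `|gam m (v l0) i|.
  have [nz _ thl] := vP _ l0b; apply: contrapT => H; apply: nz.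
  apply: (nd _ (in_box _ l0b)) => [i ie|]; last by lra.
  by rewrite leNgt; apply/negP => Hi; apply: H; exists i.
pose u := `|gam m (v l0) i| - U i / 2.
have u0 : U i / 2 < u by rewrite /u; have := U0 i; lra.
have u00 : 0 < u by have := U0 i; lra.
have urange l : l \in bc -> u <= `|gam m (v l) i| <= 3 * u.
  by move=> lbc; apply: scale => //; exact: near.
have i0P : (0 < P.+1)%N by [].
(* A line of the grid in direction [i] is represented by its point with index 0. *)
pose rep (l : {ffun 'I_d -> 'I_P.+1}) : {ffun 'I_d -> 'I_P.+1} :=
  [ffun j => if j == i then ord0 else l j].
pose Kl j := if j == i then 1%N else K j.
pose lines := [set l : {ffun 'I_d -> 'I_P.+1} | [forall j, (0 <= l j < 0 + Kl j)%N]].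
have Ki0 : (0 < K i)%N.
  by have := l0b; rewrite inE => /andP[/forallP/(_ i)/(leq_ltn_trans (leq0n _))].
have linesn : (#|lines| * K i <= \prod_j K j)%N.
  apply: (@leq_trans ((\prod_j Kl j) * K i)).
    by rewrite leq_pmul2r//; apply: card_fun_box.
  rewrite (bigD1 i)//= {1}/Kl eqxx mul1n [leqRHS](bigD1 i)//= mulnC leq_pmul2l//.
  by apply: leq_prod => j /negPf ji; rewrite /Kl ji.
apply: (@le_trans _ _ (#|lines|%:R * ((K i)%:R * (48 * Del / Psi)))); last first.
  rewrite mulrA -natrM ler_wpM2r ?ler_nat//.
  by rewrite divr_ge0 ?(ltW Psi0)// mulr_ge0// ltW.
apply: (card_fiber_le (f := rep)) => [l lbc|r _].
  rewrite inE; apply/forallP => j; rewrite ffunE /Kl.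
  case: eqP => //= _; move/bcb: lbc; rewrite inE => /andP[/forallP/(_ j)//].
set A := [set _ in bc | _].
have Abc l : l \in A -> l \in bc by rewrite inE => /andP[].
(* [D1]: for equal classes modulo [m], [th] moves by at most [2 * Del], at a rate of at least
   [u * step i]. [D2]: for different classes, [th] has to move by [Psi / 2], at a rate of at most
   [3 * u * step i]. *)
pose D1 := 2 * Del / (u * step i); pose D2 := Psi / (6 * u * step i).
have us0 : 0 < u * step i by rewrite mulr_gt0.
have D10 : 1 <= D1.
  rewrite /D1 ler_pdivlMr// mul1r; apply: le_trans (Gs _ ie).
  rewrite ler_pM2r//; have /andP[+ _] := urange _ l0bc.
  by move/le_trans; apply; exact: vG.
have D20 : 0 < D2 by rewrite /D2 divr_gt0// -mulrA mulr_gt0.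
have KD2 : 1 <= (K i)%:R / D2.
  rewrite /D2 invf_div mulrA ler_pdivlMr// mul1r (le_trans (UKs _ ie))//.
  rewrite (_ : (K i)%:R * _ = (6 * u) * ((K i)%:R * step i)); last by ring.
  rewrite (_ : 3 * _ * _ * _ = (3 * U i) * ((K i)%:R * step i)); last by ring.
  by apply: half_u => //; rewrite mulr_ge0// ltW.
have Kx : (K i)%:R * (48 * Del / Psi) = 4 * ((K i)%:R / D2) * D1.
  by rewrite /D1 /D2; field; rewrite !gt_eqF.
have Aeq l l' j : l \in A -> l' \in A -> j != i -> l j = l' j.
  rewrite !inE => /andP[_ /eqP lr] /andP[_ /eqP l'r] /negPf ji.
  have := congr1 (fun f : {ffun _} => f j) lr.
  by rewrite -l'r !ffunE ji.
have gsub l l' m' : l \in A -> l' \in A ->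
    th m m' (gridpt y0 step l) - th m m' (gridpt y0 step l')
    = gam m m' i * step i * ((l i)%:R - (l' i)%:R).
  move=> lA l'A; rewrite th_sub (bigD1 i)//= big1 ?addr0 => [|j ji].
    by rewrite /gridpt; ring.
  by rewrite /gridpt (Aeq l l' j lA l'A ji) subrr mulr0.
apply: (@le_trans _ _ (((K i)%:R / D2 + 1) * (D1 + 1))); last first.
  rewrite Kx (_ : 4 * _ * _ = (2 * ((K i)%:R / D2)) * (2 * D1)); last by ring.
  exact: succM.
apply: (@card_sparse R _ A (fun l : {ffun 'I_d -> 'I_P.+1} => nat_of_ord (l i)) (K i) D1 D2).
- exact: le_trans ler01 D10.
- by [].
- move=> l l' lA l'A /= H; apply/ffunP => j; have [->|ji] := eqVneq j i.
    exact: val_inj.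
  exact: (Aeq _ _ _ lA l'A ji).
- by move=> l /Abc/bcb; rewrite inE => /andP[/forallP].
move=> l l' lA l'A.
have [lbc l'bc] := (Abc _ lA, Abc _ l'A).
have [lb l'b] := (bcb _ lbc, bcb _ l'bc).
have [_ _ thl] := vP _ lb; have [_ _ thl'] := vP _ l'b.
have /andP[g1 g2] := urange _ lbc; have /andP[g1' g2'] := urange _ l'bc.
have nle (a g : R) : `|g * step i * a| = `|g| * step i * `|a|.
  by rewrite !normrM (gtr0_norm (step0 i)).
have [zz|nz] := pselect (inZ m (v l - v l')).
  left; have E : th m (v l) (gridpt y0 step l') = th m (v l') (gridpt y0 step l').
    apply/eqP; rewrite -subr_eq0 -thB; have [p ->] := zz.
    by rewrite thMz.
  have := gsub l l' (v l) lA l'A; rewrite E => H.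
  have : `|gam m (v l) i * step i * ((l i)%:R - (l' i)%:R)| <= 2 * Del.
    by rewrite -H; exact: tri.
  rewrite nle => H2; rewrite /D1 ler_pdivlMr//.
  apply: le_trans H2; rewrite mulrC ler_wpM2r// ler_pM2r//.
right.
have thd : Psi <= `|th m (v l - v l') (gridpt y0 step l)|.
  rewrite leNgt; apply/negP => H; apply: nz.
  apply: (nd _ (in_box _ lb)) => // j _; rewrite gamB.
  apply: le_trans (near _ _ j lbc l'bc) _.
  by rewrite ler_pdivrMr// ler_peMr ?ler1n// ltW.
have H := gsub l l' (v l') lA l'A.
have H3 : Psi / 2 <= `|gam m (v l') i * step i * ((l i)%:R - (l' i)%:R)|.
  by rewrite -H; apply: far thl thl' DelPsi _; rewrite -thB.
rewrite nle in H3.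
rewrite /D2 ler_pdivrMr ?mulr_gt0//.
have : Psi / 2 <= 3 * u * step i * `|(l i)%:R - (l' i)%:R|.
  by apply: le_trans H3 _; rewrite ler_wpM2r// ler_pM2r.
exact: third.
Qed.

End BadPoints.

(** Bernoulli's inequality for the powers of 4/3. *)
Lemma exists_small_pow (R : realType) (c : R) : 0 < c -> exists r, (3 / 4) ^+ r <= c.
Proof.
move=> c0; have B r : 1 + r%:R / 3 <= (4 / 3 : R) ^+ r.
  elim: r => [|r IH]; first by rewrite mul0r addr0 expr0.
  rewrite exprS -natr1; apply: (@le_trans _ _ (4 / 3 * (1 + r%:R / 3))).
    by have : 0 <= r%:R :> R by []; lra.
  by rewrite ler_pM2l// divr_gt0.
exists (Num.truncn (3 / c)).+1; set r := (X in X <= _).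
have h : (3 / 4 : R) ^+ (Num.truncn (3 / c)).+1 = ((4 / 3) ^+ (Num.truncn (3 / c)).+1)^-1.
  by rewrite -exprVn invf_div.
rewrite /r h invf_ple ?posrE ?exprn_gt0//; last lra.
apply: le_trans (B _); have := truncnS_gt (3 / c).
have -> : c^-1 = (3 / c) / 3 by field; rewrite gt_eqF.
lra.
Qed.

(** * Grid points that carry children *)

Section GoodPoints.
Context {R : realType} {V : zmodType} {d : nat}.
Context (y : 'I_d -> {additive V -> R}) (k : {additive V -> R}) (e i1 : 'I_d).
Local Notation gam := (gam y e).
Local Notation th := (th y k e).
Local Notation inZ := (@inZ V).

(* [eta] is a vector with small [th] at a grid point [x0], with [gam i1] within a
   factor 3/4 of minimal; [z] is reached from [x0] by sliding along the coordinate
   [i1] until [th] enters [[del, 2 del]]. *)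
Definition goodpt (m : V) (N : 'I_d -> R) (c Del del r : R) (z : 'I_d -> R) (eta : V) :=
  [/\ 0 <= y e eta < y e m, forall i, i != e -> `|gam m eta i| <= N i,
      3 / 4 * (c * N i1) <= gam m eta i1, del <= th m eta z <= 2 * del &
   exists x0, exists lam, [/\ c <= lam <= 1, gam m eta i1 <= lam * N i1, `|th m eta x0| <= Del,
     (forall i, i != i1 -> x0 i = z i) /\ `|x0 i1 - z i1| <= r &
     forall v, `|gam m v i1| <= 3 / 4 * (lam * N i1) ->
       (forall i, i != e -> i != i1 -> `|gam m v i| <= N i) ->
       `|th m v x0| <= Del -> inZ m v]].

(** At most a quarter of the grid is bad, and at most half lies within [S] of the ends of a line in
    direction [i1]. At every other point the vector from Dirichlet's theorem is replaced by shorter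
    ones in the coordinate [i1] until no factor 3/4 can be gained; this stops above [c * N i1]
    because the point is not bad. The point is then slid along [i1] by at most [S] steps, so at most
    [2 * S + 1] points end at the same place. *)
Lemma good_count (m : V) (y0 b U G step N : 'I_d -> R) (K : 'I_d -> nat) (P S : nat)
    (Psi Del del c : R) :
  i1 != e -> 0 < y e m ->
  (forall x, inbox e y0 b x -> forall v, (forall i, i != e -> `|gam m v i| <= U i) ->
     `|th m v x| < Psi -> inZ m v) ->
  (forall x, exists v, [/\ ~ inZ m v, forall i, i != e -> `|gam m v i| <= N i
     & `|th m v x| <= Del]) ->
  (forall i, 0 < U i <= G i) -> (forall i, 0 < step i) ->
  (forall i, (K i)%:R * step i <= b i) -> (forall i, K i <= P.+1)%N ->
  0 < c <= 1 -> G i1 = c * N i1 -> (forall i, i != e -> i != i1 -> G i = N i) ->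
  0 < N i1 ->
  0 < del <= Del -> 4 * Del <= Psi ->
  (forall i, i != e -> G i * step i <= 2 * Del) ->
  (forall i, i != e -> Psi <= 3 * U i * (K i)%:R * step i) ->
  4 * ((\prod_i (5 * G i / U i)) * (48 * Del / Psi)) <= 1 ->
  N i1 * step i1 <= del -> (Del + del) / (3 / 4 * (c * N i1) * step i1) + 1 <= S%:R ->
  (4 * S <= K i1)%N ->
  exists good : {set {ffun 'I_d -> 'I_P.+1}}, exists eta : {ffun 'I_d -> 'I_P.+1} -> V,
    [/\ forall l, l \in good -> goodpt m N c Del del (S%:R * step i1) (gridpt y0 step l) (eta l),
        forall l, l \in good -> forall i, (l i < K i)%N &
        (\prod_i K i <= 4 * (2 * S + 1) * #|good|)%N].
Proof.
have p34 : 0 < 3 / 4 :> R by rewrite divr_gt0.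
have q34 : 3 / 4 <= 1 :> R by lra.
have step_in (a x z D : R) : D - a <= x -> x < D - a + z -> z <= D -> D <= a + x <= 2 * D.
  by move=> h1 h2 h3; apply/andP; split; lra.
have near_int (a x z : R) : a <= x -> x < a + 1 -> `|a| <= z -> `|x| <= z + 1.
  by rewrite !ler_norml => h1 h2 /andP[h3 h4]; apply/andP; split; lra.
move=> i1e q0 nd dir UG step0 Kb KP /andP[c0 c1] G1 GN N10 /andP[del0 delDel] DelPsi Gs UKs
  prodB Nstep HS SK.
have Del0 : 0 < Del by lra.
pose grid := [set l : {ffun 'I_d -> 'I_P.+1} | [forall i, (l i < K i)%N]].
have gridE : #|grid| = (\prod_i K i)%N by exact: card_fun_box0.
have := bad_count (lt0r_neq0 q0) nd UG step0 Kb KP Del0 DelPsi Gs UKs.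
set bad := [set _ | _] => badn.
have {}badn : (4 * #|bad| <= #|grid|)%N.
  rewrite -(ler_nat R) natrM gridE.
  set X := \prod_i (5 * G i / U i) in badn prodB; set Y := 48 * Del / Psi in badn prodB.
  set Z := ((\prod_i K i)%N)%:R in badn *.
  have Z0 : 0 <= Z by [].
  have : 4 * #|bad|%:R <= 4 * (X * (Z * Y)) by rewrite ler_wpM2l.
  move/le_trans; apply; rewrite (_ : 4 * _ = Z * (4 * (X * Y))); last by ring.
  by rewrite ler_piMr.
pose mid := [set l in grid | (S <= l i1)%N && (l i1 < K i1 - S)%N].
have midn : (#|grid| <= 2 * #|mid|)%N.
  pose nS j := if j == i1 then S else K j.
  pose lo2 j := if j == i1 then (K i1 - S)%N else 0%N.
  have cS : (4 * \prod_j nS j <= #|grid|)%N.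
    rewrite gridE (bigD1 i1)//= [leqRHS](bigD1 i1)//= /nS eqxx mulnA leq_mul//.
    by apply: leq_prod => j /negPf ->.
  pose lo1 (j : 'I_d) := 0%N.
  have sub : grid :\: mid \subset
      [set l : {ffun 'I_d -> 'I_P.+1} | [forall i, (lo1 i <= l i < lo1 i + nS i)%N]]
     :|: [set l : {ffun 'I_d -> 'I_P.+1} | [forall i, (lo2 i <= l i < lo2 i + nS i)%N]].
    apply/subsetP => l; rewrite !inE => /andP[lm lg]; rewrite lg/= in lm.
    move: lm; rewrite negb_and -ltnNge -leqNgt => lm.
    have lg' := forallP lg; case/orP: lm => H; apply/orP; [left|right].
      apply/forallP => j; rewrite /lo1 add0n/= /nS; case: eqP => [->//|_]; exact: lg'.
    apply/forallP => j; rewrite /lo2 /nS; case: eqP => [->|_]; last by rewrite add0n lg'.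
    by rewrite H/= subnK ?lg'//; apply: leq_trans SK; rewrite leq_pmull.
  have := subset_leq_card sub => /leq_trans/(_ (leq_card_setU _ _)).
  have b1 := card_fun_box P.+1 lo1 nS; have b2 := card_fun_box P.+1 lo2 nS.
  have := cardsID mid grid; rewrite (setIidPr _); last first.
    by apply/subsetP => l; rewrite !inE => /andP[].
  move: cS b1 b2; set n1 := #|mid|; set n2 := #|grid :\: mid|; set n3 := #|grid|.
  set b1 := #|[set l | _]|; set b2 := #|[set l | _]|; set pp := (\prod_j nS j)%N.
  clear; move=> *; lia.
pose nb := mid :\: bad.
have nbn : (#|grid| <= 4 * #|nb|)%N.
  have := cardsID bad mid; have := subset_leq_card (subsetIr mid bad).
  rewrite -/nb; move: badn midn; clear; set a := #|mid :&: bad|; lia.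
pose good := [set l : {ffun 'I_d -> 'I_P.+1} | (l \in grid) && `[< exists eta,
  goodpt m N c Del del (S%:R * step i1) (gridpt y0 step l) eta >]].
have key l : l \in nb -> exists l', [/\ l' \in good, forall j, j != i1 -> l' j = l j,
   (l' i1 <= l i1 + S)%N & (l i1 <= l' i1 + S)%N].
  rewrite !inE => /and4P[lbad lg lS lK].
  have nbad v : (forall i, i != e -> `|gam m v i| <= G i) ->
      `|th m v (gridpt y0 step l)| <= Del -> inZ m v.
    move=> h1 h2; apply: contrapT => h3; move: lbad; rewrite lg/= => /asboolP; apply.
    by exists v.
  (* [E 0] is Dirichlet's theorem, and [E r] fails once [(3 / 4)^r] is at most [c]. A vector for an
     [r] with [E r] but not [E r.+1] is minimal up to the factor 3/4. *)
  pose E r := exists v, [/\ ~ inZ m v, `|gam m v i1| <= (3 / 4) ^+ r * N i1,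
     forall i, i != e -> i != i1 -> `|gam m v i| <= N i & `|th m v (gridpt y0 step l)| <= Del].
  have nE r : (3 / 4) ^+ r <= c -> ~ E r.
    move=> rc [v [nz v1 vN vth]]; apply: nz; apply: nbad => // i ie.
    have [->|ii] := eqVneq i i1; last by rewrite GN//; exact: vN.
    by rewrite G1 (le_trans v1)// ler_pM2r.
  have [r [Er nEr]] : exists r, E r /\ ~ E r.+1.
    apply: contrapT => H; have Eall r : E r.
      elim: r => [|r Er]; last by apply: contrapT => nEr; apply: H; exists r.
      have [v [nz vN vth]] := dir (gridpt y0 step l); exists v; split=> //.
        by rewrite expr0 mul1r; exact: vN.
      by move=> i ie _; exact: vN.
    have [r rc] := exists_small_pow c0; exact: (nE r rc).
  pose lam : R := (3 / 4) ^+ r.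
  have lamc : c < lam by rewrite ltNge; apply/negP => /nE.
  have lam1 : lam <= 1 by apply: exprn_ile1 => //; exact: ltW.
  have [v0 [nz0 v01 v0N v0th]] := Er; rewrite -/lam in v01.
  have v0l : 3 / 4 * (lam * N i1) < `|gam m v0 i1|.
    rewrite ltNge; apply/negP => H; apply: nEr; exists v0; split=> //.
    by rewrite exprS -/lam -mulrA.
  have [v1 [nz v1g v1l v1N v1th]] : exists v, [/\ ~ inZ m v,
       0 < gam m v i1, 3 / 4 * (lam * N i1) < gam m v i1 <= lam * N i1,
       forall i, i != e -> i != i1 -> `|gam m v i| <= N i
       & `|th m v (gridpt y0 step l)| <= Del].
    have lN : 0 < lam * N i1 by rewrite mulr_gt0// (lt_trans c0).
    have [g0|g0] := leP 0 (gam m v0 i1).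
      rewrite ger0_norm// in v0l v01; exists v0; split=> //.
        by apply: lt_trans v0l; exact: mulr_gt0.
      by rewrite v0l v01.
    have gN u i : gam m (- u) i = - gam m u i.
      by rewrite -[- u]sub0r gamB -(mulr0z m) gamMz ?sub0r// gt_eqF.
    have tN u z : th m (- u) z = - th m u z.
      by rewrite -[- u]sub0r thB -(mulr0z m) thMz ?sub0r// gt_eqF.
    rewrite ltr0_norm// in v0l v01; exists (- v0); split.
    - by move/inZN; rewrite opprK.
    - by rewrite gN oppr_gt0.
    - by rewrite gN v0l v01.
    - by move=> i ie ii; rewrite gN normrN; exact: v0N.
    - by rewrite tN normrN.
  (* Reduction modulo [m] brings [y e] into [[0, y e m)] and changes neither [gam] nor [th]. *)
  pose fl := Num.floor (y e v1 / y e m).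
  pose eta := v1 - m *~ fl.
  have q00 : y e m != 0 by rewrite gt_eqF.
  have gE i : gam m eta i = gam m v1 i by rewrite gamB gamMz// subr0.
  have tE z : th m eta z = th m v1 z by rewrite thB thMz// subr0.
  have etae : 0 <= y e eta < y e m.
    rewrite raddfB/= addMz.
    have a1 := floor_le (y e v1 / y e m); have a2 := lt_succ_floor (y e v1 / y e m).
    rewrite -/fl in a1 a2; rewrite intrD in a2.
    rewrite ler_pdivlMr// in a1; rewrite ltr_pdivrMr// in a2.
    by rewrite subr_ge0 a1/= ltrBlDr; move: a2; rewrite mulrDl mul1r addrC.
  have eta0 : ~ inZ m eta.
    move=> [p pE]; apply: nz; exists (p + fl); rewrite mulrzDr -pE /eta subrK//.
  pose mu := gam m eta i1 * step i1.
  have mu0 : 0 < mu by rewrite /mu gE mulr_gt0.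
  have mul : 3 / 4 * (c * N i1) * step i1 <= mu.
    rewrite /mu gE ler_pM2r//; move: v1l => /andP[/ltW + _]; apply: le_trans.
    by rewrite ler_pM2l// ler_pM2r// ltW.
  have muu : mu <= del.
    apply: le_trans Nstep; rewrite /mu gE ler_pM2r//; move: v1l => /andP[_ h].
    by apply: le_trans h _; rewrite ler_piMl// ltW.
  pose t0 := th m eta (gridpt y0 step l).
  have t0D : `|t0| <= Del by rewrite /t0 tE.
  (* One grid step along [i1] changes [th] by [mu], at most [del], so the sliding cannot jump over
     [[del, 2 * del]]. *)
  pose z := Num.ceil ((del - t0) / mu).
  have z1 : (del - t0) / mu <= z%:~R by exact: ceil_ge.
  have z2 : z%:~R < (del - t0) / mu + 1.
    by have := gt_pred_ceil ((del - t0) / mu); rewrite -/z intrB ltrBlDr.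
  have tz : del <= t0 + z%:~R * mu <= 2 * del.
    rewrite ler_pdivrMr// in z1.
    have : z%:~R * mu < (del - t0) + mu.
      by rewrite -ltr_pdivlMr// mulrDl divff ?gt_eqF.
    by move/step_in; apply.
  have muS : (Del + del) / mu + 1 <= S%:R.
    apply: le_trans HS; rewrite lerD2r; apply: ler_wpM2l; first by rewrite addr_ge0 ?ltW.
    have cN0 : 0 < 3 / 4 * (c * N i1) * step i1 by apply: mulr_gt0 => //; apply: mulr_gt0 => //; exact: mulr_gt0.
    by rewrite lef_pV2 ?posrE.
  have zS : `|z%:~R| <= S%:R :> R.
    apply: le_trans muS.
    have h : `|(del - t0) / mu| <= (Del + del) / mu.
      rewrite normrM normfV (gtr0_norm mu0) ler_pM2r ?invr_gt0//.
      by rewrite (le_trans (ler_normB _ _))// (gtr0_norm del0) addrC lerD2r.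
    exact: near_int z1 z2 h.
  have zS' : (`|z| <= S)%N by rewrite -(ler_nat R) natr_absz intr_norm.
  pose az : nat := absz ((l i1)%:Z + z)%R.
  have zlK : (0 <= (l i1)%:Z + z) && (az < K i1)%N.
    by rewrite /az; move: zS' lS lK; clear; lia.
  pose l' : {ffun 'I_d -> 'I_P.+1} :=
    [ffun j => if j == i1 then inord az else l j].
  have l'1 : l' i1 = az :> nat.
    rewrite ffunE eqxx inordK//; case/andP: zlK => _ h.
    exact: leq_trans h (KP _).
  have l'g : l' \in grid.
    rewrite inE; apply/forallP => j; rewrite ffunE; case: eqP => [->|_]; last first.
      exact: (forallP lg).
    by case/andP: zlK => _ h; rewrite inordK// (leq_trans h (KP _)).
  have pt' j : j != i1 -> gridpt y0 step l' j = gridpt y0 step l j.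
    by move=> /negPf ji; rewrite /gridpt ffunE ji.
  have pt1 : gridpt y0 step l' i1 = gridpt y0 step l i1 + z%:~R * step i1.
    rewrite /gridpt l'1 -addrA; congr (_ + _); rewrite -mulrDl; congr (_ * _).
    case/andP: zlK => h _; have -> : az%:R = (az%:Z)%:~R :> R by [].
    have -> : (l i1)%:R = ((l i1)%:Z)%:~R :> R by [].
    by rewrite -intrD /az gez0_abs.
  exists l'; split.
  - rewrite inE l'g; apply/asboolP; exists eta; split=> //.
    + move=> i ie; rewrite gE; have [->|ii] := eqVneq i i1; last exact: v1N.
      rewrite ger0_norm ?(ltW v1g)//; case/andP: v1l => _ h; apply: le_trans h _.
      by rewrite ler_piMl// ltW.
    + rewrite gE; case/andP: v1l => /ltW + _; apply: le_trans.
      by rewrite ler_pM2l// ler_pM2r// ltW.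
    + rewrite (_ : th m eta _ = t0 + z%:~R * mu)//.
      apply/eqP; rewrite addrC -subr_eq; apply/eqP; rewrite /t0 th_sub (bigD1 i1)//=.
      rewrite big1 => [|j ji]; last by rewrite pt'// subrr mulr0.
      by rewrite pt1 /mu; ring.
    + exists (gridpt y0 step l), lam; split.
      * by rewrite ltW.
      * by rewrite gE; case/andP: v1l.
      * exact: t0D.
      * split; first by move=> i /pt'.
        rewrite pt1 opprD addrA subrr sub0r normrN normrM (gtr0_norm (step0 _)).
        by rewrite ler_pM2r.
      * move=> v h1 h2 h3; apply: contrapT => h4; apply: nEr; exists v; split=> //.
        by rewrite exprS -/lam -mulrA.
  - by move=> j /negPf ji; rewrite ffunE ji.
  - by rewrite l'1 /az; move: zS' lS lK zlK; clear; lia.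
  - by rewrite l'1 /az; move: zS' lS lK zlK; clear; lia.
have /choice[f fP] l : exists l', l \in nb -> [/\ l' \in good, forall j, j != i1 -> l' j = l j,
   (l' i1 <= l i1 + S)%N & (l i1 <= l' i1 + S)%N].
  have [/key[l' h]|h] := boolP (l \in nb); first by exists l'.
  by exists l.
have /choice[eta etaP] l : exists eta, l \in good ->
    goodpt m N c Del del (S%:R * step i1) (gridpt y0 step l) eta.
  have [|h] := boolP (l \in good); last by exists 0.
  by rewrite inE => /andP[_ /asboolP[eta h]]; exists eta.
exists good, eta; split=> //.
  by move=> l; rewrite !inE => /andP[/forallP].
have : (#|nb|%:R <= #|good|%:R * (2 * S + 1)%:R :> R).
  apply: (card_fiber_le (f := f)) => [l /fP[]//|l' _].
  pose n j := if j == i1 then (2 * S + 1)%N else 1%N.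
  pose lo j := if j == i1 then (l' i1 - S)%N else nat_of_ord (l' j).
  apply: (@le_trans _ _ (\prod_j n j)%:R).
    rewrite ler_nat; apply: leq_trans (card_fun_box P.+1 lo n).
    apply/subset_leq_card/subsetP => l; rewrite inE => /andP[lnb /eqP fl].
    have [h1 h2 h3 h4] := fP l lnb; rewrite inE.
    apply/forallP => j; rewrite /lo /n.
    case: eqP => [->|/eqP ji]; last by rewrite -fl h2// leqnn addn1/=.
    rewrite fl in h3 h4; move: h3 h4; clear;
    set a1 := nat_of_ord (l i1); set a2 := nat_of_ord (l' i1) => h3 h4; lia.
  by rewrite (bigD1 i1)//= {1}/n eqxx big1 ?muln1// => j /negPf ji; rewrite /n ji.
rewrite -natrM ler_nat -gridE => h; apply: leq_trans nbn _.
by rewrite -mulnA leq_pmul2l// mulnC.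
Qed.

End GoodPoints.

(** * Children inherit the invariants of their parent *)

Section Child.
Context {R : realType} {V : zmodType} {d : nat}.
Context (y : 'I_d -> {additive V -> R}) (k : {additive V -> R}) (e i1 : 'I_d).
Local Notation gam := (gam y e).
Local Notation th := (th y k e).
Local Notation phi := (phi y k).
Local Notation inZ := (@inZ V).
Local Notation goodpt := (goodpt y k e i1).

(* The last clause says that the quotient by [nu.1] has no short vector above the
   box of [nu]. *)
Definition nodeinv (A Ah lo Psi : R) (N U b : 'I_d -> R) (nu : V * ('I_d -> R)) :=
  [/\ A <= y e nu.1 <= Ah, forall i, i != e -> `|y i nu.1| <= 2 * N i,
      lo <= y i1 nu.1 &
      forall x, inbox e nu.2 b x -> forall v,
        (forall i, i != e -> `|gam nu.1 v i| <= U i) ->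
        `|th nu.1 v x| < Psi -> inZ nu.1 v].

Definition region (b : 'I_d -> R) (rho : R) (nu : V * ('I_d -> R)) (x : 'I_d -> R) :=
  inbox e nu.2 b x /\ `|phi nu.1 x| <= rho.

Lemma gam_shift m eta j i : y e m != 0 -> gam m (eta + m *~ j) i = gam m eta i.
Proof.
move=> q0; have := gamB y e m (eta + m *~ j) (m *~ j) i.
by rewrite addrK gamMz// subr0.
Qed.

Lemma th_shift m eta j x : y e m != 0 -> th m (eta + m *~ j) x = th m eta x.
Proof.
move=> q0; have := thB y k e m (eta + m *~ j) (m *~ j) x.
by rewrite addrK thMz// subr0.
Qed.

Context (m eta : V) (z b' N N' : 'I_d -> R) (A Ah c Del del r g : R) (J j : nat).
Context (i1e : i1 != e) (A0 : 0 < A) (qA : A <= y e m <= Ah)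
  (mN : forall i, i != e -> `|y i m| <= 2 * N i) (m1 : 0 <= y i1 m)
  (gd : goodpt m N' c Del del r z eta) (c0 : 0 < c) (del0 : 0 < del)
  (g0 : 0 < g) (gJ : g <= J%:R <= 2 * g) (J0 : (0 < J)%N) (Jj : (J <= j < 2 * J)%N)
  (gN : forall i, i != e -> 8 * g * N i <= N' i)
  (b'0 : forall i, 0 <= b' i) (N'0 : forall i, 0 <= N' i)
  (Nb : \sum_(i | i != e) N' i * b' i <= del / 2).

Let m' := eta + m *~ j.
Let q0 : 0 < y e m. Proof. by case/andP: qA => + _; apply: lt_le_trans. Qed.
Let q1 : y e m != 0. Proof. by rewrite gt_eqF. Qed.

Let q'E : y e m' = y e eta + j%:R * y e m.
Proof. by rewrite /m' raddfD/= addMz. Qed.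

Let jg : g <= j%:R.
Proof.
by case/andP: gJ => + _; move/le_trans; apply; rewrite ler_nat; case/andP: Jj.
Qed.

Let jg' : j%:R + 1 <= 4 * g.
Proof.
case/andP: gJ => _ J2; case/andP: Jj => _ jJ.
apply: (@le_trans _ _ (2 * J)%:R); first by rewrite natr1 ler_nat.
by rewrite natrM; lra.
Qed.

Lemma child_last : g * y e m <= y e m' <= 4 * g * y e m.
Proof.
have [/andP[e0 e1] _ _ _ _] := gd; rewrite q'E; apply/andP; split.
  by rewrite -[leLHS]add0r lerD// ler_pM2r.
apply: (@le_trans _ _ ((j%:R + 1) * y e m)); first by rewrite mulrDl mul1r addrC lerD2l ltW.
by rewrite ler_pM2r.
Qed.

Let q'0 : 0 < y e m'.
Proof. by case/andP: child_last => + _; apply: lt_le_trans; rewrite mulr_gt0. Qed.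
Let q'1 : y e m' != 0. Proof. by rewrite gt_eqF. Qed.

Let ratio : (4 * g)^-1 <= y e m / y e m' <= g^-1.
Proof.
have /andP[h1 h2] := child_last.
rewrite ler_pdivlMr// ler_pdivrMr// ![_^-1 * _]mulrC ler_pdivrMr ?mulr_gt0//.
by rewrite ler_pdivlMr// mulrC h2 mulrC h1.
Qed.

Lemma th_child_range x : inbox e z b' x -> del / 2 <= th m eta x <= 3 * del.
Proof.
move=> xz; have [_ eN _ tz _] := gd.
have : `|th m eta x - th m eta z| <= del / 2.
  apply: le_trans Nb; rewrite th_sub (bigD1 e)//= gam_last// mul0r add0r.
  apply: le_trans (ler_norm_sum _ _ _) _; apply: ler_sum => i ie.
  rewrite normrM; apply: ler_pM => //; first exact: eN.
  by have /andP[h1 h2] := xz i ie; rewrite ger0_norm; lra.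
by rewrite ler_norml; lra.
Qed.

(** On the slab of the child, [phi m'] is small against [th m eta], and [phi_th] turns the latter,
    of order [del], into [phi m], of order [del / g]. The upper bound nests the slab in that of the
    parent; the lower bound separates siblings. *)
Lemma phi_child_range x (rho' : R) : inbox e z b' x -> `|phi m' x| <= rho' -> rho' <= del / 4 ->
  del / (16 * g) <= `|phi m x| <= 4 * del / g.
Proof.
move=> xz px rd; have d0 := del0; have /andP[t1 t2] := th_child_range xz.
rewrite (phi_th k q1 x q'1) th_shift// normrM.
have rp : 0 < y e m / y e m' by rewrite divr_gt0.
rewrite (gtr0_norm rp); move: px; rewrite ler_norml => px.
have h : del / 4 <= `|phi m' x - th m eta x| <= 4 * del.
  by rewrite ler0_norm; lra.
have /andP[r1 r2] := ratio; have /andP[h1 h2] := h; apply/andP; split.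
  rewrite (_ : _ / _ = (4 * g)^-1 * (del / 4)); last by field; rewrite gt_eqF.
  by apply: ler_pM => //; [rewrite invr_ge0 mulr_ge0// ltW | lra].
by rewrite [leRHS]mulrC; apply: ler_pM => //; rewrite ltW.
Qed.

Lemma child_coord i : i != e -> `|y i m'| <= 2 * N' i.
Proof.
move=> ie; have [_ eN _ _ _] := gd.
have -> : y i m' = gam m eta i + y e m' / y e m * y i m.
  by rewrite -(gam_shift eta j i q1) /gam -/m' subrK.
apply: le_trans (ler_normD _ _) _.
have h : `|y e m' / y e m * y i m| <= N' i.
  rewrite normrM; apply: le_trans (gN ie).
  rewrite (_ : 8 * _ * _ = 4 * g * (2 * N i)); last by ring.
  apply: ler_pM => //; last exact: mN.
  have rp : 0 <= y e m' / y e m by rewrite divr_ge0 ?ltW.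
  rewrite (ger0_norm rp) ler_pdivrMr//.
  by case/andP: child_last.
by have := eN i ie; lra.
Qed.

Lemma child_first : 3 / 4 * (c * N' i1) <= y i1 m'.
Proof.
have [_ _ e1 _ _] := gd.
have -> : y i1 m' = gam m eta i1 + y e m' / y e m * y i1 m.
  by rewrite -(gam_shift eta j i1 q1) /gam -/m' subrK.
by rewrite (le_trans e1)// lerDl mulr_ge0// divr_ge0 ?ltW.
Qed.

(** Reduce [v] modulo [m'] until its coordinate [e] is at most half of that of [m']. Modulo [m] it
    is then at most half of the bound on [eta] plus a small error in the coordinate [i1], which
    stays below the factor 3/4 of near minimality, so it is a multiple of [m]. A nonzero multiple of
    [m] has a [th m'] value of at least [del / (8 * g)], so the multiple is 0. *)
Lemma child_nondeg (U' : 'I_d -> R) (Psi' : R) :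
  del <= Del -> r * (c * N' i1) / 64 <= Del / 8 -> Psi' <= Del / 8 -> Psi' <= del / (8 * g) ->
  U' i1 = c * N' i1 / 64 -> (forall i, i != e -> i != i1 -> U' i = N' i / 4) -> 0 <= r ->
  forall x, inbox e z b' x -> forall v,
    (forall i, i != e -> `|gam m' v i| <= U' i) -> `|th m' v x| < Psi' -> inZ m' v.
Proof.
have dist_in (a0 b0 s : R) : a0 <= s <= a0 + b0 -> `|a0 - s| <= b0.
  by move=> /andP[? ?]; rewrite ler0_norm; lra.
move=> dD rD PD Pd U1 UN r0 x xz v vU vth; have d0 := del0.
have [_ eN _ _ [x0 [lam [/andP[cl l1] el x0D [x0z x0r] minl]]]] := gd.
pose p := Num.floor (y e v / y e m' + 1 / 2).
pose u := v - m' *~ p.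
have guE i : gam m' u i = gam m' v i by rewrite gamB gamMz// subr0.
have tuE w : th m' u w = th m' v w by rewrite thB thMz// subr0.
pose tau := y e u / y e m'.
have tau12 : `|tau| <= 1 / 2.
  rewrite /tau raddfB/= addMz mulrBl mulfK//.
  have a1 := floor_le (y e v / y e m' + 1 / 2); rewrite -/p in a1.
  have a2 := lt_succ_floor (y e v / y e m' + 1 / 2); rewrite -/p intrD in a2.
  by rewrite ler_norml; move: a1 a2; move: (y e v / y e m') (p%:~R : R) => s t; rewrite -[1%:~R]/(1 : R) => *; lra.
have N10 : 0 <= c * N' i1 by rewrite mulr_ge0// ltW.
have c1 : c <= 1 by lra.
have cN : c * N' i1 <= N' i1 by rewrite ler_piMl.
have UN4 i : i != e -> U' i <= N' i / 4.
  move=> ie; have [->|ii] := eqVneq i i1; last by rewrite UN.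
  by rewrite U1; lra.
have lN : c * N' i1 <= lam * N' i1 by rewrite ler_wpM2r.
have gu i : gam m u i = gam m' u i + tau * gam m eta i.
  by rewrite (gam_change q1 _ _ q'1) gam_shift.
have tu w : th m u w = th m' u w + tau * th m eta w.
  by rewrite (th_change k q1 _ _ q'1) th_shift.
have uZ : inZ m u.
  apply: minl.
  - rewrite gu (le_trans (ler_normD _ _))// guE normrM.
    have e1 : `|gam m eta i1| <= lam * N' i1.
      have [_ _ e3 _ _] := gd; rewrite ger0_norm//; apply: le_trans e3.
      by rewrite mulr_ge0//; lra.
    have : `|tau| * `|gam m eta i1| <= 1 / 2 * (lam * N' i1) by apply: ler_pM.
    by have := vU i1 i1e; rewrite U1; lra.
  - move=> i ie ii; rewrite gu (le_trans (ler_normD _ _))// guE normrM.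
    have : `|tau| * `|gam m eta i| <= 1 / 2 * N' i by apply: ler_pM => //; exact: eN.
    have := vU i ie; rewrite UN//; have := N'0 i; lra.
  - rewrite tu (le_trans (ler_normD _ _))// normrM.
    have h2 : `|tau| * `|th m eta x0| <= 1 / 2 * Del by apply: ler_pM.
    suff : `|th m' u x0| <= Del / 2 by lra.
    (* Near minimality is known at [x0] only. The way there from [x] costs [del / 8] inside the box
       and [Del / 8] for the sliding distance [r]. *)
    have h3 : `|th m' u x0 - th m' u x| <= del / 8 + Del / 8.
      rewrite th_sub (bigD1 e)//= gam_last// mul0r add0r.
      rewrite (bigD1 i1)//= (le_trans (ler_normD _ _))//.
      have hi i : i != e -> `|gam m' u i| * b' i <= N' i * b' i / 4.
        move=> ie; have := UN4 i ie; have := vU i ie; rewrite -guE => a1 a2.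
        by rewrite mulrAC ler_wpM2r//; lra.
      have h4 : `|gam m' u i1 * (x0 i1 - x i1)| <= N' i1 * b' i1 / 4 + Del / 8.
        rewrite normrM; apply: (@le_trans _ _ (`|gam m' u i1| * (b' i1 + r))).
          rewrite ler_wpM2l//; have /andP[a1 a2] := xz i1 i1e.
          by move: x0r; rewrite !ler_norml; lra.
        rewrite mulrDr lerD ?hi//; apply: le_trans rD.
        rewrite mulrC -mulrA ler_wpM2l//.
        by have := vU i1 i1e; rewrite -guE U1.
      have h5 : `|\sum_(i < d | (i != e) && (i != i1)) gam m' u i * (x0 i - x i)|
          <= \sum_(i < d | (i != e) && (i != i1)) N' i * b' i / 4.
        apply: le_trans (ler_norm_sum _ _ _) _; apply: ler_sum => i /andP[ie ii].
        apply: le_trans (hi i ie); rewrite normrM ler_wpM2l// x0z//.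
        exact: dist_in (xz i ie).
      have h6 : \sum_(i < d | i != e) N' i * b' i / 4 <= del / 8.
        by rewrite -mulr_suml; have := Nb; lra.
      rewrite (bigD1 i1)//= in h6; lra.
    have h7 : `|th m' u x| < Psi' by rewrite tuE.
    by have := ler_normD (th m' u x0 - th m' u x) (th m' u x); rewrite subrK; lra.
have [p' uE] := uZ.
have p'0 : p' = 0.
  have : `|th m' u x| < Psi' by rewrite tuE.
  have /andP[t1 _] := th_child_range xz; have /andP[r1 _] := ratio.
  rewrite uE -(subr0 (m *~ p')).
  have -> : th m' (m *~ p' - 0) x = p'%:~R * th m' m x.
    by rewrite subr0 /th phiMz addMz; ring.
  rewrite (th_swap k q1 x q'1) th_shift// normrM normrM normrN.
  have h : del / (8 * g) <= `|y e m / y e m'| * `|th m eta x|.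
    rewrite (_ : _ / _ = (4 * g)^-1 * (del / 2)); last by field; rewrite gt_eqF.
    have t0 : 0 <= th m eta x by apply: le_trans t1; rewrite divr_ge0 ?ltW.
    have rp : 0 <= y e m / y e m' by rewrite divr_ge0 ?ltW.
    rewrite (ger0_norm t0) (ger0_norm rp).
    by apply: ler_pM => //; [rewrite invr_ge0 mulr_ge0// ltW | rewrite divr_ge0 ?ltW].
  move=> H; apply/eqP; rewrite -normr_le0 leNgt gtz0_ge1; apply/negP => p1.
  have : 1 <= `|p'%:~R| :> R by rewrite -intr_norm ler1z.
  move=> p1R; have h0 : 0 <= `|y e m / y e m'| * `|th m eta x| by rewrite mulr_ge0.
  have := ler_wpM2r h0 p1R; rewrite mul1r => /(le_trans h)/(le_trans Pd).
  by rewrite leNgt H.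
exists p; move: uE; rewrite p'0 mulr0z /u => /eqP; rewrite subr_eq0 => /eqP ->.
by [].
Qed.

End Child.

Lemma size_close (R : realType) (s : seq nat) (D : R) : uniq s -> 0 <= D ->
  (forall a b, a \in s -> b \in s -> `|a%:R - b%:R| <= D) -> (size s)%:R <= 2 * D + 1.
Proof.
case: s => [|a s] us D0 h; first by rewrite addr_ge0// mulr_ge0.
apply: (@le_trans _ _ (2 * Num.truncn D + 1)%:R); last first.
  by rewrite natrD natrM lerD2r ler_pM2l// truncn_le.
rewrite ler_nat -[leqRHS](size_iota (a - Num.truncn D)); apply: uniq_leq_size => // b bs.
have := h a b (mem_head _ _) bs; rewrite mem_iota => hb.
have : (`|a - b| <= Num.truncn D)%N.
  rewrite truncn_ge_nat//; apply: le_trans hb; rewrite natr_absz intr_norm intrB.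
  by rewrite -[X in X <= _]/(`|a%:R - b%:R|).
by clear; lia.
Qed.

(** * Children that meet a box *)

Section Hits.
Context {R : realType} {V : zmodType} {d : nat}.
Context (y : 'I_d -> {additive V -> R}) (k : {additive V -> R}) (e i1 : 'I_d).
Local Notation phi := (phi y k).
Local Notation goodpt := (goodpt y k e i1).
Local Notation region := (region y k e).

Definition hit (b : 'I_d -> R) (rho : R) (a t : 'I_d -> R) (nu : V * ('I_d -> R)) : bool :=
  `[< exists x, (forall i, a i <= x i <= a i + t i) /\ region b rho nu x >].

Definition children P (m : V) (y0 step : 'I_d -> R) (J : nat)
    (eta : {ffun 'I_d -> 'I_P.+1} -> V) (L : seq {ffun 'I_d -> 'I_P.+1}) :=
  [seq (eta l + m *~ j%:Z, gridpt y0 step l) | l <- L, j <- iota J J].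

(** The step is twice the side of a cell, so a box no longer than a cell is met for at most three
    consecutive indices in each direction other than [i1]; only in that direction does the length of
    the box count. *)
Lemma count_grid_boxes (P : nat) (y0 step b a t : 'I_d -> R) (L : seq {ffun 'I_d -> 'I_P.+1}) :
  i1 != e -> uniq L -> (forall l, l \in L -> l e = ord0) ->
  (forall i, i != e -> step i = 2 * b i) -> (forall i, 0 < b i) -> (forall i, 0 <= t i) ->
  (forall i, i != e -> i != i1 -> t i <= b i) ->
  (count (fun l => `[< exists x, (forall i, a i <= x i <= a i + t i) /\
     inbox e (gridpt y0 step l) b x >]) L)%:R <= (3 ^ d)%:R * (t i1 / step i1 + 3) :> R.
Proof.
move=> i1e uL Le stepE b0 t0 tb.
pose lo i : nat := if i == e then 0%N else Num.truncn ((a i - y0 i - b i) / step i).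
pose n i : nat := if i == i1 then (Num.truncn ((t i1 + b i1) / step i1)).+2 else 3%N.
have st0 i : i != e -> 0 < step i by move=> ie; rewrite stepE// mulr_gt0.
apply: (@le_trans _ _ (\prod_i n i)%N%:R).
  rewrite ler_nat; apply: leq_trans (card_fun_box P.+1 lo n).
  rewrite -size_filter -(card_uniqP (filter_uniq _ uL)).
  apply/subset_leq_card/fintype.subsetP => l; rewrite mem_filter => /andP[/asboolP[x [xa xb]] lL].
  rewrite inE; apply/forallP => i; rewrite /lo; case: eqP => [->|/eqP ie].
    by rewrite Le//= add0n /n eq_sym (negbTE i1e).
  have /andP[a1 a2] := xa i; have /andP[b1 b2] := xb i ie; rewrite /gridpt in b1 b2.
  have h1 : (a i - y0 i - b i) / step i <= (l i)%:R.
    by rewrite ler_pdivrMr ?st0//; lra.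
  have h2 : (l i)%:R <= (a i - y0 i - b i) / step i + (t i + b i) / step i.
    by rewrite -mulrDl ler_pdivlMr ?st0//; lra.
  have h3 : (a i - y0 i - b i) / step i < (Num.truncn ((a i - y0 i - b i) / step i)).+1%:R.
    exact: truncnS_gt.
  apply/andP; split.
    have [X00|X00] := leP 0 ((a i - y0 i - b i) / step i).
      by rewrite -(ler_nat R) (le_trans _ h1)// truncn_le.
    have -> // : Num.truncn ((a i - y0 i - b i) / step i) = 0%N.
    by apply/truncn0Pn; rewrite -ltNge; lra.
  rewrite -(ltr_nat R) natrD; apply: le_lt_trans h2 _; rewrite -natr1 in h3.
  have h4 : (t i + b i) / step i + 1 <= (n i)%:R.
    rewrite /n; case: eqP => [E|/eqP ii].
      by rewrite E -natr1 lerD2r ltW// truncnS_gt.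
    have : (t i + b i) / step i <= 1.
      by rewrite ler_pdivrMr ?st0// mul1r stepE//; have := tb i ie ii; lra.
    lra.
  lra.
rewrite (bigD1 i1)//= natrM mulrC; apply: ler_pM => //.
  rewrite ler_nat -[d in X in (_ <= X)%N]card_ord -prod_nat_const [leqRHS](bigD1 i1)//=.
  rewrite -[leqLHS]mul1n leq_mul// leq_prod// => j /negPf ji.
  by rewrite /n ji.
rewrite /n eqxx -addn2 natrD.
have : (Num.truncn ((t i1 + b i1) / step i1))%:R <= (t i1 + b i1) / step i1.
  rewrite truncn_le; apply: divr_ge0; first by rewrite addr_ge0// ltW.
  by rewrite ltW// st0.
have : b i1 / step i1 <= 1.
  by rewrite ler_pdivrMr ?st0// mul1r stepE//; have := b0 i1; lra.
rewrite mulrDl; lra.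
Qed.

(** Over one cell, the forms of the siblings [j] and [j'] differ by [(j' - j)] times the form of
    [m], which [phi_child_range] bounds from below; so few [j] give slabs meeting the box. This is
    summed over the cells that the box meets. *)
Lemma hit_count (P : nat) (m : V) (y0 step b' N N' Yb a t : 'I_d -> R)
   (eta : {ffun 'I_d -> 'I_P.+1} -> V) (L : seq {ffun 'I_d -> 'I_P.+1})
   (A Ah c Del del r g rho' Cs : R) (J : nat) :
  i1 != e -> 0 < A -> A <= y e m <= Ah ->
  (forall i, i != e -> `|y i m| <= 2 * N i) -> 0 <= y i1 m ->
  0 < c -> 0 < del -> 1 <= g -> g <= J%:R <= 2 * g -> (0 < J)%N ->
  (forall i, i != e -> 8 * g * N i <= N' i) ->
  (forall i, 0 < b' i) -> (forall i, 0 <= N' i) ->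
  \sum_(i | i != e) N' i * b' i <= del / 2 ->
  uniq L ->
  (forall l, l \in L -> goodpt m N' c Del del r (gridpt y0 step l) (eta l)) ->
  (forall l, l \in L -> l e = ord0) ->
  (forall i, i != e -> step i = 2 * b' i) -> (forall i, 0 <= t i) ->
  (forall i, i != e -> i != i1 -> t i <= b' i) ->
  4 * rho' <= del / (16 * g) ->
  (forall i l j, l \in L -> j \in iota J J -> `|y i (eta l + m *~ j%:Z)| <= Yb i) ->
  Yb i1 = 2 * N' i1 -> \sum_(i | i != i1) Yb i * t i <= rho' ->
  0 <= Cs -> del <= Cs * (N' i1 * step i1) ->
  (count (hit b' rho' a t) (children m y0 step J eta L))%:R <=
    (3 ^ d)%:R * (224 + 3 * Cs) * (1 + t i1 * (g * N' i1 / del)).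
Proof.
have close (u v v' s : R) : u <= v <= u + s -> u <= v' <= u + s -> `|v - v'| <= s.
  by move=> /andP[? ?] /andP[? ?]; rewrite ler_norml; apply/andP; split; lra.
have three (u v v' s s' : R) : `|u| <= s -> `|v| <= s' + s -> `|v'| <= s ->
    `|u - v| + `|v'| <= 3 * s + s' by move=> h1 h2 h3; have := ler_normB u v; lra.
move=> i1e A0 qA mN m1 c0 del0 g1 gJ J0 gN b'0 N'0 Nb uL Lgood Le stepE t0 tb rho16 mY Y1
  Yt Cs0 delC.
have g0 : 0 < g by exact: lt_le_trans ltr01 g1.
have q0 : y e m != 0.
  by rewrite gt_eqF//; case/andP: qA => + _; apply: lt_le_trans.
have rho4 : rho' <= del / 4.
  have : del / (16 * g) <= del / 4.
    by rewrite ler_pM2l// lef_pV2 ?posrE ?mulr_gt0//; lra.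
  have := divr_gt0 del0 (mulr_gt0 (ltr0n R 16) g0); lra.
have N10 : 0 < N' i1.
  rewrite lt_neqAle N'0 andbT; apply/negP => /eqP N0.
  by move: delC; rewrite -N0 mul0r mulr0; lra.
pose compat (l : {ffun 'I_d -> 'I_P.+1}) : bool := `[< exists x, (forall i, a i <= x i <= a i + t i) /\
   inbox e (gridpt y0 step l) b' x >].
(* Slabs are compared inside one cell, so the extent along [i1] is capped by the side of the cell.
   This keeps the product of the two counts linear in [t i1]. *)
pose D1 : R := Num.min (t i1) (b' i1).
have D1t : D1 <= t i1 by rewrite /D1 ge_min lexx.
have D1b : D1 <= b' i1 by rewrite /D1 ge_min lexx orbT.
have D10 : 0 <= D1 by rewrite /D1 le_min t0 ltW.
pose X := 1 + 32 * g * N' i1 * D1 / del.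
have X0 : 0 <= X.
  by rewrite addr_ge0// divr_ge0 ?(ltW del0)// !mulr_ge0// ltW.
have jcount l : l \in L ->
    (count (fun j : nat => hit b' rho' a t (eta l + m *~ j%:Z, gridpt y0 step l)) (iota J J))%:R
     <= if compat l then 2 * X + 1 else 0.
  move=> lL; case: ifPn => [_|nc]; last first.
    rewrite lern0; apply/negP => /negP; rewrite -lt0n -has_count => /hasP[j jJ].
    move=> /asboolP[x [xa [xb _]]]; case/negP: nc; apply/asboolP; by exists x.
  rewrite -size_filter; apply: size_close => //; first by rewrite filter_uniq// iota_uniq.
  move=> j j'; rewrite !mem_filter => /andP[/asboolP[x [xa [/= xb px]]] jJ].
  move=> /andP[/asboolP[x' [xa' [/= xb' px']]] jJ'].
  have Jj' : (J <= j' < 2 * J)%N by move: jJ'; rewrite mem_iota mul2n addnn.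
  have /andP[low _] := phi_child_range A0 qA (Lgood l lL) del0 g0 gJ Jj' Nb xb' px' rho4.
  set mj := eta l + m *~ j%:Z; set mj' := eta l + m *~ j'%:Z.
  have E : phi mj' x' = phi mj x' + (j'%:R - j%:R) * phi m x'.
    have : phi (mj' - mj) x' = phi (m *~ (j'%:Z - j%:Z)) x'.
      by congr (phi _ _); rewrite /mj /mj' opprD addrACA subrr add0r mulrzBr.
    rewrite phiB phiMz intrB => h.
    by rewrite -[j'%:R]/(j'%:Z%:~R) -[j%:R]/(j%:Z%:~R) -h addrC subrK.
  have sub : `|phi mj x' - phi mj x| <= 2 * N' i1 * D1 + rho'.
    rewrite phi_sub (bigD1 i1)//=; apply: le_trans (ler_normD _ _) _; apply: lerD.
      rewrite normrM -Y1; apply: ler_pM => //; first exact: mY.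
      by rewrite /D1 le_min (close _ _ _ _ (xa' i1) (xa i1)) (close _ _ _ _ (xb' i1 i1e) (xb i1 i1e)).
    apply: le_trans Yt; apply: le_trans (ler_norm_sum _ _ _) _; apply: ler_sum => i ii.
    rewrite normrM; apply: ler_pM => //; first exact: mY.
    exact: close (xa' i) (xa i).
  have H : `|j%:R - j'%:R| * (del / (16 * g)) <= 3 * rho' + 2 * N' i1 * D1.
    apply: (@le_trans _ _ (`|j%:R - j'%:R| * `|phi m x'|)); first by rewrite ler_wpM2l.
    rewrite distrC -normrM (_ : (j'%:R - j%:R) * phi m x' = phi mj' x' - (phi mj x' - phi mj x) - phi mj x);
      last by rewrite E; ring.
    by apply: le_trans (ler_normB _ _) _; exact: three.
  have dg0 : 0 < del / (16 * g) by rewrite divr_gt0// mulr_gt0.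
  rewrite -(ler_pM2r dg0) (le_trans H)//.
  rewrite (_ : X * _ = del / (16 * g) + 2 * N' i1 * D1).
    rewrite lerD2r; apply: le_trans rho16; apply: ler_wpM2r; last by rewrite ler_nat.
    exact: le_trans px.
  by rewrite /X; field; rewrite !gt_eqF.
have compat_n : (count compat L)%:R <= (3 ^ d)%:R * (t i1 / step i1 + 3) :> R.
  exact: count_grid_boxes.
rewrite /children count_flatten -map_comp sumnE big_map natr_sum.
apply: (@le_trans _ _ (\sum_(l <- L) if compat l then 2 * X + 1 else 0)).
  rewrite big_seq [leRHS]big_seq; apply: ler_sum => l lL /=.
  rewrite count_map; exact: jcount.
rewrite -big_mkcond/= big_const_seq iter_addr_0 -[leLHS]mulr_natl.
apply: (@le_trans _ _ ((3 ^ d)%:R * (t i1 / step i1 + 3) * (2 * X + 1))).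
  apply: ler_wpM2r => //; by rewrite addr_ge0// mulr_ge0.
rewrite -[leLHS]mulrA -[leRHS]mulrA; apply: ler_wpM2l => //.
have st0 : 0 < step i1 by rewrite stepE// mulr_gt0.
set s' := g * N' i1 / del.
have s'0 : 0 < s' by rewrite divr_gt0// mulr_gt0.
have E1 : X = 1 + 32 * (D1 * s') by rewrite /X /s'; field; rewrite gt_eqF.
have E2 : (t i1 / step i1) <= Cs * (t i1 * s').
  rewrite ler_pdivrMr//; have -> : Cs * (t i1 * s') * step i1 =
     t i1 * (g * (Cs * (N' i1 * step i1) / del)).
    by rewrite /s'; field; rewrite gt_eqF.
  rewrite -[leLHS]mulr1 ler_wpM2l//.
  have : 1 <= Cs * (N' i1 * step i1) / del by rewrite ler_pdivlMr// mul1r.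
  move=> h; rewrite -[leLHS]mulr1; exact: ler_pM.
have E3 : t i1 / step i1 * (D1 * s') <= t i1 * s' / 2.
  rewrite (_ : _ * _ = (t i1 * s') * (D1 / step i1)); last by ring.
  apply: ler_wpM2l; first by rewrite mulr_ge0// ltW.
  by rewrite ler_pdivrMr// stepE//; lra.
have E4 : D1 * s' <= t i1 * s' by rewrite ler_pM2r.
have T0 : 0 <= t i1 * s' by rewrite mulr_ge0// ltW.
rewrite E1; move: E2 E3 E4 T0.
move: (t i1 / step i1) (D1 * s') (t i1 * s') => u v w E2 E3 E4 w0.
have := mulr_ge0 Cs0 w0; lra.
Qed.

End Hits.

(** * Dirichlet's theorem in the quotient by a node vector *)

Section Dirichlet.
Context {R : realType} {V : zmodType} {d : nat}.
Context (y : 'I_d -> {additive V -> R}) (k : {additive V -> R}) (e : 'I_d).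
Local Notation gam := (gam y e).
Local Notation th := (th y k e).
Local Notation inZ := (@inZ V).

(** Pigeonhole on vectors rounded from a grid of spacing 5, slanted along [m] so that [gam]
    essentially sees only the offsets. Rounding moves a coordinate by at most 2, so different grid
    points give different vectors. The vector [o] shifts [th] into [[0, 1)] at no cost. *)
Lemma dirichlet (m : V) (N x : 'I_d -> R) (Del : R) :
  (forall ys : 'I_d -> R, exists v, forall i, `|y i v - ys i| <= 2) ->
  (exists2 o, forall i, y i o = 0 & k o = 1) ->
  1 / 2 <= y e m -> (forall i, i != e -> 10 <= N i) ->
  (forall i, i != e -> 2 + 2 * `|y i m| / y e m <= N i / 4) ->
  0 < Del <= 1 -> 2 ^+ (5 * d + 8) <= Del * (y e m * \prod_(i | i != e) N i) ->
  exists v, [/\ ~ inZ m v, forall i, i != e -> `|gam m v i| <= N i & `|th m v x| <= Del].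
Proof.
move=> rnd [o oy ok] q12 N10 mN /andP[Del0 Del1] big.
set q := y e m in q12 mN big *.
have q0 : 0 < q by lra.
have q00 : y e m != 0 by rewrite gt_eqF.
pose na := (Num.truncn (q / 5)).+1.
pose Pn i := if i == e then 1%N else Num.truncn (N i / 10).
pose Pm := \max_i Pn i.
pose ys (al : 'I_na * {ffun 'I_d -> 'I_Pm.+1}) i : R :=
  if i == e then 5 * (al.1)%:R else 5 * (al.2 i)%:R + 5 * (al.1)%:R / q * y i m.
have /choice[v vP] al : exists v, [/\ forall i, `|y i v - ys al i| <= 2 & 0 <= th m v x < 1].
  have [v0 v0P] := rnd (ys al).
  pose n := Num.floor (th m v0 x); exists (v0 + o *~ n).
  have yE i : y i (v0 + o *~ n) = y i v0 by rewrite raddfD/= addMz oy mulr0 addr0.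
  split; first by move=> i; rewrite yE.
  have -> : th m (v0 + o *~ n) x = th m v0 x - n%:~R.
    rewrite /th yE /phi raddfD/= addMz ok mulr1 (eq_bigr (fun i => y i v0 * x i)).
      by ring.
    by move=> i _; rewrite yE.
  have h1 := floor_le (th m v0 x); have h2 := lt_succ_floor (th m v0 x).
  rewrite -/n in h1; rewrite -/n intrD in h2.
  by rewrite subr_ge0 h1/= ltrBlDl; exact: h2.
pose Nb := (Num.truncn (Del^-1)).+1.
have ye al : -2 <= y e (v al) <= q + 2.
  have [h _] := vP al; have := h e; rewrite /ys eqxx ler_norml.
  have : 0 <= (al.1)%:R :> R by [].
  have : (al.1)%:R <= q / 5.
    apply: (@le_trans _ _ (Num.truncn (q / 5))%:R).
      by rewrite ler_nat -ltnS ltn_ord.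
    by rewrite truncn_le divr_ge0// ltW.
  lra.
(* [y e] ranges over a length of [q + 4], covered by 19 bins of width [q / 2] as [q] is at least
   1/2. Within a bin it differs by less than [y e m], so the difference of two vectors is no nonzero
   multiple of [m]. *)
pose bin al : 'I_19 * 'I_Nb :=
  (inord (Num.truncn ((y e (v al) + 2) / (q / 2))), inord (Num.truncn (th m (v al) x * Nb%:R))).
pose A := setX [set: 'I_na] [set l : {ffun 'I_d -> 'I_Pm.+1} | [forall i, (l i < Pn i)%N]].
have cA : #|A| = (na * \prod_i Pn i)%N.
  rewrite cardsX cardsT card_ord card_fun_box0// => i.
  by rewrite ltnW// ltnS (leq_bigmax i).
have nA : (19 * Nb < #|A|)%N.
  have e1 : q / 5 * \prod_(i | i != e) (N i / 20) <= (#|A|)%:R.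
    rewrite cA natrM; apply: ler_pM.
    - by rewrite divr_ge0// ltW.
    - by apply: prodr_ge0 => i ie; rewrite divr_ge0// (le_trans _ (N10 i ie)).
    - by rewrite ltW// truncnS_gt.
    - rewrite natr_prod [leRHS](bigD1 e)//= {1}/Pn eqxx mul1r.
      apply: ler_prod => i ie; rewrite /Pn (negbTE ie).
      rewrite divr_ge0//=; last by rewrite (le_trans _ (N10 i ie)).
      have := N10 i ie; have := truncnS_gt (N i / 10); rewrite -[(Num.truncn _).+1%:R]natr1.
      have : 1 <= (Num.truncn (N i / 10))%:R :> R.
        by rewrite -[1]/(1%:R) ler_nat truncn_gt0 ler_pdivlMr// mul1r N10.
      lra.
  have e2 : \prod_(i | i != e) (N i / 20) >= (20^-1) ^+ d * \prod_(i | i != e) N i.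
    rewrite big_split/= mulrC ler_wpM2l//.
      by apply: prodr_ge0 => i ie; rewrite (le_trans _ (N10 i ie)).
    rewrite -[d in leLHS]card_ord -prodr_const [leLHS](bigD1 e)//=.
    have p20 : 0 < \prod_(i < d | i != e) (20^-1 : R) by apply: prodr_gt0 => i _; lra.
    by rewrite ger_pMl//; lra.
  have P0 : 0 < \prod_(i | i != e) N i.
    by apply: prodr_gt0 => i ie; rewrite (lt_le_trans _ (N10 i ie)).
  set PN := \prod_(i | i != e) N i in big e2 P0.
  have e3 : q / 5 * ((20^-1) ^+ d * PN) <= (#|A|)%:R.
    by apply: le_trans e1; rewrite ler_pM2l// divr_gt0.
  rewrite -(ltr_nat R) natrM; apply: lt_le_trans e3.
  have e4 : Nb%:R <= 2 / Del.
    have : 1 <= Del^-1 by rewrite invr_ge1// unitfE gt_eqF.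
    have : (Num.truncn Del^-1)%:R <= Del^-1 by rewrite truncn_le invr_ge0 ltW.
    by rewrite /Nb -natr1; lra.
  apply: (@le_lt_trans _ _ (19 * (2 / Del))); first by rewrite ler_pM2l.
  (* 190 is 19 bins, times 2 from [Nb], times 5 from the grid spacing; 20 is the loss per coordinate
     after rounding [N i / 10] down. *)
  have e5 : 190 * 20 ^+ d < 2 ^+ (5 * d + 8) :> R.
    have h2 : 2 ^+ (5 * d + 8) = 256 * 32 ^+ d :> R.
      rewrite exprD exprM mulrC (_ : 2 ^+ 8 = 256); last by ring.
      by rewrite (_ : 2 ^+ 5 = 32)//; ring.
    have h3 : 20 ^+ d <= 32 ^+ d :> R by apply: lerXn2r; rewrite ?nnegrE//; lra.
    have h4 : 0 < 20 ^+ d :> R by rewrite exprn_gt0//; lra.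
    by rewrite h2; lra.
  have e6 : 190 * 20 ^+ d < Del * (q * PN) by apply: lt_le_trans big.
  have t0 : 0 < 20 ^+ d :> R by rewrite exprn_gt0.
  rewrite exprVn (_ : q / 5 * _ = (q * PN) / (5 * 20 ^+ d)); last first.
    by field; rewrite gt_eqF.
  rewrite ltr_pdivlMr ?mulr_gt0//; move: e6; move: (20 ^+ d) => t e6.
  have -> : 19 * (2 / Del) * (5 * t) = 190 * t / Del by field; rewrite gt_eqF.
  by rewrite ltr_pdivrMr// [ltRHS]mulrC.
have [al [al' [alA al'A neq bE]]] : exists al al', [/\ al \in A, al' \in A, al != al' & bin al = bin al'].
  apply: contrapT => H; move: nA; rewrite ltnNge => /negP; apply.
  have -> : (19 * Nb)%N = #|[set: 'I_19 * 'I_Nb]|.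
    by rewrite cardsT card_prod !card_ord.
  rewrite -(card_in_imset (f := bin)) ?subset_leq_card ?finset.subsetT//.
  move=> al al' alA al'A bE; apply/eqP/negPn/negP => ne.
  by apply: H; exists al, al'.
have [b1 b2] : Num.truncn ((y e (v al) + 2) / (q / 2)) = Num.truncn ((y e (v al') + 2) / (q / 2))
   /\ Num.truncn (th m (v al) x * Nb%:R) = Num.truncn (th m (v al') x * Nb%:R).
  have h1 a : (Num.truncn ((y e (v a) + 2) / (q / 2)) < 19)%N.
    rewrite truncn_lt_nat; last by apply: divr_ge0; have := ye a; lra.
    by rewrite ltr_pdivrMr ?divr_gt0//; have := ye a; lra.
  have h2 a : (Num.truncn (th m (v a) x * Nb%:R) < Nb)%N.
    have [_ /andP[t0 t1]] := vP a; rewrite truncn_lt_nat ?mulr_ge0//.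
    by rewrite -[ltRHS]mul1r ltr_pM2r// ltr0n.
  have := congr1 (fun b => val b.1) bE; have := congr1 (fun b => val b.2) bE.
  by rewrite /= !inordK.
have tr (u w : R) : 0 <= u -> 0 <= w -> Num.truncn u = Num.truncn w -> `|u - w| < 1.
  move=> /truncn_itv/andP[u1 u2] /truncn_itv/andP[w1 w2] E.
  by rewrite E -natr1 in u1 u2; rewrite -natr1 in w2; rewrite ltr_norml; lra.
have ydiff : `|y e (v al) - y e (v al')| < q / 2.
  have h a : 0 <= (y e (v a) + 2) / (q / 2).
    by apply: divr_ge0; have := ye a; lra.
  have := tr _ _ (h al) (h al') b1; rewrite -mulrBl normrM normfV.
  rewrite (@gtr0_norm _ (q / 2)) ?divr_gt0// ltr_pdivrMr ?divr_gt0// mul1r.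
  by rewrite opprD addrACA subrr addr0.
have Nb0 : 0 < Nb%:R :> R by rewrite ltr0n.
have tdiff : `|th m (v al) x - th m (v al') x| <= Del.
  have h a : 0 <= th m (v a) x * Nb%:R.
    by have [_ /andP[t0 _]] := vP a; rewrite mulr_ge0.
  have := tr _ _ (h al) (h al') b2; rewrite -mulrBl normrM (gtr0_norm Nb0).
  rewrite -ltr_pdivlMr// mul1r => H; apply: le_trans (ltW H) _.
  by rewrite invf_ple ?posrE// ltW// truncnS_gt.
exists (v al - v al'); split; last by rewrite thB.
- move=> [p pE].
  have p0 : p = 0.
    have := ydiff; rewrite -raddfB pE addMz normrM -/q (gtr0_norm q0) => H.
    apply/eqP; rewrite -normr_le0 leNgt gtz0_ge1; apply/negP => p1.
    have p1R : 1 <= `|p%:~R| :> R by rewrite -intr_norm ler1z.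
    have := ler_wpM2r (ltW q0) p1R; lra.
  have vE : v al = v al' by apply/eqP; rewrite -subr_eq0 pE p0 mulr0z.
  have ysd i : `|ys al i - ys al' i| <= 4.
    have [h1 _] := vP al; have [h2 _] := vP al'.
    by have := h1 i; have := h2 i; rewrite vE !ler_norml; lra.
  have close (u w : nat) : `|5 * u%:R - 5 * w%:R| <= 4 :> R -> u = w.
    rewrite -mulrBr normrM ger0_norm// => H.
    have : `|(u%:Z - w%:Z)%:~R| < 1 :> R by rewrite intrB -[X in X - _]/(u%:R); lra.
    by rewrite -intr_norm ltrz1; clear; lia.
  have a1 : al.1 = al'.1.
    by apply/val_inj/close; have := ysd e; rewrite /ys eqxx.
  move/negP: neq; apply; apply/eqP; case: al al' a1 ysd {vE pE bE b1 b2 ydiff tdiff} alA al'A =>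
    [a l] [a' l'] /= <- ysd lA l'A; congr pair; apply/ffunP => i.
  have [->|ie] := eqVneq i e.
    move: lA l'A; rewrite !inE /= => /forallP/(_ e) + /forallP/(_ e).
    rewrite /Pn eqxx !ltnS !leqn0 => /eqP h /eqP h'; apply: val_inj => /=.
    by rewrite h h'.
  apply/val_inj/close; have := ysd i; rewrite /ys (negbTE ie)/=.
  by rewrite opprD addrACA subrr addr0.
- move=> i ie; have gE a : a \in A -> exists2 l : R, 0 <= l <= N i / 2 & `|gam m (v a) i - l| <= N i / 4.
    move=> aA; exists (5 * (a.2 i)%:R).
      rewrite mulr_ge0//=; have : (a.2 i)%:R <= N i / 10.
        move: aA; rewrite !inE/= => /forallP/(_ i); rewrite /Pn (negbTE ie) => /ltnW h.
        apply: (@le_trans _ _ (Num.truncn (N i / 10))%:R); first by rewrite ler_nat.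
        by rewrite truncn_le divr_ge0// (le_trans _ (N10 i ie)).
      lra.
    apply: le_trans (mN i ie); have [h _] := vP a.
    have hi := h i; have he := h e; rewrite /ys (negbTE ie) eqxx in hi he.
    have -> : gam m (v a) i - 5 * (a.2 i)%:R =
      (y i (v a) - (5 * (a.2 i)%:R + 5 * (a.1)%:R / q * y i m))
      - (y e (v a) - 5 * (a.1)%:R) * (y i m / q).
      by rewrite /gam -/q; field; rewrite gt_eqF.
    apply: le_trans (ler_normB _ _) _; apply: lerD => //.
    rewrite normrM -[leRHS]mulrA; apply: ler_pM => //.
    by rewrite normrM normfV (gtr0_norm q0).
  have [l /andP[l1 l2] hl] := gE _ alA; have [l' /andP[l1' l2'] hl'] := gE _ al'A.
  by rewrite gamB; move: hl hl'; rewrite !ler_norml; lra.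
Qed.

End Dirichlet.

(** * Levels of the construction *)

Section PowersOfTwo.
Context {R : realType}.
Implicit Types x z : R.

(** The real power of 2: comparisons between sizes become linear inequalities between exponents. *)
Definition p2 x : R := expR (x * ln 2).

Let ln2_gt0 : 0 < ln 2 :> R. Proof. by rewrite ln_gt0// ltr1n. Qed.

Lemma p2_gt0 x : 0 < p2 x. Proof. exact: expR_gt0. Qed.
Lemma p2_ge0 x : 0 <= p2 x. Proof. exact: ltW (p2_gt0 x). Qed.
Lemma p2D x z : p2 (x + z) = p2 x * p2 z. Proof. by rewrite /p2 mulrDl expRD. Qed.
Lemma p2N x : p2 (- x) = (p2 x)^-1. Proof. by rewrite /p2 mulNr expRN. Qed.
Lemma p2B x z : p2 (x - z) = p2 x / p2 z. Proof. by rewrite p2D p2N. Qed.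
Lemma p2_0 : p2 0 = 1. Proof. by rewrite /p2 mul0r expR0. Qed.
Lemma p2_le x z : x <= z -> p2 x <= p2 z.
Proof. by move=> xz; rewrite ler_expR ler_wpM2r// ltW. Qed.
Lemma p2_lt x z : x < z -> p2 x < p2 z.
Proof. by move=> xz; rewrite /p2 ltr_expR ltr_pM2r// ln_gt0// ltr1n. Qed.
Lemma p2_1 : p2 1 = 2. Proof. by rewrite /p2 mul1r lnK// posrE. Qed.
Lemma p2_nat n : p2 n%:R = 2 ^+ n.
Proof. by elim: n => [|n IH]; rewrite ?p2_0 ?expr0// -natr1 p2D IH p2_1 exprSr. Qed.
Lemma p2_sum (I : Type) (r : seq I) (P : pred I) (F : I -> R) :
  p2 (\sum_(i <- r | P i) F i) = \prod_(i <- r | P i) p2 (F i).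
Proof. by apply: (big_morph p2 p2D p2_0). Qed.
Lemma p2_le1 x : x <= 0 -> p2 x <= 1. Proof. by move/p2_le; rewrite p2_0. Qed.
Lemma p2_ge1 x : 0 <= x -> 1 <= p2 x. Proof. by move/p2_le; rewrite p2_0. Qed.
Lemma natr_le_p2 n : n%:R <= p2 n%:R.
Proof. by rewrite p2_nat -natrX ler_nat ltnW// ltn_expl. Qed.

End PowersOfTwo.

Section Levels.
Context {R : realType} {d : nat}.
Context (w : 'I_d -> R) (S : nat -> R) (C1 t : R) (e i1 : 'I_d).
Local Notation D := (d%:R : R).

(* A node of level n is a vector m with |y_i(m)| at most of order N_i (and y_e(m)
   between A and Ah) together with a box of sides b_i in the coordinates i <> e; its
   region is the slab |phi m| <= rho over the box. From one level to the next: g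
   bounds the multiples j of m in the children eta + j m, del is the size of [th] at
   the chosen grid points, Del the Dirichlet bound, K the grid size, Sn the number of
   sliding steps, F the number of grid points kept, and s the spacing of sibling
   slabs along the coordinate i1. *)
Definition lT n := S n - S n.-1.
Definition lN n i := p2 (w i * S n - n%:R).
Definition lA n := p2 (w e * S n - 6 * n%:R - 1).
Definition lAh n := p2 (w e * S n - 2 * n%:R + 1).
Definition lg n := p2 (w e * lT n - 5).
Definition ldel n := p2 (w e * lT n - S n - n%:R - 8 - t).
Definition lrho n := p2 (- S n.+1 - n%:R - 1 - t).
Definition lPsi n := p2 (- S n - n%:R - t - 16 - D).
Definition lc n := p2 (- C1 * n%:R ^+ 2).
Definition lb n i := p2 (w e * lT n - (1 + w i) * S n - 9 - t - D).
Definition lstep n i := 2 * lb n i.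
Definition lDel n := p2 (5 * D + 8 - w e * S n.-1 + 6 * (n.-1)%:R + 1 - (1 - w e) * S n
  + (D - 1) * n%:R).
Definition lJ n : nat := (Num.truncn (lg n)).+1.
Definition lU n i := if i == i1 then lc n * lN n i1 / 64 else lN n i / 4.
Definition lG n i := if i == i1 then lc n * lN n i1 else if i == e then lU n.-1 e else lN n i.
Definition lK n i : nat := if i == e then 1%N else Num.truncn (lb n.-1 i / lstep n i).
Definition lSn n : nat := (Num.truncn (p2 (D + 2) * lDel n / (lc n * ldel n))).+1.
Definition lF n : nat := ((\prod_i lK n i) %/ (4 * (2 * lSn n + 1)))%N.
Definition lYb n i := if i == e then lAh n else 2 * lN n i.
Definition ls n := p2 (- (1 + w i1) * S n - 3 - t).

End Levels.

Ltac lv n := rewrite /lN /lA /lAh /lg /ldel /lrho /lPsi /lc /lb /lDel /lT /=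
  -?[n.+1%:R]natr1.
Ltac pe := apply: p2_le.

Section LevelFacts.
Context {R : realType} {d : nat}.
Context (w : 'I_d -> R) (S : nat -> R) (C1 t : R) (e i1 : 'I_d).
Local Notation D := (d%:R : R).
Local Notation sN := (lN w S).
Local Notation sA := (lA w S e).
Local Notation sAh := (lAh w S e).
Local Notation sg := (lg w S e).
Local Notation sdel := (ldel w S t e).
Local Notation srho := (lrho S t).
Local Notation sPsi := (@lPsi R d S t).
Local Notation sc := (lc C1).
Local Notation sb := (lb w S t e).
Local Notation sstep := (lstep w S t e).
Local Notation sDel := (lDel w S e).
Local Notation sJ := (lJ w S e).
Local Notation sU := (lU w S C1 i1).
Local Notation sG := (lG w S C1 e i1).
Local Notation sK := (lK w S t e).
Local Notation sSn := (lSn w S C1 t e).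

(** The last clause lets one gap of [S], even times the smallest weight, exceed the error exponents
    of a level; its quadratic term pays for [lc]. *)
Definition level_hyp := [/\ i1 != e, forall i, 0 < w e <= w i, \sum_i w i = 1, S 0%N = 0 & 0 <= t]
  /\ C1 = 100 + 20 * D + t /\
  forall n, 50 * n.+1%:R + 10 * (D * n.+1%:R) + 10 * D + 2 * C1 * n.+1%:R ^+ 2 + 4 * t + 50
    <= w e * (S n.+1 - S n).

Context (H : level_hyp).

Lemma level_D : 2 <= D.
Proof.
have [[i1e _ _ _ _] _] := H; rewrite ler_nat.
rewrite leqNgt; apply/negP => d2; case/eqP: i1e; apply: val_inj => /=.
by have := ltn_ord i1; have := ltn_ord e; move: d2; clear; lia.
Qed.

Lemma level_w1 : w e + w i1 <= 1.
Proof.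
have [[i1e wP ws _ _] _] := H.
rewrite -ws (bigD1 e)//= lerD2l (bigD1 i1)//= lerDl.
by apply: sumr_ge0 => i _; case/andP: (wP i) => h1 h2; exact: le_trans (ltW h1) h2.
Qed.

(* The linear facts from which all comparisons of exponents follow. *)
Lemma level_facts n : [/\ 0 <= S n, 0 <= S n.+1 - S n,
   50 * (n%:R + 1) + 10 * (D * (n%:R + 1)) + 10 * D + 2 * C1 * (n%:R + 1) ^+ 2 + 4 * t + 50
    <= w e * (S n.+1 - S n), w e * (S n.+1 - S n) <= (1 - w e) * (S n.+1 - S n) &
   0 <= n%:R :> R /\ 0 <= D * n%:R].
Proof.
have [[i1e wP ws S0 t0] [C1E HT]] := H.
have D2 := level_D; have w1 := level_w1.
have we0 : 0 < w e by case/andP: (wP e).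
have we12 : w e <= 1 - w e by have /andP[_ h] := wP i1; lra.
have pos m : 0 <= S m.+1 - S m.
  rewrite -(pmulr_rge0 _ we0); apply: le_trans (HT m).
  have : 0 <= C1 * m.+1%:R ^+ 2 by rewrite mulr_ge0 ?exprn_ge0//; lra.
  have : 0 <= D * m.+1%:R by rewrite mulr_ge0.
  have : 0 <= m.+1%:R :> R by [].
  by rewrite -[2 * C1 * _]mulrA; lra.
split=> //.
- elim: n => [|n IH]; first by rewrite S0.
  by have := pos n; lra.
- by have := HT n; rewrite -[n.+1%:R]natr1.
- by rewrite ler_wpM2r.
by split=> //; rewrite mulr_ge0.
Qed.

Lemma level_wpos n i : [/\ 0 <= w i * S n, w e * (S n.+1 - S n) <= w i * (S n.+1 - S n)
   & w e * S n <= w i * S n].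
Proof.
have [[i1e wP ws S0 t0] _] := H; have /andP[we0 wi] := wP i.
have [Sn ST _ _ _] := level_facts n.
split; [by rewrite mulr_ge0//; lra| by rewrite ler_wpM2r | by rewrite ler_wpM2r].
Qed.

Lemma lT_ge n : 0 <= w e * (S n - S n.-1).
Proof.
have [[i1e wP ws S0 t0] _] := H; have /andP[we0 _] := wP e.
case: n => [|n]; first by rewrite subrr mulr0.
by rewrite mulr_ge0 ?(ltW we0)//; have [] := level_facts n.
Qed.

Lemma level_C1 (n : nat) : [/\ 100 + 20 * D + t <= C1, 100 * n%:R + 20 * (D * n%:R) <= C1 * n%:R
   & 0 <= C1 * n%:R ^+ 2].
Proof.
have [[_ _ _ _ t0] [C1E _]] := H; have D2 := level_D.
split; [by lra| |by rewrite mulr_ge0 ?exprn_ge0//; lra].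
rewrite C1E (_ : (_ + t) * _ = 100 * n%:R + 20 * (D * n%:R) + t * n%:R); last by ring.
by rewrite lerDl mulr_ge0.
Qed.

Ltac lf n := have [Sn ST HT weT [n0 dn0]] := level_facts n;
  have [[i1e wP ws S0 t0] [C1E _]] := H; have D2 := level_D; have w1 := level_w1;
  have /andP[we0 wei1] := wP i1; have [weS0 _ _] := level_wpos n e; have lT0 := lT_ge n; have [C10 C1n C1n2] := level_C1 n.

Let E2 : (2 : R) = p2 1. Proof. by rewrite p2_1. Qed.
Let E4 : (4 : R) = p2 2. Proof. by rewrite p2_nat; ring. Qed.
Let E8 : (8 : R) = p2 3. Proof. by rewrite p2_nat; ring. Qed.
Let E16 : (16 : R) = p2 4. Proof. by rewrite p2_nat; ring. Qed.
Let E64 : (64 : R) = p2 6. Proof. by rewrite p2_nat; ring. Qed.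

Lemma Del_Psi n : 4 * sDel n.+1 <= sPsi n.
Proof. lf n; rewrite E4; lv n; rewrite -p2D; pe; lra. Qed.

Lemma Del_le1 n : sDel n.+1 <= 1.
Proof.
lf n; lv n; apply: p2_le1.
have : 0 <= w e * S n by have [] := level_wpos n e.
have [_ _ _ wn _] := level_facts n.
have : 0 <= (1 - w e) * S n by rewrite mulr_ge0//; lra.
lra.
Qed.

Lemma prod_N n : \prod_(i | i != e) sN n i = p2 ((1 - w e) * S n - (D - 1) * n%:R).
Proof.
have [[_ _ ws _ _] _] := H; rewrite /lN -p2_sum; congr p2.
rewrite sumrB -mulr_suml; congr (_ * _ - _).
  by have h := ws; rewrite (bigD1 e)//= in h; rewrite -h addrAC subrr add0r.
have : \sum_(i : 'I_d) n%:R = D * n%:R :> R by rewrite sumr_const card_ord mulr_natl.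
by rewrite (bigD1 e)//= => h; rewrite mulrBl mul1r -h addrAC subrr add0r.
Qed.

(** [lDel] is defined as the value that makes this an equality for [q = sA n]. *)
Lemma dir_big n q : sA n <= q ->
  2 ^+ (5 * d + 8) <= sDel n.+1 * (q * \prod_(i | i != e) sN n.+1 i).
Proof.
move=> Aq; rewrite prod_N; apply: (@le_trans _ _ (sDel n.+1 *
  (sA n * p2 ((1 - w e) * S n.+1 - (D - 1) * n.+1%:R)))); last first.
  by rewrite ler_wpM2l ?p2_ge0// ler_wpM2r ?p2_ge0.
rewrite -p2_nat natrD natrM; lv n; rewrite -!p2D; pe; lra.
Qed.

Lemma N_ge n i : 16 <= sN n.+1 i.
Proof.
lf n; rewrite E16; lv n; pe; have [h1 h2 h3] := level_wpos n i; lra.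
Qed.

Lemma slope n i x q : 0 <= x <= 2 * sN n i -> sA n <= q -> 2 + 2 * x / q <= sN n.+1 i / 4.
Proof.
move=> /andP[x0 x2] Aq; have A0 : 0 < sA n := p2_gt0 _.
have h1 : 2 * x / q <= 2 * (2 * sN n i) / sA n.
  apply: ler_pM; rewrite ?mulr_ge0 ?invr_ge0//.
  - by rewrite (le_trans (ltW A0)).
  - by rewrite ler_pM2l.
  - by rewrite lef_pV2 ?posrE// (lt_le_trans A0).
have h2 : 2 <= sN n.+1 i / 8 by have := N_ge n i; lra.
suff h3 : 2 * (2 * sN n i) / sA n <= sN n.+1 i / 8 by lra.
lf n; have [w1' w2 w3] := level_wpos n i.
rewrite ler_pdivrMr// E2 E8; lv n; rewrite -p2N -!p2D; pe; lra.
Qed.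

Lemma U_gt0 n i : 0 < sU n i.
Proof. by rewrite /lU; case: ifP => _; rewrite divr_gt0// ?mulr_gt0// p2_gt0. Qed.

Lemma U_le_G n i : 0 < sU n i <= sG n.+1 i.
Proof.
rewrite U_gt0/= /lG /=; lf n; have [h1 h2 h3] := level_wpos n i.
have hN : sN n i / 4 <= sN n.+1 i.
  by rewrite E4; lv n; rewrite -p2B; pe; lra.
case: eqP => [->|/eqP ii]; last first.
  by case: eqP => [->//|_]; rewrite /lU (negbTE ii).
have [h1' h2' h3'] := level_wpos n i1.
rewrite /lU eqxx E64; lv n; rewrite -p2N -!p2D; pe; lra.
Qed.

Lemma K_step n i : (sK n.+1 i)%:R * sstep n.+1 i <= sb n i.
Proof.
have s0 : 0 < sstep n.+1 i by rewrite mulr_gt0// p2_gt0.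
rewrite /lK; case: eqP => [->|_]; last first.
  by rewrite -ler_pdivlMr// truncn_le divr_ge0 ?p2_ge0// ltW.
rewrite mul1r /lstep E2; lf n; have [h1 h2 h3] := level_wpos n e.
lv n; rewrite -!p2D; pe; lra.
Qed.

(** [lb] is chosen to make this product independent of [i]: a grid step changes [th] by an amount of
    the same order in all directions. *)
Lemma N_step n i : sN n.+1 i * sstep n.+1 i = sdel n.+1 * p2 (- D).
Proof. by rewrite /lstep E2; lv n; rewrite -!p2D; congr p2; ring. Qed.

Lemma del_le_Del n : sdel n.+1 <= sDel n.+1.
Proof. lf n; lv n; pe; lra. Qed.

Lemma p2D_le1 : p2 (- D) <= 1.
Proof. by apply: p2_le1; rewrite oppr_le0. Qed.

Lemma del_gt0 n : 0 < sdel n. Proof. exact: p2_gt0. Qed.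
Lemma step_gt0 n i : 0 < sstep n i. Proof. by rewrite mulr_gt0// p2_gt0. Qed.

Lemma Nstep_le n i : sN n.+1 i * sstep n.+1 i <= sdel n.+1.
Proof. by rewrite N_step ler_piMr ?p2D_le1// ltW// del_gt0. Qed.

Lemma c_le1 n : 0 < sc n <= 1.
Proof. lf n; rewrite p2_gt0/= /lc; apply: p2_le1; lra. Qed.

Lemma G_step n i : i != e -> sG n.+1 i * sstep n.+1 i <= 2 * sDel n.+1.
Proof.
move=> ie; apply: (@le_trans _ _ (sN n.+1 i * sstep n.+1 i)).
  rewrite ler_pM2r ?step_gt0// /lG (negbTE ie); case: eqP => // ->.
  by have /andP[c0 c1] := c_le1 n.+1; rewrite ler_piMl// p2_ge0.
have := Nstep_le n i; have := del_le_Del n; have := del_gt0 n.+1; lra.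
Qed.

Lemma b_over_step n i : p2 (lT S n.+1 - 1) <= sb n i / sstep n.+1 i.
Proof.
lf n; have [h1 h2 h3] := level_wpos n i; rewrite /lstep E2.
lv n; rewrite -p2D -p2B; pe; lra.
Qed.

Lemma K_half n i : i != e -> sb n i <= 2 * (sK n.+1 i)%:R * sstep n.+1 i.
Proof.
move=> ie; have h := b_over_step n i.
have h1 : 1 <= sb n i / sstep n.+1 i.
  apply: le_trans h; apply: p2_ge1; lf n; have [h1 h2 h3] := level_wpos n e.
  have [_ _ _ h4 _] := level_facts n.
  have : (1 - w e) * (S n.+1 - S n) <= S n.+1 - S n.
    by rewrite ler_piMl//; have := level_wpos 0 e; have [[_ /(_ e)/andP[]] _ _ _ _] := H; lra.
  lv n; lra.
rewrite -ler_pdivrMr ?step_gt0// /lK (negbTE ie).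
have := truncnS_gt (sb n i / sstep n.+1 i); rewrite -[(Num.truncn _).+1%:R]natr1.
have : 1 <= (Num.truncn (sb n i / sstep n.+1 i))%:R :> R.
  by rewrite -[1]/(1%:R) ler_nat truncn_gt0.
lra.
Qed.

Lemma Psi_UK n i : i != e -> sPsi n <= 3 * sU n i * (sK n.+1 i)%:R * sstep n.+1 i.
Proof.
move=> ie; have h := K_half n ie.
apply: (@le_trans _ _ (sU n i * sb n i)); last first.
  have := ler_wpM2l (ltW (U_gt0 n i)) h; have := step_gt0 n.+1 i.
  have : 0 <= sU n i * (sK n.+1 i)%:R * sstep n.+1 i.
    apply: mulr_ge0; last exact: ltW (step_gt0 _ _).
    by apply: mulr_ge0 => //; exact: ltW (U_gt0 _ _).
  lra.
lf n; have [h1 h2 h3] := level_wpos n i.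
(* At [i1] the bound [lU] contains the small factor [lc n]; the gap of [S] before level [n] pays for
   it. *)
have cT : C1 * n%:R ^+ 2 <= w e * (S n - S n.-1).
  case: (n) {Sn ST HT weT n0 dn0 lT0 C1n C1n2 h h1 h2 h3} => [|m]; first by rewrite subrr expr0n/= !mulr0.
  have [Sm STm HTm weTm [m0 dm0]] := level_facts m.
  by have [c0 c1 c2] := level_C1 m; rewrite -[m.+1%:R]natr1; lra.
rewrite /lU; case: eqP => [->|_]; rewrite ?E64 ?E4; lv n; rewrite -p2N -!p2D; pe; lra.
Qed.

Lemma pow_le_p2 (a x : R) (m : nat) : 0 <= a <= p2 x -> a ^+ m <= p2 (x * m%:R).
Proof.
move=> /andP[a0 ax]; elim: m => [|m IH]; first by rewrite expr0 mulr0 p2_0.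
rewrite exprS -[m.+1%:R]natr1 mulrDr mulr1 addrC p2D.
by apply: ler_pM => //; exact: exprn_ge0.
Qed.

(** The products of the [N] at levels [n] and [n.+1], together with [Del / Psi], contribute
    exponents in which all values of [S] cancel. What remains is 2^O(n), beaten by the ratio of [lc]
    at the two levels, which is 2^(-C1 (2n + 1)). This is why the exponent of [lc] is quadratic in
    [n]. *)
Lemma bad_small n :
  4 * (\prod_i (5 * sG n.+1 i / sU n i) * (48 * sDel n.+1 / sPsi n)) <= 1.
Proof.
have [[ie1 _ _ _ _] _] := H.
pose h i : R := if i == i1 then 64 * sc n.+1 / sc n else 4.
have e1 : \prod_i (5 * sG n.+1 i / sU n i) =
    5 ^+ d * (\prod_(i | i != e) h i * (\prod_(i | i != e) sN n.+1 i / \prod_(i | i != e) sN n i)).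
  rewrite (eq_bigr (fun i => 5 * (sG n.+1 i / sU n i))) => [|i _]; last by rewrite mulrA.
  rewrite big_split/= prodr_const card_ord; congr (_ * _).
  rewrite (bigD1 e)//= {1}/lG /= eq_sym (negbTE ie1) eqxx divff ?gt_eqF ?U_gt0// mul1r.
  rewrite -prodf_div -big_split/=; apply: eq_bigr => i ie.
  have N0 : sN n i != 0 by rewrite gt_eqF// p2_gt0.
  have c0 : sc n != 0 by rewrite gt_eqF// p2_gt0.
  rewrite /lG /lU (negbTE ie) /h; case: eqP => [E|_]; last by field.
  by rewrite E in N0 *; field; rewrite N0 c0.
have e2 : \prod_(i | i != e) h i <= p2 (6 + 2 * D) * (sc n.+1 / sc n).
  rewrite (bigD1 i1)//= {1}/h eqxx E64 (p2D 6 (2 * D)) [leLHS]mulrC.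
  rewrite -[leRHS]mulrA [leRHS]mulrCA [X in _ <= _ * X]mulrA.
  apply: ler_wpM2r.
    by rewrite !mulr_ge0 ?invr_ge0 ?p2_ge0.
  apply: le_trans (_ : 4 ^+ d <= _); last by apply: pow_le_p2; rewrite E4 p2_ge0/= lexx.
  rewrite -[d in leRHS]card_ord -prodr_const [leRHS](bigID (fun i => (i != e) && (i != i1)))/=.
  rewrite (eq_bigr (fun=> 4)) => [|i /andP[_ /negPf ii]]; last by rewrite /h ii.
  apply: ler_peMr; first by apply: prodr_ge0 => i _; lra.
  elim/big_rec: _ => // i x _ x1; lra.
have e3 : 5 ^+ d <= p2 (3 * D) by apply: pow_le_p2; rewrite -E8; lra.
rewrite e1 !prod_N -p2B; set X := p2 _.
apply: (@le_trans _ _ (p2 2 * (p2 (3 * D) * (p2 (6 + 2 * D) * (sc n.+1 / sc n) * X)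
   * (p2 6 * sDel n.+1 / sPsi n)))).
  rewrite -E4 ler_pM2l//; apply: ler_pM.
  - apply: mulr_ge0; first exact: exprn_ge0.
    apply: mulr_ge0; last exact: p2_ge0.
    by apply: prodr_ge0 => i _; rewrite /h; case: ifP => _; rewrite ?divr_ge0 ?mulr_ge0 ?p2_ge0.
  - by rewrite divr_ge0 ?mulr_ge0 ?p2_ge0.
  - apply: ler_pM => //; rewrite ?exprn_ge0//.
      apply: mulr_ge0; last exact: p2_ge0.
      by apply: prodr_ge0 => i _; rewrite /h; case: ifP => _; rewrite ?divr_ge0 ?mulr_ge0 ?p2_ge0.
    by apply: ler_wpM2r => //; exact: p2_ge0.
  - by rewrite -E64 ler_pM2r ?invr_gt0 ?p2_gt0// ler_pM2r ?p2_gt0//; lra.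
rewrite /X; lf n; lv n; rewrite -!p2N -!p2D; apply: p2_le1.
lra.
Qed.

Let X n := p2 (D + 2) * sDel n / (sc n * sdel n).

Let X_ge1 n : 1 <= X n.+1.
Proof.
lf n; rewrite /X; lv n; rewrite -!p2D -p2B; apply: p2_ge1; lra.
Qed.

Lemma Sn_ge n : (sDel n.+1 + sdel n.+1)
   / (3 / 4 * (sc n.+1 * sN n.+1 i1) * sstep n.+1 i1) + 1 <= (sSn n.+1)%:R.
Proof.
apply: (@le_trans _ _ (X n.+1)); last by rewrite ltW// /lSn truncnS_gt.
have X1 := X_ge1 n; have dD := del_le_Del n.
have d0 := del_gt0 n.+1; have /andP[c0 _] := c_le1 n.+1.
rewrite (_ : 3 / 4 * _ * _ = 3 / 4 * sc n.+1 * (sN n.+1 i1 * sstep n.+1 i1)); last by ring.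
rewrite N_step p2N.
suff h : (sDel n.+1 + sdel n.+1) / (3 / 4 * sc n.+1 * (sdel n.+1 / p2 D)) <= 3 / 4 * X n.+1.
  have hc : 1 <= X n.+1 / 4.
    rewrite /X (p2D D 2) -E4.
    rewrite (_ : _ / 4 = p2 D * (sDel n.+1 / (sc n.+1 * sdel n.+1))); last first.
      by field; rewrite !gt_eqF.
    have h1 : 1 <= p2 D by apply: p2_ge1.
    have h2 : 1 <= sDel n.+1 / (sc n.+1 * sdel n.+1).
      rewrite ler_pdivlMr ?mulr_gt0// mul1r; apply: le_trans dD.
      by rewrite ler_piMl ?(ltW d0)//; have /andP[] := c_le1 n.+1.
    exact: mulr_ege1.
  lra.
have E P c dl Dl : P != 0 -> c != 0 -> dl != 0 ->
    (Dl + dl) / (3 / 4 * c * (dl / P)) = 4 / 3 * (P / (c * dl)) * (Dl + dl) :> R.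
  by move=> P0 c1 d1; field; rewrite P0 c1 d1.
rewrite E ?gt_eqF// ?p2_gt0//.
have E' P c dl Dl : c != 0 -> dl != 0 ->
    3 / 4 * (P * 4 * Dl / (c * dl)) = 3 * (P / (c * dl)) * Dl :> R.
  by move=> c1 d1; field; rewrite c1 d1.
rewrite /X (p2D D 2) -E4 E' ?gt_eqF//.
have Y0 : 0 < p2 D / (sc n.+1 * sdel n.+1) by rewrite divr_gt0 ?p2_gt0// mulr_gt0.
have := ler_wpM2l (ltW Y0) dD; have := mulr_ge0 (ltW Y0) (le_trans (ltW d0) dD).
by rewrite -!mulrA !mulrDr; lra.
Qed.

Lemma Sn_le n : (sSn n.+1)%:R <= 2 * X n.+1.
Proof.
have X1 := X_ge1 n; rewrite /lSn -[(Num.truncn _).+1%:R]natr1 -/(X n.+1).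
have : (Num.truncn (X n.+1))%:R <= X n.+1 by rewrite truncn_le; lra.
lra.
Qed.

Lemma Sn_step n : (sSn n.+1)%:R * sstep n.+1 i1 * (sc n.+1 * sN n.+1 i1) / 64 <= sDel n.+1 / 8.
Proof.
have d0 := del_gt0 n.+1; have /andP[c0 _] := c_le1 n.+1.
rewrite (_ : _ * _ * (_ * _) = (sSn n.+1)%:R * (sc n.+1 * (sN n.+1 i1 * sstep n.+1 i1)));
  last by ring.
rewrite N_step.
have Y0 : 0 <= sc n.+1 * (sdel n.+1 * p2 (- D)) by rewrite !mulr_ge0 ?p2_ge0// ltW.
have := ler_wpM2r Y0 (Sn_le n).
rewrite /X (p2D D 2) -E4.
rewrite p2N (_ : 2 * _ * _ = 8 * sDel n.+1); last first.
  by field; rewrite !gt_eqF// p2_gt0.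
lra.
Qed.

Lemma Sn_K n : (4 * sSn n.+1 <= sK n.+1 i1)%N.
Proof.
have [[ie1 _ _ _ _] _] := H; rewrite /lK (negbTE ie1).
rewrite truncn_ge_nat; last by rewrite divr_ge0 ?p2_ge0// ltW// step_gt0.
apply: le_trans (b_over_step n i1); rewrite natrM.
apply: (@le_trans _ _ (8 * X n.+1)); first by have := Sn_le n; lra.
rewrite E8 /X; lf n; lv n; rewrite -!p2D -p2N -!p2D; pe.
have : 0 <= w e * (S n.+1 - S n) by rewrite mulr_ge0// ltW.
lra.
Qed.

Lemma g_ge n : 2 <= sg n.+1.
Proof. lf n; rewrite E2; lv n; pe; lra. Qed.

Lemma g_J n : sg n.+1 <= (sJ n.+1)%:R <= 2 * sg n.+1.
Proof.
rewrite /lJ (ltW (truncnS_gt _))/= -[(Num.truncn _).+1%:R]natr1.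
have : (Num.truncn (sg n.+1))%:R <= sg n.+1 by rewrite truncn_le p2_ge0.
by have := g_ge n; lra.
Qed.

(** The minimality of [w e] enters here: a multiple of order [sg], governed by [w e], stays within
    the growth of every coordinate. *)
Lemma g_N n i : 8 * sg n.+1 * sN n i <= sN n.+1 i.
Proof.
lf n; have [h1 h2 h3] := level_wpos n i.
rewrite E8; lv n; rewrite -!p2D; pe; lra.
Qed.

Lemma Nb_step n i : sN n.+1 i * sb n.+1 i = sdel n.+1 * p2 (- D - 1).
Proof. by lv n; rewrite -!p2D; congr p2; ring. Qed.

Lemma Nb_sum n : \sum_(i | i != e) sN n.+1 i * sb n.+1 i <= sdel n.+1 / 2.
Proof.
apply: (@le_trans _ _ (\sum_(i : 'I_d) sdel n.+1 * p2 (- D - 1))).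
  rewrite [leRHS](bigD1 e)//=; apply: ler_wpDl; first by rewrite mulr_ge0 ?p2_ge0.
  by apply: ler_sum => i _; rewrite Nb_step.
rewrite sumr_const card_ord -mulrnAr ler_pM2l ?del_gt0// p2B p2N p2_1 -mulr_natl.
rewrite mulrA -[leRHS]mul1r ler_pM2r ?invr_gt0// ler_pdivrMr ?p2_gt0// mul1r.
exact: natr_le_p2.
Qed.

Lemma Psi_del n : sPsi n.+1 <= sdel n.+1 / (8 * sg n.+1).
Proof. lf n; rewrite E8; lv n; rewrite -p2D -p2B; pe; lra. Qed.

Lemma Psi_Del n : sPsi n.+1 <= sDel n.+1 / 8.
Proof. lf n; rewrite E8; lv n; rewrite -p2B; pe; lra. Qed.

Lemma A_step n : sA n.+1 <= sg n.+1 * sA n.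
Proof. lf n; lv n; rewrite -p2D; pe; lra. Qed.

Lemma Ah_step n : 4 * sg n.+1 * sAh n <= sAh n.+1.
Proof. lf n; rewrite E4; lv n; rewrite -!p2D; pe; lra. Qed.

Lemma rho_prev n : 4 * sdel n.+1 / sg n.+1 <= srho n.
Proof. lf n; rewrite E4; lv n; rewrite -!p2D -p2B; pe; lra. Qed.

Lemma rho_small n : 4 * srho n.+1 <= sdel n.+1 / (16 * sg n.+1).
Proof.
have [Sn' ST' HT' weT' [n0' dn0']] := level_facts n.+1.
rewrite -[n.+1%:R]natr1 in HT' n0' dn0'.
have [c0 c1 c2] := level_C1 n.+1; rewrite -[n.+1%:R]natr1 in c1 c2.
have hw : w e * (S n.+2 - S n.+1) <= S n.+2 - S n.+1.
  by rewrite ler_piMl//; lf n; lra.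
lf n; rewrite E4 E16; lv n; rewrite -!p2D -p2B; pe; lra.
Qed.

Lemma rho_del n : srho n.+1 <= sdel n.+1 / 4.
Proof.
have h := rho_small n; have d0 := del_gt0 n.+1; have g2 := g_ge n.
have : sdel n.+1 / (16 * sg n.+1) <= sdel n.+1 / 4.
  by rewrite ler_pM2l// lef_pV2 ?posrE//; lra.
have : 0 <= srho n.+1 := p2_ge0 _.
lra.
Qed.

Lemma del_N n : sdel n.+1 <= p2 D * (sN n.+1 i1 * sstep n.+1 i1).
Proof. by rewrite N_step mulrCA -p2D subrr p2_0 mulr1. Qed.

(** Forms of consecutive siblings differ by [phi m], of order [del / g], and have slope of order at
    most [N i1] along [i1]; this gives the spacing [ls]. *)
Lemma s_inv n : sg n * sN n i1 / sdel n = (ls w S t i1 n)^-1.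
Proof. by rewrite /ls; lv n; rewrite -p2D -p2B -p2N; congr p2; ring. Qed.

Lemma c_half n : sc n * sN n i1 / 2 <= 3 / 4 * (sc n * sN n i1).
Proof. by have : 0 <= sc n * sN n i1 by [rewrite mulr_ge0 ?p2_ge0|]; lra. Qed.

End LevelFacts.

(** * Number of children per level *)

Section LevelCounts.
Context {R : realType} {d : nat}.
Context (w : 'I_d -> R) (S : nat -> R) (C1 t : R) (e i1 : 'I_d).
Local Notation D := (d%:R : R).
Local Notation sg := (lg w S e).
Local Notation sdel := (ldel w S t e).
Local Notation sc := (lc C1).
Local Notation sb := (lb w S t e).
Local Notation sstep := (lstep w S t e).
Local Notation sDel := (lDel w S e).
Local Notation sJ := (lJ w S e).
Local Notation sK := (lK w S t e).
Local Notation sSn := (lSn w S C1 t e).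
Local Notation sF := (lF w S C1 t e).

Context (H : level_hyp w S C1 t e i1).
Ltac lf n := have [Sn ST HT weT [n0 dn0]] := level_facts H n;
  have [[i1e wP ws S0 t0] [C1E _]] := H; have D2 := level_D H; have w1 := level_w1 H;
  have /andP[we0 wei1] := wP i1; have [weS0 _ _] := level_wpos H n e; have lT0 := lT_ge H n; have [C10 C1n C1n2] := level_C1 H n.



Lemma big_ne_split (F : 'I_d -> R) : \sum_(i | i != e) F i = \sum_i F i - F e.
Proof. by rewrite [in RHS](bigD1 e)//= addrAC subrr add0r. Qed.

Lemma prod_K n : p2 ((D - 1) * (w e * (lT S n - lT S n.+1) - 2) + (D - w e) * lT S n.+1) <=
    (\prod_i sK n.+1 i)%:R.
Proof.
have [[_ _ ws _ _] _] := H.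
have -> : (D - 1) * (w e * (lT S n - lT S n.+1) - 2) + (D - w e) * lT S n.+1 =
    \sum_(i | i != e) (w e * (lT S n - lT S n.+1) - 2 + (1 + w i) * lT S n.+1).
  have cs c : \sum_(i < d) (c + (1 + w i) * lT S n.+1) = D * c + (D + 1) * lT S n.+1.
    by rewrite big_split/= -mulr_suml big_split/= ws !sumr_const card_ord mulr_natl.
  by rewrite big_ne_split cs; ring.
rewrite p2_sum natr_prod [leRHS](bigD1 e)//= {1}/lK eqxx mul1r; apply: ler_prod => i ie.
rewrite p2_ge0/=.
have := K_half H n ie; rewrite -ler_pdivrMr ?step_gt0// => h.
suff : 2 * p2 (w e * (lT S n - lT S n.+1) - 2 + (1 + w i) * lT S n.+1) <= sb n i / sstep n.+1 i.
  lra.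
have e2 x : 2 * p2 x = p2 (x + 1) by rewrite p2D p2_1 mulrC.
by rewrite /lstep /lb !e2 -p2B; pe; rewrite /lT /=; lra.
Qed.

Lemma prod_K_big n : p2 (lT S n.+1 - 2) <= (\prod_i sK n.+1 i)%:R.
Proof.
have [[ie1 _ _ _ _] _] := H.
have Kge i : i != e -> p2 (lT S n.+1 - 2) <= (sK n.+1 i)%:R.
  move=> ie; have := K_half H n ie; rewrite -ler_pdivrMr ?step_gt0// => h.
  have := b_over_step H n i.
  have -> : lT S n.+1 - 1 = 1 + (lT S n.+1 - 2) by ring.
  by rewrite (p2D 1) p2_1; lra.
apply: le_trans (Kge _ ie1) _; rewrite ler_nat (bigD1 i1)//=; apply: leq_pmulr.
apply: prodn_gt0 => i; have [->|ie] := eqVneq i e; first by rewrite /lK eqxx.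
by rewrite -(ltr_nat R); apply: lt_le_trans (Kge i ie); exact: p2_gt0.
Qed.

Lemma Sn_exp n : (4 * (2 * sSn n.+1 + 1))%:R <= p2 (2 * C1 * n.+1%:R ^+ 2).
Proof.
have := Sn_le H n.
have -> : p2 (D + 2) * sDel n.+1 / (sc n.+1 * sdel n.+1) =
    p2 (6 * D + 19 + 6 * n%:R + D * (n%:R + 1) + C1 * (n%:R + 1) ^+ 2 + t).
  by lv n; rewrite -!p2D -p2B; congr p2; ring.
set E := _ + t => h; lf n.
have n1 : 0 <= n%:R * n%:R :> R by rewrite mulr_ge0.
have C1n' : 0 <= C1 * (n%:R ^+ 2 + 2 * n%:R).
  by rewrite mulr_ge0 ?addr_ge0 ?exprn_ge0// ?mulr_ge0//; lra.
have hE : E + 5 <= 2 * C1 * n.+1%:R ^+ 2.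
  have h2 : 6 * D + 24 + 6 * n%:R + D * (n%:R + 1) + t <= C1 * (n%:R + 1) ^+ 2.
    have -> : C1 * (n%:R + 1) ^+ 2 = C1 + C1 * n%:R + (C1 * n%:R + C1 * n%:R ^+ 2) by ring.
    have : 0 <= C1 * n%:R by rewrite mulr_ge0//; lra.
    lra.
  by rewrite /E -[n.+1%:R]natr1; lra.
apply: le_trans (p2_le hE); have -> : p2 (E + 5) = 32 * p2 E.
  by rewrite p2D p2_nat; ring.
have : 1 <= p2 E.
  apply: p2_ge1; rewrite /E; have : 0 <= C1 * (n%:R + 1) ^+ 2 by rewrite mulr_ge0 ?exprn_ge0//; lra.
  have : 0 <= D * (n%:R + 1) by rewrite mulr_ge0 ?addr_ge0//; lra.
  lra.
by rewrite natrM natrD natrM; lra.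
Qed.

(** The exponent is arranged to telescope over the levels: the first term sums to [D * S n], the
    second leaves only the last gap, and the errors sum to order [C1 * n^3]. *)
Lemma FJ_ge n : p2 (D * lT S n.+1 + (D - 1) * (w e * (lT S n - lT S n.+1)) - 3 * C1 * n.+1%:R ^+ 2)
   <= (sF n.+1 * sJ n.+1)%:R.
Proof.
set Q := (4 * (2 * sSn n.+1 + 1))%N.
have Q0 : (0 < Q)%N by rewrite /Q addn1.
have QE : Q%:R <= p2 (2 * C1 * n.+1%:R ^+ 2) := Sn_exp n.
have QK : 2 * Q%:R <= (\prod_i sK n.+1 i)%:R :> R.
  apply: le_trans (prod_K_big n); apply: (@le_trans _ _ (p2 (1 + 2 * C1 * n.+1%:R ^+ 2))).
    by rewrite (p2D 1) p2_1; lra.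
  have [_ _ h1 h2 _] := level_facts H n; pe; rewrite /lT /=.
  have : (1 - w e) * (S n.+1 - S n) <= S n.+1 - S n.
    have [_ h3 _ _ _] := level_facts H n; rewrite ler_piMl//.
    by have [[_ /(_ e)/andP[h4 _] _ _ _] _] := H; lra.
  rewrite -[n.+1%:R]natr1; have [_ _ _ _ [n0 dn0]] := level_facts H n.
  by have D2 := level_D H; have [[_ _ _ _ t0] _] := H; lra.
have F1 : (\prod_i sK n.+1 i)%:R <= 2 * Q%:R * (sF n.+1)%:R :> R.
  have : (\prod_i sK n.+1 i)%:R < (sF n.+1).+1%:R * Q%:R :> R.
    by rewrite -natrM ltr_nat /lF ltn_ceil.
  by rewrite -[(sF n.+1).+1%:R]natr1; lra.
have J1 : sg n.+1 <= (sJ n.+1)%:R by case/andP: (g_J H n).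
have Q20 : 0 < 2 * p2 (2 * C1 * n.+1%:R ^+ 2) by rewrite mulr_gt0 ?p2_gt0.
have F2 : p2 ((D - 1) * (w e * (lT S n - lT S n.+1) - 2) + (D - w e) * lT S n.+1)
   / (2 * p2 (2 * C1 * n.+1%:R ^+ 2)) <= (sF n.+1)%:R.
  rewrite ler_pdivrMr//; apply: le_trans (prod_K n) _; apply: (le_trans F1).
  by rewrite mulrC ler_wpM2l// ler_pM2l.
rewrite natrM; apply: le_trans (ler_pM _ _ F2 J1); rewrite ?divr_ge0 ?p2_ge0//; last first.
  by rewrite mulr_ge0// p2_ge0.
rewrite -{2}[2]p2_1 -p2D -p2B -p2D; pe; rewrite /lT /=.
have [h1 h2 h3] := level_C1 H n.+1; have D2 := level_D H.
have h4 : 1 <= n.+1%:R ^+ 2 :> R by rewrite exprn_ege1// ler1n.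
have h5 : C1 <= C1 * n.+1%:R ^+ 2 by rewrite ler_peMr//; have [[_ _ _ _ t0] _] := H; lra.
have [[_ _ _ _ t0] _] := H.
move: (n.+1%:R ^+ 2) h4 h5 h3 => q h4 h5 h3; lra.
Qed.

End LevelCounts.

(** * The tree of slabs *)

Section Tree.
Context {R : realType} {V : zmodType} {d : nat}.
Context (y : 'I_d -> {additive V -> R}) (k : {additive V -> R}).
Context (w : 'I_d -> R) (S : nat -> R) (C1 t0 : R) (e i1 : 'I_d).
Local Notation D := (d%:R : R).
Local Notation sN := (lN w S).
Local Notation sA := (lA w S e).
Local Notation sAh := (lAh w S e).
Local Notation sg := (lg w S e).
Local Notation sdel := (ldel w S t0 e).
Local Notation srho := (lrho S t0).
Local Notation sPsi := (@lPsi R d S t0).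
Local Notation sc := (lc C1).
Local Notation sb := (lb w S t0 e).
Local Notation sstep := (lstep w S t0 e).
Local Notation sDel := (lDel w S e).
Local Notation sJ := (lJ w S e).
Local Notation sU := (lU w S C1 i1).
Local Notation sG := (lG w S C1 e i1).
Local Notation sK := (lK w S t0 e).
Local Notation sSn := (lSn w S C1 t0 e).
Local Notation sF := (lF w S C1 t0 e).
Local Notation sYb := (lYb w S e).
Local Notation node := (V * ('I_d -> R))%type.

Definition node_ok n (nu : node) :=
  nodeinv y k e i1 (sA n) (sAh n) (sc n * sN n i1 / 2) (sPsi n) (sN n) (sU n) (sb n) nu.
Definition node_region n (nu : node) (x : 'I_d -> R) :=
  region y k e (sb n) (srho n) nu x.
(** Flat boxes: apart from the direction [i1], they are no longer than a cell and move no form of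
    level [n] by more than the width of a slab. *)
Definition thin n (t : 'I_d -> R) := [/\ forall i, 0 <= t i,
  forall i, i != e -> i != i1 -> t i <= sb n i &
  \sum_(i | i != i1) sYb n i * t i <= srho n].

Context (H : level_hyp w S C1 t0 e i1)
  (rnd : forall ys : 'I_d -> R, exists v, forall i, `|y i v - ys i| <= 2)
  (orth : exists2 o, forall i, y i o = 0 & k o = 1).

(** The lower bound on [y e m] that [dirichlet] requires, at every level. *)
Lemma A_half n : 1 / 2 <= sA n.
Proof.
have [[_ wP _ S0 _] [_ HS]] := H; rewrite /lA.
have h : 6 * n%:R <= w e * S n.
  elim: n => [|n IH]; first by rewrite S0 !mulr0.
  have := HS n; rewrite -[n.+1%:R]natr1.
  have [h1 _ _] := level_C1 H 0; have D2 := level_D H.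
  have n0 : 0 <= n%:R :> R by [].
  have : 0 <= D * (n%:R + 1) by rewrite mulr_ge0//; lra.
  have : 0 <= C1 * (n%:R + 1) ^+ 2.
    have [[_ _ _ _ t00] _] := H.
    by rewrite mulr_ge0 ?exprn_ge0//; lra.
  have [[_ _ _ _ t00] _] := H.
  rewrite -[2 * C1 * _]mulrA; move: (C1 * _) (D * _) => *; lra.
have -> : 1 / 2 = p2 (-1) :> R by rewrite p2N p2_1 div1r.
by apply: p2_le; lra.
Qed.

Lemma step_children n nu : node_ok n nu -> exists cs : seq node,
  [/\ size cs = (sF n.+1 * sJ n.+1)%N,
   forall nu', nu' \in cs -> node_ok n.+1 nu',
   forall nu', nu' \in cs -> forall x, node_region n.+1 nu' x -> node_region n nu x &
   forall a t, thin n.+1 t ->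
    (count (hit y k e (sb n.+1) (srho n.+1) a t) cs)%:R <=
      (3 ^ d)%:R * (224 + 3 * p2 D) * (1 + t i1 / ls w S t0 i1 n.+1)].
Proof.
case: nu => m y0 [/= qA mN m1 nd].
have [[i1e wP ws _ t00] _] := H.
have Ah := A_half n; have /andP[Aq qAh] := qA.
have A0 : 0 < sA n by rewrite p2_gt0.
have q0 : 0 < y e m by lra.
have m10 : 0 <= y i1 m by apply: le_trans m1; rewrite divr_ge0 ?mulr_ge0 ?p2_ge0.
have dir x : exists v, [/\ ~ inZ m v, forall i, i != e -> `|gam y e m v i| <= sN n.+1 i
     & `|th y k e m v x| <= sDel n.+1].
  apply: dirichlet => //; first by lra.
  - by move=> i _; have := N_ge H n i; lra.
  - by move=> i ie; apply: (slope H) Aq; rewrite normr_ge0 mN.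
  - by rewrite p2_gt0 (Del_le1 H).
  - exact: (dir_big H).
pose P := \max_i sK n.+1 i.
have KP i : (sK n.+1 i <= P.+1)%N by rewrite (leq_trans (leq_bigmax i)).
have G1 : sG n.+1 i1 = sc n.+1 * sN n.+1 i1 by rewrite /lG eqxx.
have GN i : i != e -> i != i1 -> sG n.+1 i = sN n.+1 i.
  by move=> /negPf ie /negPf ii; rewrite /lG ii ie.
have delD : 0 < sdel n.+1 <= sDel n.+1 by rewrite p2_gt0 (del_le_Del H).
have [good [eta [goodP goodK goodn]]] := good_count (P := P) i1e q0 nd dir (U_le_G H n)
   (step_gt0 w S t0 e n.+1)
   (K_step H n) KP (c_le1 H n.+1) G1 GN (p2_gt0 _) delD (Del_Psi H n) (G_step H n)
   (Psi_UK H n) (bad_small H n) (Nstep_le w S t0 e n i1) (Sn_ge H n) (Sn_K H n).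
(* Truncation gives all nodes of a level equally many children, so that proportions of nodes behave
   like a measure. *)
pose L := take (sF n.+1) (enum good).
have LgP l : l \in L -> l \in good by move/mem_take; rewrite mem_enum.
have g0 : 0 < sg n.+1 by exact: p2_gt0.
have J0 : (0 < sJ n.+1)%N by [].
have gP l : l \in L -> _ := fun lL => goodP l (LgP l lL).
have bS i : i != e -> sstep n.+1 i = 2 * sb n.+1 i by [].
have c0 : 0 < sc n.+1 by exact: p2_gt0.
have jJ j : j \in iota (sJ n.+1) (sJ n.+1) -> (sJ n.+1 <= j < 2 * sJ n.+1)%N.
  by rewrite mem_iota addnn mul2n.
have N0 i : 0 <= sN n.+1 i by exact: p2_ge0.
have b0 i : 0 < sb n.+1 i by exact: p2_gt0.
have b00 i : 0 <= sb n.+1 i by exact: p2_ge0.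
have gN i : i != e -> 8 * sg n.+1 * sN n i <= sN n.+1 i by move=> _; exact: (g_N H).
have cL l j (lL : l \in L) jL := child_last (k := k) A0 qA (gP l lL) (g_J H n) (jJ j jL).
have cC l j i (lL : l \in L) (jL : j \in _) (ie : i != e) :=
  child_coord (k := k) A0 qA mN (gP l lL) g0 (g_J H n) (jJ j jL) gN ie.
exists (children m y0 (sstep n.+1) (sJ n.+1) eta L); split.
- rewrite size_allpairs size_iota size_takel// -cardE.
  have c4 : (0 < 4 * (2 * sSn n.+1 + 1))%N by rewrite addn1.
  by rewrite -(mulKn #|good| c4) leq_div2r.
- move=> _ /allpairsP[[l j] [/= lL jL ->]]; split => /=.
  + have /andP[h1 h2] := cL l j lL jL.
    apply/andP; split.
      by apply: le_trans (A_step H n) _; apply: le_trans h1; rewrite ler_pM2l.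
    by apply: (le_trans h2); apply: le_trans (Ah_step H n); rewrite ler_pM2l// mulr_gt0.
  + by move=> i ie; exact: cC.
  + apply: le_trans (c_half _ _ _ _ _) _.
    exact: (child_first (k := k) A0 qA m10 (gP l lL) g0 (g_J H n) (jJ j jL)).
  + have U1 : sU n.+1 i1 = sc n.+1 * sN n.+1 i1 / 64 by rewrite /lU eqxx.
    have UN i : i != e -> i != i1 -> sU n.+1 i = sN n.+1 i / 4.
      by move=> _ /negPf ii; rewrite /lU ii.
    have r0 : 0 <= (sSn n.+1)%:R * sstep n.+1 i1 by rewrite mulr_ge0// ltW// step_gt0.
    exact: (child_nondeg i1e A0 qA (gP l lL) c0 (p2_gt0 _) g0 (g_J H n) (jJ j jL) b00 N0
      (Nb_sum w S t0 e n) (del_le_Del H n) (Sn_step H n) (Psi_Del H n) (Psi_del H n) U1 UN r0).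
- move=> _ /allpairsP[[l j] [/= lL jL ->]] x [/= xb xp]; split => /=.
    move=> i ie; have /andP[x1 x2] := xb i ie; move: x1 x2; rewrite /gridpt /lstep => x1 x2.
    have s0 := b0 i; apply/andP; split.
      by apply: le_trans x1; rewrite lerDl mulr_ge0// mulr_ge0// ltW.
    apply: (le_trans x2); rewrite -addrA lerD2l; apply: le_trans (K_step H n i).
    apply: (@le_trans _ _ ((l i).+1%:R * sstep n.+1 i)).
      by rewrite -[(l i).+1%:R]natr1 /lstep mulrDl mul1r; lra.
    by rewrite ler_pM2r ?step_gt0// ler_nat goodK// LgP.
  have /andP[_] := phi_child_range A0 qA (gP l lL) (p2_gt0 _) g0 (g_J H n) (jJ j jL)
     (Nb_sum w S t0 e n) xb xp (rho_del H n).
  by move/le_trans; apply; exact: (rho_prev H).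
- move=> a t [tt0 tb tY].
  have Le l : l \in L -> l e = ord0.
    move=> lL; apply: val_inj; have := goodK l (LgP l lL) e.
    by rewrite /lK eqxx ltnS leqn0 => /eqP.
  have mY i l j : l \in L -> j \in iota (sJ n.+1) (sJ n.+1) ->
      `|y i (eta l + m *~ j%:Z)| <= sYb n.+1 i.
    move=> lL jL; rewrite /lYb; have [->|ie] := eqVneq i e; last exact: cC.
    have /andP[h1 h2] := cL l j lL jL; rewrite ger0_norm.
      by apply: (le_trans h2); apply: le_trans (Ah_step H n); rewrite ler_pM2l// mulr_gt0.
    by apply: le_trans h1; rewrite mulr_ge0// ltW.
  have Y1 : sYb n.+1 i1 = 2 * sN n.+1 i1 by rewrite /lYb (negPf i1e).
  have g1 : 1 <= sg n.+1 by have := g_ge H n; lra.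
  have uL : uniq L by rewrite take_uniq ?enum_uniq.
  rewrite -(s_inv w S t0 e i1).
  apply: (hit_count a i1e A0 qA mN m10 c0 (p2_gt0 _) g1 (g_J H n) J0 gN b0 N0 (Nb_sum w S t0 e n) uL gP Le
    bS tt0 tb (rho_small H n) mY Y1 tY (p2_ge0 _) (del_N _ _ _ _ _ _)).
Qed.

End Tree.

(** * Counting the slabs that meet a cube *)

Lemma count_flatten_le (R : realType) (T : eqType) (s : seq T) (f : T -> seq T) (p p' : pred T) (M : R) :
  0 <= M -> (forall x, x \in s -> p x -> (count p' (f x))%:R <= M) ->
  (forall x, x \in s -> forall x', x' \in f x -> p' x' -> p x) ->
  (count p' (flatten [seq f x | x <- s]))%:R <= M * (count p s)%:R.
Proof.
move=> M0; elim: s => [|x s IH] h1 h2 /=; first by rewrite mulr0.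
rewrite count_cat natrD natrD mulrDr lerD//; last first.
  by apply: IH => z zs; [apply: h1|apply: h2]; rewrite inE zs orbT.
have [px|px] := boolP (p x); first by rewrite mulr1 h1// mem_head.
rewrite mulr0 lern0 -leqn0 leqNgt -has_count; apply/hasPn => x' x'f.
by apply/negP => px'; move/negP: px; apply; apply: (h2 x) px' => //; rewrite mem_head.
Qed.

Lemma count_cover (T : Type) (I : finType) (A : {set I}) (p : pred T) (P : I -> pred T) (s : seq T) :
  (forall x, p x -> exists2 l, l \in A & P l x) ->
  (count p s <= \sum_(l in A) count (P l) s)%N.
Proof.
move=> h; elim: s => [|x s IH] //=; rewrite big_split/=; apply: leq_add => //.
have [px|//] := boolP (p x); have [l lA Pl] := h x px.
by rewrite (bigD1 l)//= Pl.
Qed.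

Section Counting.
Context {R : realType} {V : zmodType} {d : nat}.
Context (y : 'I_d -> {additive V -> R}) (k : {additive V -> R}).
Context (w : 'I_d -> R) (S : nat -> R) (C1 t0 : R) (e i1 : 'I_d).
Local Notation D := (d%:R : R).
Local Notation sN := (lN w S).
Local Notation srho := (lrho S t0).
Local Notation sc := (lc C1).
Local Notation sb := (lb w S t0 e).
Local Notation sJ := (lJ w S e).
Local Notation sF := (lF w S C1 t0 e).
Local Notation sYb := (lYb w S e).
Local Notation node := (V * ('I_d -> R))%type.


Local Notation node_ok := (node_ok y k w S C1 t0 e i1).
Local Notation node_region := (node_region y k w S t0 e).
Local Notation thin := (thin w S t0 e i1).

Definition hits n (Q : ('I_d -> R) -> Prop) (nu : node) : bool :=
  `[< exists x, Q x /\ node_region n nu x >].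

Context (H : level_hyp w S C1 t0 e i1) (ch : nat -> node -> seq node) (nu0 : node).

Fixpoint tree n : seq node :=
  if n is n'.+1 then flatten [seq ch n' nu | nu <- tree n'] else [:: nu0].

Context (ok0 : node_ok 0 nu0)
  (chP : forall n nu, node_ok n nu ->
  [/\ size (ch n nu) = (sF n.+1 * sJ n.+1)%N,
   forall nu', nu' \in ch n nu -> node_ok n.+1 nu',
   forall nu', nu' \in ch n nu -> forall x, node_region n.+1 nu' x -> node_region n nu x &
   forall a t, thin n.+1 t ->
    (count (hit y k e (sb n.+1) (srho n.+1) a t) (ch n nu))%:R <=
      (3 ^ d)%:R * (224 + 3 * p2 D) * (1 + t i1 / ls w S t0 i1 n.+1)]).

Lemma tree_ok n nu : nu \in tree n -> node_ok n nu.
Proof.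
elim: n nu => [|n IH] nu; first by rewrite inE => /eqP ->.
by move=> /= /flatten_mapP[nu' /IH ok']; case: (chP ok') => _ + _ _; apply.
Qed.

Lemma tree_size n : size (tree n.+1) = (size (tree n) * (sF n.+1 * sJ n.+1))%N.
Proof.
rewrite /= size_flatten /shape -map_comp sumnE big_map big_seq.
rewrite (eq_bigr (fun=> (sF n.+1 * sJ n.+1)%N)) => [|nu /tree_ok/chP[]//].
by rewrite -big_seq big_const_seq count_predT iter_addn_0 mulnC.
Qed.

Lemma tree_region n nu' : nu' \in tree n.+1 ->
  exists2 nu, nu \in tree n & forall x, node_region n.+1 nu' x -> node_region n nu x.
Proof.
move=> /= /flatten_mapP[nu nuT nu'c]; exists nu => //.
by case: (chP (tree_ok nuT)) => _ _ h _; exact: h.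
Qed.

Lemma hits_step n Q (M : R) : 0 <= M ->
  (forall nu, nu \in tree n -> hits n Q nu -> (count (hits n.+1 Q) (ch n nu))%:R <= M) ->
  (count (hits n.+1 Q) (tree n.+1))%:R <= M * (count (hits n Q) (tree n))%:R.
Proof.
move=> M0 h; apply: count_flatten_le => // nu nuT nu' nu'c /asboolP[x [Qx xr]].
apply/asboolP; exists x; split=> //.
by case: (chP (tree_ok nuT)) => _ _ nest _; exact: nest xr.
Qed.

Lemma hits_ratio n Q :
  (count (hits n.+1 Q) (tree n.+1))%:R <=
     (sF n.+1 * sJ n.+1)%:R * (count (hits n Q) (tree n))%:R :> R.
Proof.
apply: hits_step => // nu /tree_ok/chP[<- _ _ _] _.
by rewrite ler_nat count_size.
Qed.

Definition box (a t x : 'I_d -> R) : Prop := forall i, a i <= x i <= a i + t i.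

(* The slab of a parent meets the box in a segment of length at most
   12 rho / (c N) along the coordinate i1, whatever the length t i1 of the box. *)
Lemma hits_thin n a t : thin n.+1 t -> \sum_(i | i != i1) sYb n i * t i <= srho n ->
  (count (hits n.+1 (box a t)) (tree n.+1))%:R <=
   (3 ^ d)%:R * (224 + 3 * p2 D) *
     (1 + Num.min (t i1) (12 * srho n / (sc n * sN n i1)) / ls w S t0 i1 n.+1)
   * (count (hits n (box a t)) (tree n))%:R.
Proof.
move=> tt tY; have [tt0 tb tY'] := tt.
set L := 12 * _ / _; have L0 : 0 <= L by rewrite divr_ge0 ?mulr_ge0 ?p2_ge0.
apply: hits_step.
  rewrite mulr_ge0//; first by rewrite mulr_ge0// addr_ge0// mulr_ge0// p2_ge0.
  by rewrite addr_ge0// divr_ge0 ?p2_ge0// le_min tt0.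
move=> nu nuT /asboolP[x0 [x0b [x0r1 x0r2]]].
have [_ _ nest cnt] := chP (tree_ok nuT).
have [qA yN ylo _] := tree_ok nuT.
have cN0 : 0 < sc n * sN n i1 by rewrite mulr_gt0 ?p2_gt0.
have i1e : i1 != e by case: H => [[]].
have y1 : 0 < y i1 nu.1 by apply: lt_le_trans ylo; rewrite divr_gt0.
have yY i : `|y i nu.1| <= sYb n i.
  rewrite /lYb; have [->|ie] := eqVneq i e; last exact: yN.
  case/andP: qA => q1 q2; rewrite ger0_norm//; apply: le_trans q1; exact: p2_ge0.
have near x : box a t x -> node_region n nu x -> `|x i1 - x0 i1| <= L / 2.
  move=> xb [xr1 xr2].
  have E : y i1 nu.1 * (x i1 - x0 i1) = phi y k nu.1 x - phi y k nu.1 x0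
      - \sum_(i | i != i1) y i nu.1 * (x i - x0 i).
    by rewrite phi_sub (bigD1 i1)//= addrK.
  have : `|y i1 nu.1 * (x i1 - x0 i1)| <= 3 * srho n.
    rewrite E (le_trans (ler_normB _ _))//.
    have h1 : `|phi y k nu.1 x - phi y k nu.1 x0| <= srho n + srho n.
      by rewrite (le_trans (ler_normB _ _))// lerD.
    have h2 : `|\sum_(i | i != i1) y i nu.1 * (x i - x0 i)| <= srho n.
      apply: le_trans tY; apply: le_trans (ler_norm_sum _ _ _) _; apply: ler_sum => i ii.
      rewrite normrM ler_pM// ler_norml.
      by move: (xb i) (x0b i) => /andP[? ?] /andP[? ?]; lra.
    lra.
  rewrite normrM (gtr0_norm y1) => h.
  have : sc n * sN n i1 / 2 * `|x i1 - x0 i1| <= 3 * srho n.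
    by apply: le_trans h; rewrite ler_wpM2r.
  have -> : L / 2 = 6 * srho n / (sc n * sN n i1) by rewrite /L; field; rewrite !gt_eqF ?p2_gt0.
  rewrite ler_pdivlMr//; lra.
(* A box longer than [L] is cut along [i1] down to the interval of length [L] centred at [x0 i1],
   outside which it misses the slab of the parent. *)
pose a' i := if i == i1 then (if t i1 <= L then a i1 else x0 i1 - L / 2) else a i.
pose t' i := if i == i1 then Num.min (t i1) L else t i.
have tt' : thin n.+1 t'.
  split.
  - by move=> i; rewrite /t'; case: ifP => // _; rewrite le_min tt0.
  - by move=> i ie ii; rewrite /t' (negPf ii) tb.
  - by rewrite (eq_bigr (fun i => sYb n.+1 i * t i))// => i /negPf ii; rewrite /t' ii.
have := cnt a' t' tt'; rewrite {2}/t' eqxx; apply: le_trans.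
have sub : forall nu', nu' \in ch n nu -> hits n.+1 (box a t) nu' ->
    hit y k e (sb n.+1) (srho n.+1) a' t' nu'.
  move=> nu' nu'c /asboolP[x [xb xr]]; apply/asboolP; exists x; split=> // i.
  rewrite /a' /t'; have [->|ii] := eqVneq i i1; last exact: xb.
  have := near x xb (nest _ nu'c _ xr); rewrite /Num.min ler_norml.
  have := xb i1; case: (lerP (t i1) L) => hL /andP[b1 b2] /andP[b3 b4].
    rewrite lt_neqAle hL andbT; case: eqVneq => [tE|_]; last by rewrite b1.
    by rewrite b1 -tE.
  by rewrite ltNge (ltW hL) /=; lra.
rewrite ler_nat (@eq_in_count _ _ (predI (hits n.+1 (box a t)) (hit y k e (sb n.+1) (srho n.+1) a' t'))).
  by apply: sub_count => nu' /= /andP[].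
by move=> nu' /sub h /=; apply/idP/andP => [h'|[]//]; split=> //; apply: h.
Qed.

Lemma tree_size_ge n : p2 (D * S n - (D - 1) * (w e * lT S n) - 3 * C1 * n%:R ^+ 3)
  <= (size (tree n))%:R.
Proof.
elim: n => [|n IH].
  have [[_ _ _ S0 _] _] := H.
  by rewrite /lT /= subrr S0 expr0n /= !mulr0 !subr0 p2_0.
rewrite (tree_size) natrM.
apply: le_trans (ler_pM (p2_ge0 _) (p2_ge0 _) IH (FJ_ge H n)).
rewrite -p2D; apply: p2_le; rewrite /lT /= -[n.+1%:R]natr1.
have [h1 h2 h3] := level_C1 H n; have [[_ _ _ _ t00] _] := H; have D2 := level_D H.
have : 0 <= C1 * n%:R by rewrite mulr_ge0//; lra.
lra.
Qed.

Lemma S_mono m n : (m <= n)%N -> S m <= S n.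
Proof.
move=> mn; rewrite -(subnK mn); elim: (n - m)%N => [|p IH]; first by rewrite add0n.
by rewrite addSn (le_trans IH)// -subr_ge0; have [] := level_facts H (p + m)%N.
Qed.

(** Short enough for [thin] at every level up to [K] at once, so that one box can be followed down
    the tree. *)
Definition tside K i := p2 (- (1 + w i) * S K.+1 - 9 - t0 - D).

Lemma thin_side K l (t : 'I_d -> R) : (l <= K)%N -> 0 <= t i1 ->
  (forall i, i != i1 -> t i = tside K i) -> thin l t.
Proof.
move=> lK t10 tE.
have [[i1e wP _ _ t00] _] := H.
have SlK : S l <= S K.+1 by apply: S_mono; exact: leqW.
have SlK' : S l.+1 <= S K.+1 by apply: S_mono.
have l0 : 0 <= l%:R :> R by [].
split=> [i|i ie ii|].
- by have [->//|ii] := eqVneq i i1; rewrite tE// p2_ge0.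
- rewrite tE// /tside /lb; apply: p2_le; have /andP[we0 wi] := wP i.
  have := lT_ge H l; have : 0 <= (1 + w i) * (S K.+1 - S l) by rewrite mulr_ge0//; lra.
  by rewrite /lT; lra.
apply: (@le_trans _ _ (\sum_(i < d) srho l * p2 (- D))); last first.
  rewrite sumr_const card_ord -(mulr_natr (srho l * _)) -mulrA ler_piMr ?p2_ge0//.
  by rewrite p2N mulrC ler_pdivrMr ?p2_gt0// mul1r natr_le_p2.
rewrite big_mkcond/=; apply: ler_sum => i _.
have [->|ii] := eqVneq i i1; first by rewrite mulr_ge0// p2_ge0.
have /andP[we0 wi] := wP i.
have h : 0 <= w i * (S K.+1 - S l) by rewrite mulr_ge0//; lra.
rewrite /= tE// /tside /lYb; case: eqP => [->|ie].
  have h' : 0 <= w e * (S K.+1 - S l) by rewrite mulr_ge0//; lra.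
  by rewrite /lAh /lrho -!p2D; apply: p2_le; lra.
have -> : 2 * sN l i = p2 (1 + (w i * S l - l%:R)) by rewrite (p2D 1) p2_1.
by rewrite /lrho -!p2D; apply: p2_le; lra.
Qed.

Let Cd : R := (3 ^ d)%:R * (224 + 3 * p2 D).

Let Cd_le : 0 <= Cd /\ 3 * Cd <= p2 C1.
Proof.
have p0 := p2_ge0 D; have p1 : 1 <= p2 D by apply: p2_ge1.
split; first by rewrite /Cd mulr_ge0//; lra.
have h3 : (3 ^ d)%:R <= p2 (2 * D).
  rewrite natrX; apply: pow_le_p2; rewrite p2_nat; lra.
have h : 3 * (224 + 3 * p2 D) <= p2 (10 + D).
  have e10 : p2 (10 : R) = 1024 by rewrite p2_nat; ring.
  by rewrite p2D e10; lra.
have := ler_pM _ _ h3 h; rewrite -p2D => h'.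
apply: (@le_trans _ _ (p2 (2 * D + (10 + D)))); last first.
  by apply: p2_le; have [h1 _ _] := level_C1 H 0; have [[_ _ _ _ t00] _] := H; have := level_D H; lra.
rewrite /Cd mulrCA; apply: h' => //; lra.
Qed.

(** While the box is at most twice the spacing of siblings, a level multiplies the count by at most
    [3 * Cd], which [2^C1] bounds. *)
Lemma hits_small K a (t : 'I_d -> R) : (forall l, (l <= K)%N -> thin l t) ->
  forall l, (l <= K)%N -> (forall m, (0 < m <= l)%N -> t i1 <= 2 * ls w S t0 i1 m) ->
  (count (hits l (box a t)) (tree l))%:R <= p2 (C1 * l%:R).
Proof.
move=> tt; elim=> [|l IH] lK ts; first by rewrite mulr0 p2_0 /= addn0 lern1 leq_b1.
have [_ _ tY] := tt l (ltnW lK); have [Cd0 Cd3] := Cd_le.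
apply: le_trans (hits_thin _ (tt _ lK) tY) _; rewrite -/Cd.
have -> : C1 * l.+1%:R = C1 + C1 * l%:R by rewrite -[l.+1%:R]natr1; ring.
rewrite (p2D C1); apply: ler_pM => //.
- apply: mulr_ge0 => //; rewrite addr_ge0// divr_ge0 ?p2_ge0// le_min.
  by have [h _ _] := tt _ lK; rewrite h divr_ge0 ?mulr_ge0 ?p2_ge0.
- apply: le_trans Cd3; rewrite [leRHS]mulrC; apply: ler_wpM2l => //.
  suff : Num.min (t i1) (12 * srho l / (sc l * sN l i1)) / ls w S t0 i1 l.+1 <= 2 by lra.
  rewrite ler_pdivrMr ?p2_gt0//; apply: le_trans (ts _ _); first by rewrite ge_min lexx.
  by rewrite ltnSn.
- by apply: IH => [|m /andP[m0 ml]]; [exact: ltnW|apply: ts; rewrite m0 leqW].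
Qed.

Lemma ell_over_s l : 12 * srho l / (sc l * sN l i1) / ls w S t0 i1 l.+1
  <= 12 * p2 (w i1 * (S l.+1 - S l) + C1 * l%:R ^+ 2 + 2).
Proof.
by rewrite -!mulrA ler_pM2l// /lrho /lc /lN /ls -p2D -!p2N -!p2D; apply: p2_le; lra.
Qed.

(** Level [j] contributes a factor of about [rho / ls j], that is, [rho * 2^((1 + w i1) * S j)].
    Each later level contributes about [2^(w i1 * (S l.+1 - S l))] by [hits_thin], and these factors
    telescope. *)
Lemma hits_large K a (t : 'I_d -> R) (rho : R) (j : nat) :
  (forall l, (l <= K)%N -> thin l t) -> t i1 = 2 * rho ->
  (0 < j)%N -> ls w S t0 i1 j <= rho ->
  (forall m, (0 < m < j)%N -> rho <= ls w S t0 i1 m) ->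
  forall l, (j <= l <= K)%N -> (count (hits l (box a t)) (tree l))%:R <=
    rho * p2 (S j + w i1 * S l + 3 + t0 + 2 * C1 * l%:R ^+ 3).
Proof.
move=> tt t1 j0 sj sm.
have [Cd0 Cd3] := Cd_le; have [[_ wP _ _ t00] _] := H; have D2 := level_D H.
have C10 : 0 <= C1 by have [] := level_C1 H 0; lra.
have rho0 : 0 < rho by apply: lt_le_trans sj; exact: p2_gt0.
have nn l : 0 <= C1 * l%:R /\ 0 <= C1 * l%:R ^+ 2 by rewrite !mulr_ge0// exprn_ge0.
elim=> [/andP[/(leq_trans j0)//]|l IH] /andP[jl lK].
have [_ _ tY] := tt l (ltnW lK).
apply: le_trans (hits_thin _ (tt _ lK) tY) _; rewrite -/Cd.
set mn := Num.min _ _.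
have mn0 : 0 <= mn / ls w S t0 i1 l.+1.
  rewrite divr_ge0 ?p2_ge0// le_min.
  by have [h _ _] := tt _ lK; rewrite h divr_ge0 ?mulr_ge0 ?p2_ge0.
have [lj|lj] := ltnP l j.
  have {jl} jE : j = l.+1 by apply/eqP; rewrite eqn_leq jl lj.
  have h : Cd * (1 + mn / ls w S t0 i1 l.+1) <= p2 C1 * (rho / ls w S t0 i1 l.+1).
    apply: (@le_trans _ _ (3 * Cd * (rho / ls w S t0 i1 l.+1))); last first.
      by apply: ler_wpM2r => //; rewrite divr_ge0 ?p2_ge0// ltW.
    have E3 (x z : R) : 3 * x * z = x * (3 * z) by ring.
    rewrite E3; apply: ler_wpM2l => //.
    have h1 : 1 <= rho / ls w S t0 i1 l.+1 by rewrite ler_pdivlMr ?p2_gt0// mul1r -jE.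
    suff : mn / ls w S t0 i1 l.+1 <= 2 * (rho / ls w S t0 i1 l.+1) by lra.
    by rewrite mulrA ler_pM2r ?invr_gt0 ?p2_gt0// -t1 ge_min lexx.
  have := hits_small a tt (ltnW lK) => /(_ _)/= hs.
  apply: le_trans (ler_pM _ _ h (hs _)) _ => //.
  - by rewrite mulr_ge0// addr_ge0.
  - by move=> m /andP[m0 ml]; rewrite t1 ler_pM2l// sm// m0 jE ltnS.
  have E4 (x r u v : R) : x * (r / u) * v = r * (x * u^-1 * v) by ring.
  rewrite E4 ler_pM2l// jE /ls -p2N -!p2D; apply: p2_le.
  rewrite -[l.+1%:R]natr1; have [n1 n2] := nn l.
  have : 0 <= C1 * l%:R ^+ 3 by rewrite mulr_ge0// exprn_ge0.
  lra.
have h : Cd * (1 + mn / ls w S t0 i1 l.+1) <=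
    p2 C1 * p2 (w i1 * (S l.+1 - S l) + C1 * l%:R ^+ 2 + 5).
  apply: (@le_trans _ _ (3 * Cd * p2 (w i1 * (S l.+1 - S l) + C1 * l%:R ^+ 2 + 5))); last first.
    by apply: ler_wpM2r => //; rewrite p2_ge0.
  have E3 (x z : R) : 3 * x * z = x * (3 * z) by ring.
    rewrite E3; apply: ler_wpM2l => //.
  have mn1 : mn / ls w S t0 i1 l.+1 <= 12 * srho l / (sc l * sN l i1) / ls w S t0 i1 l.+1.
    by rewrite ler_pM2r ?invr_gt0 ?p2_gt0// ge_min lexx orbT.
  have := le_trans mn1 (ell_over_s l).
  have -> : p2 (w i1 * (S l.+1 - S l) + C1 * l%:R ^+ 2 + 5) =
     p2 (w i1 * (S l.+1 - S l) + C1 * l%:R ^+ 2 + 2) * 8.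
    have e3 : p2 (3 : R) = 8 by rewrite p2_nat; ring.
    by rewrite -e3 -p2D; congr p2; ring.
  have : 1 <= p2 (w i1 * (S l.+1 - S l) + C1 * l%:R ^+ 2 + 2).
    apply: p2_ge1; have [n1 n2] := nn l; have [_ ST _ _ _] := level_facts H l.
    have : 0 <= w i1 * (S l.+1 - S l) by rewrite mulr_ge0//; have /andP[? ?] := wP i1; lra.
    lra.
  lra.
have /IH hI : (j <= l <= K)%N by rewrite lj ltnW.
apply: le_trans (ler_pM _ _ h hI) _ => //; first by rewrite mulr_ge0// addr_ge0.
rewrite mulrCA ler_pM2l// -!p2D; apply: p2_le; rewrite -[l.+1%:R]natr1; have [n1 n2] := nn l.
have C11 : 5 <= C1 by have [] := level_C1 H 0; lra.
lra.
Qed.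

(** A cube is too wide for [thin] in the directions other than [i1]; it is cut into flat boxes
    there. *)
Lemma hits_cover n (rho B : R) (a t : 'I_d -> R) (N : 'I_d -> nat) :
  N i1 = 1%N -> t i1 = 2 * rho ->
  (forall i, i != i1 -> 0 < t i /\ 2 * rho < (N i)%:R * t i) ->
  (forall a', (count (hits n (box a' t)) (tree n))%:R <= B) ->
  (count (hits n (box a (fun=> 2 * rho))) (tree n))%:R <= (\prod_i N i)%:R * B.
Proof.
move=> N1 t1 tN hB.
pose P := \max_i N i.
have NP i : (N i <= P.+1)%N by rewrite leqW// (leq_bigmax i).
pose A := [set l : {ffun 'I_d -> 'I_P.+1} | [forall i, (l i < N i)%N]].
have -> : (\prod_i N i)%:R * B = \sum_(l in A) B.
  by rewrite sumr_const mulr_natl (card_fun_box0 NP).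
apply: (@le_trans _ _ (\sum_(l in A) (count (hits n (box (gridpt a t l) t)) (tree n))%:R)); last first.
  by apply: ler_sum => l _; exact: hB.
rewrite -natr_sum ler_nat; apply: count_cover => nu /asboolP[x [xb xr]].
have xa i : 0 <= x i - a i <= 2 * rho by have /andP[? ?] := xb i; lra.
pose l0 i := if i == i1 then 0%N else Num.truncn ((x i - a i) / t i).
have l0N i : (l0 i < N i)%N.
  rewrite /l0; case: eqVneq => [->|ii]; first by rewrite N1.
  have [ti0 tiN] := tN i ii; have /andP[x0 x1] := xa i.
  rewrite -(ltr_nat R); apply: le_lt_trans (_ : (x i - a i) / t i < _).
    by rewrite truncn_le divr_ge0// ltW.
  by rewrite ltr_pdivrMr//; lra.
have lE i : (inord (l0 i) : 'I_P.+1) = l0 i :> nat by rewrite inordK// (leq_trans (l0N i)).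
exists [ffun i => inord (l0 i)].
  by rewrite inE; apply/forallP => i; rewrite ffunE lE.
apply/asboolP; exists x; split=> // i; rewrite /gridpt ffunE lE /l0.
have /andP[x0 x1] := xa i.
case: eqVneq => [iE|ii]; first by move: x0 x1; rewrite iE t1 mul0r; lra.
have [ti0 _] := tN i ii.
have /truncn_itv/andP[] : 0 <= (x i - a i) / t i by rewrite divr_ge0// ltW.
rewrite -[(Num.truncn _).+1%:R]natr1 ler_pdivlMr// ltr_pdivrMr//; lra.
Qed.

Lemma hits_cube K j a lam : (0 < j <= K)%N -> lam <= S K -> ls w S t0 i1 j <= p2 (- lam) ->
  (forall m, (0 < m < j)%N -> p2 (- lam) <= ls w S t0 i1 m) ->
  (count (hits K (box a (fun=> 2 * p2 (- lam)))) (tree K))%:R <=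
   p2 ((D - 1) * (11 + t0 + D - lam) + (D - w i1) * S K.+1 - lam +
       (S j + w i1 * S K + 3 + t0 + 2 * C1 * K%:R ^+ 3)).
Proof.
move=> /andP[j0 jK] lamS sj sm; set rho := p2 (- lam).
have [[_ wP ws _ t00] _] := H; have D2 := level_D H.
have rho0 : 0 < rho := p2_gt0 _.
pose t i := if i == i1 then 2 * rho else tside K i.
have t1 : t i1 = 2 * rho by rewrite /t eqxx.
have tE i : i != i1 -> t i = tside K i by rewrite /t => /negPf ->.
have tt l : (l <= K)%N -> thin l t.
  by move=> lK; apply: (thin_side lK) => //; rewrite t1 mulr_ge0// ltW.
pose N i := if i == i1 then 1%N else (Num.truncn (2 * rho / t i)).+1.
have tN i : i != i1 -> 0 < t i /\ 2 * rho < (N i)%:R * t i.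
  move=> ii; have ti : 0 < t i by rewrite tE// p2_gt0.
  by split=> //; rewrite -ltr_pdivrMr// /N (negPf ii) truncnS_gt.
have N1 : N i1 = 1%N by rewrite /N eqxx.
have hB a' := hits_large a' tt t1 j0 sj sm (l := K) (introT andP (conj jK (leqnn K))).
apply: le_trans (hits_cover a N1 t1 tN hB) _.
have -> : (D - 1) * (11 + t0 + D - lam) + (D - w i1) * S K.+1 - lam +
   (S j + w i1 * S K + 3 + t0 + 2 * C1 * K%:R ^+ 3) =
   \sum_(i | i != i1) (11 + t0 + D - lam + (1 + w i) * S K.+1) +
   (- lam + (S j + w i1 * S K + 3 + t0 + 2 * C1 * K%:R ^+ 3)).
  have cs c : \sum_(i < d) (c + (1 + w i) * S K.+1) = D * c + (D + 1) * S K.+1.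
    by rewrite big_split/= -mulr_suml big_split/= ws !sumr_const card_ord mulr_natl.
  by rewrite big_ne_split cs; ring.
rewrite [leRHS]p2D [p2 (- lam + _)]p2D -/rho; apply: ler_wpM2r; first by rewrite mulr_ge0 ?p2_ge0.
rewrite p2_sum natr_prod (bigD1 i1)//= N1 mul1r; apply: ler_prod => i ii.
rewrite ler0n /N (negPf ii) -[(Num.truncn _).+1%:R]natr1 /=.
have SK : S K <= S K.+1 by apply: (S_mono).
have /andP[we0 wi] := wP i.
have S0 : 0 <= S K.+1 by have [] := level_facts H K.+1.
have w0 : 0 <= w i * S K.+1 by rewrite mulr_ge0//; lra.
have E : 2 * rho / t i = p2 (1 - lam + ((1 + w i) * S K.+1 + 9 + t0 + D)).
  by rewrite tE// /tside /rho -[2 * _]/(2 * p2 (- lam)) -[X in X * p2 (- lam)]p2_1 -p2D -p2B;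
    congr p2; ring.
have h1 : 1 <= 2 * rho / t i by rewrite E; apply: p2_ge1; lra.
have h2 : (Num.truncn (2 * rho / t i))%:R <= 2 * rho / t i by rewrite truncn_le; lra.
apply: (@le_trans _ _ (2 * (2 * rho / t i))); first lra.
by rewrite E -[X in X * p2 _]p2_1 -p2D; apply: p2_le; lra.
Qed.

(** The nodes of a level have equally many children, so the proportion of slabs hit cannot grow with
    the depth. *)
Lemma hits_fraction n Q m :
  (count (hits (n + m) Q) (tree (n + m)))%:R * (size (tree n))%:R <=
  (count (hits n Q) (tree n))%:R * (size (tree (n + m)))%:R :> R.
Proof.
elim: m => [|m IH]; first by rewrite addn0.
rewrite addnS (tree_size) natrM.
have := hits_ratio (n + m) Q.
set F := (_ * _)%:R; set c := (count _ _)%:R; set c' := (count _ (tree (n + m)))%:R => h.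
have := ler_wpM2r (ler0n R (size (tree n))) h.
have := ler_wpM2l (ler0n R _ : 0 <= F) IH; rewrite -/c'; lra.
Qed.

(** Exponent of the bound of [hits_cube] over the size of level [K]. Its leading part is
    [- D * lam + S j]; the rest consists of gaps of [S] and errors. *)
Definition frac_exp lam K j := (D - 1) * (11 + t0 + D - lam) + (D - w i1) * S K.+1 - lam +
       (S j + w i1 * S K + 3 + t0 + 2 * C1 * K%:R ^+ 3)
  - (D * S K - (D - 1) * (w e * lT S K) - 3 * C1 * K%:R ^+ 3).

Lemma cube_fraction K j a lam m : (0 < j <= K)%N -> lam <= S K -> ls w S t0 i1 j <= p2 (- lam) ->
  (forall m, (0 < m < j)%N -> p2 (- lam) <= ls w S t0 i1 m) ->
  (count (hits (K + m) (box a (fun=> 2 * p2 (- lam)))) (tree (K + m)))%:R <=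
   p2 (frac_exp lam K j) * (size (tree (K + m)))%:R.
Proof.
move=> jK lamS sj sm; have hc := hits_cube a jK lamS sj sm.
have hs := tree_size_ge K.
have s0 : 0 < (size (tree K))%:R :> R by apply: lt_le_trans hs; exact: p2_gt0.
have := hits_fraction K (box a (fun=> 2 * p2 (- lam))) m.
rewrite -ler_pdivlMr// => /le_trans; apply.
rewrite ler_pdivrMr// mulrAC; apply: ler_wpM2r => //.
apply: (le_trans hc); apply: le_trans (ler_wpM2l (p2_ge0 _) hs).
by rewrite -p2D; apply: p2_le; rewrite /frac_exp; lra.
Qed.

End Counting.

(** * Choice of the level heights *)

Section QuarticLevels.
Context {R : realType} {d : nat} (w : 'I_d -> R) (t : R) (e i1 : 'I_d).
Local Notation D := (d%:R : R).

(* The quartic growth of [Spar] dominates the error terms in [level_hyp], while the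
   ratio of consecutive values still tends to 1. *)
Definition C1par : R := 100 + 20 * D + t.
Definition Mpar : R := (100 + 20 * D + 2 * C1par + 4 * t) / w e.
Definition Spar (n : nat) : R := Mpar * n%:R ^+ 4.

Context (i1e : i1 != e) (wP : forall i, 0 < w e <= w i) (ws : \sum_i w i = 1) (t0 : 0 <= t).

Lemma Spar_level : level_hyp w Spar C1par t e i1.
Proof.
split; first by split=> //; rewrite /Spar expr0n/= mulr0.
have ME : w e * Mpar = 100 + 20 * D + 2 * C1par + 4 * t.
  by rewrite mulrC divfK// gt_eqF//; case/andP: (wP e).
split=> // n; rewrite /Spar -mulrBr [leRHS]mulrA ME.
have D0 : 0 <= D by []; have n0 : 0 <= n%:R :> R by [].
have t00 : 0 <= t by exact: t0.
have C10 : 0 <= C1par by rewrite /C1par; lra.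
have n2 : 0 <= n%:R ^+ 2 :> R by exact: exprn_ge0.
have n3 : 0 <= n%:R ^+ 3 :> R by exact: exprn_ge0.
set X := 100 + _ + _ + _; have X0 : 0 <= X by rewrite /X; lra.
apply: (@le_trans _ _ (X * n.+1%:R ^+ 2)); last first.
  by apply: ler_wpM2l => //; rewrite -[n.+1%:R]natr1; lra.
have h1 : n.+1%:R <= n.+1%:R ^+ 2 :> R by rewrite ler_eXnr// ler1n.
have h2 : 1 <= n.+1%:R ^+ 2 :> R by rewrite exprn_ege1// ler1n.
have h3 : D * n.+1%:R <= D * n.+1%:R ^+ 2 by rewrite ler_wpM2l.
have h4 : D <= D * n.+1%:R ^+ 2 by rewrite ler_peMr.
have h5 : t <= t * n.+1%:R ^+ 2 by rewrite ler_peMr.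
rewrite /X; move: (n.+1%:R ^+ 2) h1 h2 h3 h4 h5 => q; move: (n.+1%:R) => p; lra.
Qed.

Let M0 : 0 < Mpar.
Proof.
rewrite /Mpar divr_gt0//; last by case/andP: (wP e).
have t00 : 0 <= t by exact: t0.
by rewrite /C1par; have : 0 <= D by []; lra.
Qed.

Let S_ge n : Mpar * n%:R <= Spar n.
Proof.
rewrite /Spar ler_pM2l//; case: n => [|n]; first by rewrite expr0n.
by rewrite ler_eXnr// ler1n.
Qed.

Let Sgap P n : (n <= P.+1)%N -> Spar n.+1 - Spar n <= 65 * Mpar * (P%:R ^+ 3 + 1).
Proof.
move=> nP; have np : n%:R <= P%:R + 1 :> R by rewrite natr1 ler_nat.
have n0 : 0 <= n%:R :> R by []; have P0 : 0 <= P%:R :> R by [].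
apply: (@le_trans _ _ (Mpar * ((P%:R + 2) ^+ 4 - (P%:R + 1) ^+ 4))).
  rewrite /Spar -mulrBr ler_pM2l// -[n.+1%:R]natr1.
  have -> : (n%:R + 1) ^+ 4 - n%:R ^+ 4 = 4 * n%:R ^+ 3 + 6 * n%:R ^+ 2 + 4 * n%:R + 1 :> R by ring.
  have -> : (P%:R + 2) ^+ 4 - (P%:R + 1) ^+ 4 =
    4 * (P%:R + 1) ^+ 3 + 6 * (P%:R + 1) ^+ 2 + 4 * (P%:R + 1) + 1 :> R by ring.
  have := lerXn2r 2 n0 (addr_ge0 P0 ler01) np.
  have := lerXn2r 3 n0 (addr_ge0 P0 ler01) np.
  lra.
have -> : 65 * Mpar * (P%:R ^+ 3 + 1) = Mpar * (65 * (P%:R ^+ 3 + 1)) by ring.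
rewrite ler_pM2l//.
have h : P%:R ^+ 2 <= P%:R ^+ 3 :> R.
  by case: (P) => [|p]; [rewrite !expr0n | rewrite ler_weXn2l// ler1n].
have h' : P%:R <= P%:R ^+ 3 :> R.
  by case: (P) => [|p]; [rewrite !expr0n | rewrite ler_eXnr// ler1n].
lra.
Qed.

(** [K] is the first level with [S K] at least [lam], and [j] the first with spacing at most
    [2^(- lam)], so [S j] is about [lam / (1 + w i1)]. The exponent is thus about
    [- (D - 1 / (1 + w i1)) * lam], with errors of order [P^3] for [K = P.+1]. As [lam] exceeds
    [Mpar * P^4], the slack [del * lam] absorbs them. *)
Lemma frac_exp_bound (s : R) : s < D - 1 / (1 + w i1) -> exists C0, forall lam, 0 < lam ->
  exists K, exists j, [/\ (0 < j <= K)%N, lam <= Spar K, ls w Spar t i1 j <= p2 (- lam),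
    forall m, (0 < m < j)%N -> p2 (- lam) <= ls w Spar t i1 m &
    frac_exp w Spar C1par t e i1 lam K j <= C0 - s * lam].
Proof.
move=> sD; set del := D - 1 / (1 + w i1) - s; have del0 : 0 < del by rewrite /del; lra.
have t00 : 0 <= t by exact: t0.
have D2 : 2 <= D := level_D Spar_level; have C10 : 0 < C1par by rewrite /C1par; lra.
have /andP[we0 we1] := wP i1; have M0' := M0.
have we12 : w e + w i1 <= 1 := level_w1 Spar_level.
pose G := (D - w i1) * (65 * Mpar) + 65 * Mpar + 40 * C1par + (D - 1) * (w e * (65 * Mpar)).
have M65 : 0 <= 65 * Mpar by exact: mulr_ge0 (ltW M0').
have G0 : 0 <= G.
  rewrite /G; have a1 : 0 <= (D - w i1) * (65 * Mpar) by apply: mulr_ge0 => //; lra.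
  have a2 : 0 <= (D - 1) * (w e * (65 * Mpar)).
    by apply: mulr_ge0; [lra | apply: mulr_ge0 => //; exact: ltW].
  lra.
(* Beyond this value of [P] the slack dominates [G * P^3]; smaller [P] are absorbed by the constant
   [C0]. *)
pose x := G / (del * Mpar).
have x0 : 0 <= x by rewrite divr_ge0//; apply: mulr_ge0; exact: ltW.
exists ((D - 1) * (11 + t + D) + 3 + t + G + G * x ^+ 3) => lam lam0.
have exK : exists n, lam <= Spar n.
  exists (Num.truncn (lam / Mpar)).+1; apply: le_trans (S_ge _).
  by rewrite mulrC -ler_pdivrMr// ltW// truncnS_gt.
case: (ex_minnP exK) => K lK Kmin.
have K0 : (0 < K)%N.
  by rewrite lt0n; apply/eqP => K0; move: lK; rewrite K0 /Spar expr0n/= mulr0; lra.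
have lsE m : (ls w Spar t i1 m <= p2 (- lam)) = (lam <= (1 + w i1) * Spar m + 3 + t).
  apply/idP/idP => h; last by apply: p2_le; lra.
  rewrite leNgt; apply/negP => h'; move: h; rewrite leNgt => /negP; apply.
  by rewrite /ls; apply: p2_lt; lra.
have exj : exists n, (0 < n)%N && (lam <= (1 + w i1) * Spar n + 3 + t).
  exists K; rewrite K0/=; have S0 : 0 <= Spar K by apply: mulr_ge0; [exact: ltW | exact: exprn_ge0].
  have : 0 <= w i1 * Spar K by rewrite mulr_ge0//; lra.
  lra.
case: (ex_minnP exj) => j /andP[j0 lj] jmin.
have jK : (j <= K)%N.
  apply: jmin; rewrite K0/=; have S0 : 0 <= Spar K by apply: mulr_ge0; [exact: ltW | exact: exprn_ge0].
  have : 0 <= w i1 * Spar K by rewrite mulr_ge0//; lra.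
  lra.
exists K, j; split=> //; first by rewrite j0.
- by rewrite lsE.
- move=> m /andP[m0 mj]; rewrite leNgt; apply/negP => h.
  by move: (ltW h); rewrite lsE => h'; have := jmin m; rewrite m0 h' leqNgt mj => /(_ isT).
case: K K0 lK Kmin jK {exj} => // P _ lK Kmin jK.
have SP : Spar P < lam by rewrite ltNge; apply/negP => /Kmin; rewrite ltnn.
case: j j0 lj jmin jK => // Q _ lj jmin QP.
have SQ : Spar Q <= lam / (1 + w i1).
  rewrite ler_pdivlMr; last by lra.
  have [Q0|Q0] := posnP Q; first by rewrite Q0 /Spar expr0n/= mulr0 mul0r ltW.
  rewrite leNgt; apply/negP => h; have := jmin Q; rewrite Q0 ltnn/= => /(_ _)/notF; apply.
  lra.
have g1 := Sgap (leqnn P.+1); have g2 := Sgap (leqW (leqnn P)).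
have g3 : Spar Q.+1 - Spar Q <= 65 * Mpar * (P%:R ^+ 3 + 1) by apply: Sgap; rewrite ltnW.
set u := P%:R ^+ 3 + 1 in g1 g2 g3.
have P0 : 0 <= P%:R :> R by [].
have K3 : P.+1%:R ^+ 3 <= 8 * u.
  rewrite -[P.+1%:R]natr1 /u.
  have h : P%:R ^+ 2 <= P%:R ^+ 3 :> R.
    by case: (P) => [|p]; [rewrite !expr0n | rewrite ler_weXn2l// ler1n].
  have h' : P%:R <= P%:R ^+ 3 :> R.
    by case: (P) => [|p]; [rewrite !expr0n | rewrite ler_eXnr// ler1n].
  lra.
have Gu : G * u <= G + G * x ^+ 3 + del * lam.
  rewrite /u mulrDr mulr1.
  suff : G * P%:R ^+ 3 <= G * x ^+ 3 + del * lam by lra.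
  have [Px|xP] := lerP P%:R x.
    have := ler_wpM2l G0 (lerXn2r 3 P0 x0 Px).
    have := mulr_gt0 del0 lam0; lra.
  have h1 : G <= del * Mpar * P%:R.
    by rewrite mulrC -ler_pdivrMr; [exact: ltW | exact: mulr_gt0].
  have h2 := ler_wpM2r (exprn_ge0 3 P0) h1.
  have h3 : del * Mpar * P%:R * P%:R ^+ 3 <= del * lam.
    have -> : del * Mpar * P%:R * P%:R ^+ 3 = del * Spar P by rewrite /Spar; ring.
    by rewrite ler_pM2l//; exact: ltW.
  have := mulr_ge0 G0 (exprn_ge0 3 x0); lra.
have a1 : (D - w i1) * (Spar P.+2 - Spar P.+1) <= (D - w i1) * (65 * Mpar) * u.
  by rewrite -[leRHS]mulrA ler_wpM2l//; lra.
have a2 : (D - 1) * (w e * (Spar P.+1 - Spar P)) <= (D - 1) * (w e * (65 * Mpar)) * u.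
  by rewrite -[leRHS]mulrA -[w e * _ * u]mulrA ler_wpM2l ?ler_wpM2l//; lra.
have a3 : 5 * C1par * P.+1%:R ^+ 3 <= 40 * C1par * u.
  have := ler_wpM2l (ltW C10) K3; lra.
have -> : s * lam = D * lam - lam / (1 + w i1) - del * lam by rewrite /del; ring.
move: Gu; rewrite /G /frac_exp /lT /= => Gu.
move: (lam / (1 + w i1)) SQ => q SQ; move: (P.+1%:R ^+ 3) a3 K3 => k3 a3 K3.
clear - a1 a2 a3 g3 SQ Gu M0'.
lra.
Qed.

End QuarticLevels.

(** * The Frostman estimate for covers of one level *)

Section FrostmanTree.
Context {R : realType} {d : nat} (w : 'I_d -> R) (t : R) (e i1 : 'I_d).
Local Notation D := (d%:R : R).
Local Notation S := (Spar w t e).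
Local Notation C1 := (@C1par R d t).
Context (i1e : i1 != e) (wP : forall i, 0 < w e <= w i) (ws : \sum_i w i = 1) (t0 : 0 <= t).

(** All cubes are compared at one depth beyond every [Kj j]: there a cube of radius [r] meets at
    most the proportion [C * r^s] of the slabs, and together they meet all of them. [C] is fixed
    before the forms, which gives uniformity over the slices. *)
Lemma frostman_tree (s : R) : s < D - 1 / (1 + w i1) -> exists2 C : R, 0 < C &
  forall (V : zmodType) (y : 'I_d -> {additive V -> R}) (k : {additive V -> R}) nu0,
  (forall ys : 'I_d -> R, exists v, forall i, `|y i v - ys i| <= 2) ->
  (exists2 o, forall i, y i o = 0 & k o = 1) ->
  node_ok y k w S C1 t e i1 0 nu0 ->
  exists tr : nat -> seq (V * ('I_d -> R)),
  [/\ tr 0 = [:: nu0],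
    forall n nu, nu \in tr n -> node_ok y k w S C1 t e i1 n nu,
    forall n nu', nu' \in tr n.+1 -> exists2 nu, nu \in tr n &
      forall x, node_region y k w S t e n.+1 nu' x -> node_region y k w S t e n nu x &
    forall n m (P : pred 'I_m) (p : 'I_m -> 'I_d -> R) (r : 'I_m -> R),
      (forall j, P j -> 0 < r j < 1) ->
      (forall nu x, nu \in tr n -> node_region y k w S t e n nu x ->
         exists2 j, P j & forall i, `|x i - p j i| <= r j) ->
      1 <= \sum_(j | P j) C * r j `^ s].
Proof.
move=> sD; have H := Spar_level i1e wP ws t0.
have [C0 C0P] := frac_exp_bound i1e wP ws t0 sD.
exists (p2 C0) => [|V y k nu0 rnd orth ok0]; first exact: p2_gt0.
have /choice[ch chP] (nn : nat * (V * ('I_d -> R))) : exists cs : seq (V * ('I_d -> R)),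
  node_ok y k w S C1 t e i1 nn.1 nn.2 ->
  [/\ size cs = (lF w S C1 t e nn.1.+1 * lJ w S e nn.1.+1)%N,
   forall nu', nu' \in cs -> node_ok y k w S C1 t e i1 nn.1.+1 nu',
   forall nu', nu' \in cs -> forall x, node_region y k w S t e nn.1.+1 nu' x ->
      node_region y k w S t e nn.1 nn.2 x &
   forall a u, thin w S t e i1 nn.1.+1 u ->
    (count (hit y k e (lb w S t e nn.1.+1) (lrho S t nn.1.+1) a u) cs)%:R <=
      (3 ^ d)%:R * (224 + 3 * p2 D) * (1 + u i1 / ls w S t i1 nn.1.+1)].
  have [ok|nok] := pselect (node_ok y k w S C1 t e i1 nn.1 nn.2); last by exists [::].
  by have [cs csP] := step_children H rnd orth ok; exists cs.
pose ch' n nu := ch (n, nu).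
have ch'P n nu (ok : node_ok y k w S C1 t e i1 n nu) := chP (n, nu) ok.
exists (tree ch' nu0); split=> //.
- by move=> n nu; exact: (tree_ok ok0 ch'P).
- by move=> n nu'; exact: (tree_region ok0 ch'P).
move=> n m P p r r01 cov.
have Tnest q nu' : nu' \in tree ch' nu0 (n + q) -> exists2 nu, nu \in tree ch' nu0 n &
    forall x, node_region y k w S t e (n + q) nu' x -> node_region y k w S t e n nu x.
  elim: q nu' => [|q IH] nu'; first by rewrite addn0 => h; exists nu'.
  rewrite addnS => /(tree_region ok0 ch'P)[nu1 nu1T h1].
  by have [nu nuT h] := IH nu1 nu1T; exists nu => // x /h1/h.
pose lam j := - (ln (r j) / ln 2).
have l2 : 0 < ln 2 :> R by rewrite ln_gt0// ltr1n.
have lam0 j : P j -> 0 < lam j.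
  by move=> /r01/andP[r0 r1]; rewrite oppr_gt0 pmulr_llt0 ?invr_gt0// ln_lt0// r0.
have rE j : P j -> r j = p2 (- lam j).
  move=> /r01/andP[r0 r1]; rewrite /p2 /lam opprK divfK ?lnK//; last by rewrite gt_eqF.
have rsE j : P j -> r j `^ s = p2 (- (s * lam j)).
  move=> /r01/andP[r0 r1]; rewrite /powR gt_eqF// /p2 /lam; congr expR.
  by field; rewrite gt_eqF.
have /choice[Kj KjP] j : exists K, P j -> forall a q,
    (count (hits y k w S t e (K + q) (box a (fun=> 2 * r j))) (tree ch' nu0 (K + q)))%:R <=
      p2 C0 * r j `^ s * (size (tree ch' nu0 (K + q)))%:R.
  have [Pj|nPj] := boolP (P j); last by exists 0%N.
  have [K [j' [jK lK sj sm fe]]] := C0P _ (lam0 j Pj).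
  exists K => _ a q; rewrite {1}rE// rsE//.
  apply: le_trans (cube_fraction H ok0 ch'P a q jK lK sj sm) _; apply: ler_wpM2r => //.
  by rewrite -p2D; apply: p2_le.
pose N := (n + \sum_j Kj j)%N.
have KN j : exists q, N = (Kj j + q)%N.
  by exists (N - Kj j)%N; rewrite subnKC// /N (bigD1 j)//= addnCA leq_addr.
have sz : 0 < (size (tree ch' nu0 N))%:R :> R.
  by apply: lt_le_trans (tree_size_ge H ok0 ch'P N); exact: p2_gt0.
rewrite -(ler_pM2r sz) mul1r mulr_suml.
pose A := [set j | P j].
pose Q j := box (fun i => p j i - r j) (fun=> 2 * r j).
apply: (@le_trans _ _ (\sum_(j in A) (count (hits y k w S t e N (Q j)) (tree ch' nu0 N))%:R)).
  rewrite -natr_sum ler_nat.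
  have <- : count (mem (tree ch' nu0 N)) (tree ch' nu0 N) = size (tree ch' nu0 N).
    by apply/eqP; rewrite -all_count; apply/allP.
  apply: count_cover => nu nuT.
  have [[qA _ _ _]] := tree_ok ok0 ch'P nuT.
  have q0 : 0 < y e nu.1 by case/andP: qA => h _; apply: lt_le_trans h; exact: p2_gt0.
  (* The point of the hyperplane over the corner of the box: no region is empty, so every slab is
     hit. *)
  pose x i := if i == e then (k nu.1 - \sum_(i | i != e) y i nu.1 * nu.2 i) / y e nu.1 else nu.2 i.
  have xr : node_region y k w S t e N nu x.
    split=> [i /negPf ie|]; first by rewrite /x ie lexx lerDl p2_ge0.
    have -> : phi y k nu.1 x = 0.
      have E : \sum_(i | i != e) y i nu.1 * x i = \sum_(i | i != e) y i nu.1 * nu.2 i.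
        by apply: eq_bigr => i /negPf ie; rewrite /x ie.
      by rewrite /phi (bigD1 e)//= E {1}/x eqxx mulrC divfK ?gt_eqF//; ring.
    by rewrite normr0 p2_ge0.
  have [nu1 nu1T h1] := Tnest _ _ nuT.
  have [j Pj jP] := cov nu1 x nu1T (h1 _ xr); exists j; first by rewrite inE.
  apply/asboolP; exists x; split=> // i; have := jP i; rewrite ler_norml; lra.
rewrite (eq_bigl P) => [|j]; last by rewrite inE.
apply: ler_sum => j Pj; have [q qE] := KN j; rewrite qE; exact: KjP.
Qed.

End FrostmanTree.

(** * Forms attached to a matrix *)

Section MatrixForms.
Context {R : realType} {d : nat}.
Local Notation V := ('rV[int]_d * int)%type.

Definition rowform (B : 'M[R]_d) (i : 'I_d) (v : V) : R := \sum_j (v.1 0 j)%:~R * B j i.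
Definition lastform (v : V) : R := v.2%:~R.

Lemma rowform_zmod B i : zmod_morphism (rowform B i).
Proof.
move=> u v; rewrite /rowform -sumrB; apply: eq_bigr => j _.
by rewrite !mxE intrB mulrBl.
Qed.
HB.instance Definition _ B i := GRing.isZmodMorphism.Build V R (rowform B i) (rowform_zmod B i).

Lemma lastform_zmod : zmod_morphism lastform.
Proof. by move=> u v; rewrite /lastform /= intrB. Qed.
HB.instance Definition _ := GRing.isZmodMorphism.Build V R lastform lastform_zmod.

(** At this radius [v B] differs from [v] by at most an eighth of the largest entry of [v]. *)
Definition near1 (B : 'M[R]_d) := forall i j, `|B i j - (i == j)%:R| <= 1 / (8 * d%:R).

Context (B : 'M[R]_d) (B1 : near1 B) (d2 : (2 <= d)%N).

Lemma rowform_near (u : 'I_d -> R) (M : R) i : (forall j, `|u j| <= M) ->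
  `|\sum_j u j * B j i - u i| <= M / 8.
Proof.
move=> uM; have d0 : 0 < d%:R :> R by rewrite ltr0n (leq_trans _ d2).
have -> : \sum_j u j * B j i - u i = \sum_j u j * (B j i - (j == i)%:R).
  under [RHS]eq_bigr do rewrite mulrBr.
  rewrite sumrB; congr (_ - _); rewrite (bigD1 i)//= eqxx mulr1 big1 ?addr0// => j /negPf ->.
  by rewrite mulr0.
apply: le_trans (ler_norm_sum _ _ _) _.
apply: (@le_trans _ _ (\sum_(j < d) M * (1 / (8 * d%:R)))).
  by apply: ler_sum => j _; rewrite normrM ler_pM.
rewrite sumr_const card_ord -(mulr_natr (M * _)) le_eqVlt; apply/orP; left; apply/eqP.
by field; rewrite gt_eqF.
Qed.

Lemma rowform_round (ys : 'I_d -> R) : B \in unitmx ->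
  exists v : V, forall i, `|rowform B i v - ys i| <= 2.
Proof.
move=> uB; pose u : 'rV[R]_d := (\row_j ys j) *m invmx B.
have uE i : \sum_j u 0 j * B j i = ys i.
  have := congr1 (fun M : 'rV_d => M 0 i) (mulmxKV uB (\row_j ys j)).
  by rewrite mxE [RHS]mxE.
exists (\row_j Num.floor (u 0 j), 0) => i; rewrite -uE /rowform -sumrB.
rewrite (eq_bigr (fun j => ((Num.floor (u 0 j))%:~R - u 0 j) * B j i)) => [|j _]; last first.
  by rewrite !mxE -mulrBl.
have h j : `|(Num.floor (u 0 j))%:~R - u 0 j| <= 1.
  have := floor_le (u 0 j); have := lt_succ_floor (u 0 j).
  by rewrite intrD ler_norml -[1%:~R]/(1 : R) => *; lra.
have := rowform_near i h; have := h i; rewrite !ler_norml; lra.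
Qed.

Lemma rowform_orth : exists2 o : V, forall i, rowform B i o = 0 & lastform o = 1.
Proof.
exists (0, 1) => // i; rewrite /rowform big1// => j _.
by rewrite mxE mulr0z mul0r.
Qed.

Context (w : 'I_d -> R) (t : R) (e i1 : 'I_d).
Context (i1e : i1 != e) (wP : forall i, 0 < w e <= w i) (ws : \sum_i w i = 1) (t0 : 0 <= t).

(** Both [y e] and [y i1] have to be close to 1 at the root: the former lies between [lA] and [lAh],
    the latter is bounded below. *)
Definition rootvec : V := (\row_j ((j == i1)%:Z + (j == e)%:Z), 0).

Lemma root_coord i : `|rowform B i rootvec - ((i == i1)%:R + (i == e)%:R)| <= 1 / 8.
Proof.
have E j : (rootvec.1 0 j)%:~R = (j == i1)%:R + (j == e)%:R :> R.
  by rewrite mxE intrD; congr (_ + _); case: eqP.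
rewrite -E; apply: rowform_near => j; rewrite E.
have [->|_] := eqVneq j i1; first by rewrite (negPf i1e) addr0 normr1.
by rewrite add0r; case: eqP; rewrite ?normr1 ?normr0.
Qed.

(** Nondegeneracy at the root is integrality. Subtract the multiple of the root that kills the
    integer entry [e] of [v]: a remaining nonzero entry would make some [gam] at least 7/8 - 9/56,
    more than 1/4, and otherwise only an integer of absolute value below 1 is left. *)
Lemma root_ok : node_ok (rowform B) lastform w (Spar w t e) (C1par t (d := d)) t e i1 0
   (rootvec, fun=> 0).
Proof.
have S0 : Spar w t e 0 = 0 by rewrite /Spar expr0n mulr0.
have N0 i : lN w (Spar w t e) 0 i = 1 by rewrite /lN S0 mulr0 subrr p2_0.
have c0 : lc (C1par t (d := d)) 0 = 1 by rewrite /lc expr0n/= mulr0 p2_0.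
have r_e := root_coord e; rewrite eqxx eq_sym (negPf i1e) add0r -[true%:R]/(1 : R) in r_e.
have r_1 := root_coord i1; rewrite eqxx (negPf i1e) addr0 -[true%:R]/(1 : R) in r_1.
have r_i i : `|rowform B i rootvec| <= 9 / 8.
  have : `|(i == i1)%:R + (i == e)%:R| <= 1 :> R.
    have [->|_] := eqVneq i i1; first by rewrite (negPf i1e) addr0 normr1.
    by rewrite add0r; case: eqP; rewrite ?normr1 ?normr0.
  move=> h1; have h2 := root_coord i.
  rewrite -[rowform B i rootvec](subrK ((i == i1)%:R + (i == e)%:R)).
  apply: le_trans (ler_normD _ _) _; lra.
have U4 i : lU w (Spar w t e) (C1par t (d := d)) i1 0 i <= 1 / 4.
  by rewrite /lU; case: ifP => _; rewrite ?c0 ?N0; lra.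
have Psi1 : @lPsi R d (Spar w t e) t 0 < 1.
  rewrite -p2_0 /lPsi S0; apply: p2_lt; have D0 : 0 <= d%:R :> R by [].
  have t00 : 0 <= t by [].
  lra.
rewrite /node_ok c0 N0; split => /=.
- have -> : lA w (Spar w t e) e 0 = 1 / 2.
    by rewrite /lA S0 !mulr0 subr0 sub0r p2N p2_1 div1r.
  have -> : lAh w (Spar w t e) e 0 = 2 by rewrite /lAh S0 !mulr0 subr0 add0r p2_1.
  by move: r_e; rewrite ler_norml => *; apply/andP; split; lra.
- by move=> i ie; rewrite N0; have := r_i i; lra.
- by move: r_1; rewrite ler_norml => *; lra.
move=> x _ v vU vth.
pose p := v.1 0 e; pose u := v - rootvec *~ p.
have q0 : rowform B e rootvec != 0.
  by rewrite gt_eqF//; move: r_e; rewrite ler_norml => *; lra.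
have u1 j : u.1 0 j = v.1 0 j - p * ((j == i1)%:Z + (j == e)%:Z).
  have -> : u.1 = v.1 - (rootvec.1) *~ p.
    rewrite /u /=; congr (_ - _).
    have := raddfMz (fst : {additive _ -> _}) p rootvec; exact.
  by rewrite -scaler_int !mxE intz.
have ue : u.1 0 e = 0 by rewrite u1 eqxx eq_sym (negPf i1e) add0r mulr1 subrr.
have gu i : gam (rowform B) e rootvec u i = gam (rowform B) e rootvec v i.
  by rewrite gamB gamMz// subr0.
have tu : th (rowform B) lastform e rootvec u x = th (rowform B) lastform e rootvec v x.
  by rewrite thB thMz// subr0.
suff u0 : u = 0 by exists p; apply/eqP; rewrite -subr_eq0 -/u u0.
have [i _ imax] := arg_maxnP (fun j => absz (u.1 0 j)) (isT : xpredT e).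
set M := absz (u.1 0 i) in imax.
have uM j : `|(u.1 0 j)%:~R| <= M%:R :> R.
  by rewrite -intr_norm -[M%:R]/((M%:Z)%:~R) ler_int -abszE lez_nat; exact: imax.
have rn j := rowform_near j uM.
have row0 : u.1 = 0.
  have [M0|M0] := posnP M.
    apply/rowP => j; rewrite [RHS]mxE; apply/eqP; rewrite -absz_eq0 -leqn0.
    by rewrite (leq_trans (imax j isT))// M0.
  have M1 : 1 <= M%:R :> R by rewrite ler1n.
  have ie : i != e by apply/eqP => ie; move: M0; rewrite /M ie ue.
  have := vU i ie; rewrite -gu => /le_trans/(_ (U4 i)).
  have hi : `|rowform B i u| >= 7 / 8 * M%:R.
    have := rn i; have := ler_normB (rowform B i u) (rowform B i u - (u.1 0 i)%:~R).
    rewrite opprB addrC subrK -intr_norm.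
    have -> : `|u.1 0 i|%:~R = M%:R :> R by rewrite -abszE.
    by rewrite /rowform; lra.
  have he : `|rowform B e u| <= M%:R / 8.
    by have := rn e; rewrite ue subr0.
  have q78 : 7 / 8 <= `|rowform B e rootvec|.
    by move: r_e; rewrite !ler_norml => *; rewrite ger0_norm; lra.
  have hc : `|rowform B e u / rowform B e rootvec * rowform B i rootvec| <= 9 / 56 * M%:R.
    rewrite !normrM normfV.
    apply: (@le_trans _ _ (M%:R / 8 * (7 / 8)^-1 * (9 / 8))); last by lra.
    apply: ler_pM; rewrite ?mulr_ge0 ?invr_ge0//.
    apply: ler_pM; rewrite ?invr_ge0//.
    by rewrite lef_pV2 ?posrE//; lra.
  have := ler_normB (gam (rowform B) e rootvec u i)
    (- (rowform B e u / rowform B e rootvec * rowform B i rootvec)).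
  rewrite opprK normrN {1}/gam subrK => h1 h2; exfalso.
  move: h1 h2 hc hi M1; move: `|_| `|_| `|_| => a b c *; clear S0; lra.
have uE : u = (0, u.2) by rewrite -row0; case: (u).
have y0 i0 : rowform B i0 u = 0.
  by rewrite /rowform big1// => j _; rewrite row0 mxE mulr0z mul0r.
have thE : th (rowform B) lastform e rootvec u x = - (u.2)%:~R.
  rewrite /th /phi /= y0 !mul0r subr0 big1 ?sub0r// => j _.
  by rewrite y0 mul0r.
rewrite uE; congr pair; apply/eqP; rewrite -normr_le0 leNgt gtz0_ge1 -ltNge.
have := lt_trans vth Psi1; rewrite -tu thE normrN -intr_norm.
by rewrite ltrz1.
Qed.

End MatrixForms.

(** * Points of the Cantor set are singular *)

Section Slice.
Context {R : realType} {d : nat}.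
Local Notation V := ('rV[int]_d * int)%type.

Lemma region_closed (W : zmodType) (y : 'I_d -> {additive W -> R}) (k : {additive W -> R}) (e : 'I_d)
    (b : 'I_d -> R) (rho : R) (s : seq (W * ('I_d -> R))) (z : 'I_d -> R) :
  (forall del, 0 < del -> exists x, (forall i, `|x i - z i| < del) /\
     exists2 nu, nu \in s & region y k e b rho nu x) ->
  exists2 nu, nu \in s & region y k e b rho nu z.
Proof.
elim: s => [|nu s IH] h; first by have [x [_ [nu]]] := h 1 ltr01.
have [hnu|/existsNP[del0 /not_implyP[d0 hd]]] := pselect (forall del, 0 < del ->
    exists2 x, (forall i, `|x i - z i| < del) & region y k e b rho nu x).
  exists nu; first exact: mem_head.
  split=> [i ie|].
    apply/andP; split; apply/ler_addgt0Pr => eps eps0.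
      by have [x /(_ i) xz [/(_ i ie)/andP[h1 h2] _]] := hnu eps eps0;
        move: xz; rewrite ltr_norml; lra.
    by have [x /(_ i) xz [/(_ i ie)/andP[h1 h2] _]] := hnu eps eps0;
        move: xz; rewrite ltr_norml; lra.
  apply/ler_addgt0Pr => eps eps0.
  pose Y := 1 + \sum_i `|y i nu.1|.
  have Y0 : 0 < Y by rewrite /Y ltr_pwDl// sumr_ge0.
  have [|x xz [_ xr]] := hnu (eps / Y); first by rewrite divr_gt0.
  rewrite -[phi _ _ _ _](subrK (phi y k nu.1 x)) addrC; apply: le_trans (ler_normD _ _) _.
  apply: lerD => //; rewrite phi_sub; apply: le_trans (ler_norm_sum _ _ _) _.
  apply: (@le_trans _ _ (\sum_i `|y i nu.1| * (eps / Y))).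
    by apply: ler_sum => i _; rewrite normrM ler_wpM2l// distrC ltW.
  rewrite -mulr_suml mulrA ler_pdivrMr// mulrC ler_pM2l// /Y lerDr.
  by [].
have [|nu' nu's h'] := IH; last by exists nu' => //; rewrite inE nu's orbT.
move=> del d1; have [|x [xz [nu']]] := h (Num.min del del0); first by rewrite lt_min d1.
rewrite inE => /predU1P[->|nu's] hr.
  case: hd; exists x => // i; by have := xz i; rewrite lt_min => /andP[].
by exists x; split; [move=> i; have := xz i; rewrite lt_min => /andP[]|exists nu'].
Qed.

(** For [B = 1] this says that [x] is singular as a linear form with weights [w]. *)
Definition singular (w : 'I_d -> R) (B : 'M[R]_d) (x : 'I_d -> R) :=
  forall eps, 0 < eps -> exists T0, forall T, T0 <= T -> exists v : V,
    [/\ v != 0, forall i, `|rowform B i v| <= eps * expR (w i * T) &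
       `|phi (rowform B) lastform v x| <= eps * expR (- T)].

Context (w : 'I_d -> R) (e i1 : 'I_d).
Context (i1e : i1 != e) (wP : forall i, 0 < w e <= w i) (ws : \sum_i w i = 1).

(** For [T / ln 2] between [S k] and [S k.+1] the vector of level [k] serves: [lN] refers to the
    first of these heights and [lrho] to the second, and both carry a factor of about [2^(- k)]. *)
Lemma node_singular t (B : 'M[R]_d) x : 0 <= t ->
  (forall n, exists2 nu, node_ok (rowform B) lastform w (Spar w t e) (C1par t (d := d)) t e i1 n nu &
     node_region (rowform B) lastform w (Spar w t e) t e n nu x) -> singular w B x.
Proof.
move=> t0 hn eps eps0; set S := Spar w t e in hn *.
have H := Spar_level i1e wP ws t0.
have l2 : 0 < ln 2 :> R by rewrite ln_gt0// ltr1n.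
pose k0 := (Num.truncn (2 / eps)).+1.
have k0P k : (k0 <= k)%N -> p2 (1 - k%:R) <= eps.
  move=> kk; rewrite p2B p2_1 ler_pdivrMr ?p2_gt0// mulrC -ler_pdivrMr//.
  apply: le_trans (natr_le_p2 k); apply: (@le_trans _ _ k0%:R); last by rewrite ler_nat.
  exact: ltW (truncnS_gt _).
have M0 : 0 < Mpar w t e.
  have [[_ _ _ _ _] [C1E _]] := H; have D2 := level_D H.
  rewrite /Mpar divr_gt0//; last by case/andP: (wP e).
  by rewrite /C1par; lra.
exists (S k0 * ln 2) => T TT.
have exn : exists n, T < S n * ln 2.
  pose n := (Num.truncn (T / (Mpar w t e * ln 2))).+1; exists n.
  rewrite /S /Spar.
  apply: (@lt_le_trans _ _ (n%:R * (Mpar w t e * ln 2))).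
    rewrite -ltr_pdivrMr; last exact: mulr_gt0.
    exact: truncnS_gt (T / (Mpar w t e * ln 2)).
  by rewrite mulrA ler_pM2r// mulrC ler_pM2l// ler_eXnr// ler1n.
case: (ex_minnP exn) => n Tn nmin.
have kn : (k0 < n)%N.
  rewrite ltnNge; apply/negP => nk; move: Tn; rewrite ltNge => /negP; apply.
  by apply: le_trans TT; rewrite ler_pM2r//; exact: (S_mono H).
case: n Tn nmin kn => // k Tn nmin kn.
have Tk : S k * ln 2 <= T by rewrite leNgt; apply/negP => /nmin; rewrite ltnn.
have [nu [/andP[qA qAh] mN _ _] [_ xr]] := hn k.
have q0 : 0 < rowform B e nu.1 by apply: lt_le_trans qA; exact: p2_gt0.
have wk i : p2 (w i * S k) <= expR (w i * T).
  rewrite /p2 ler_expR -mulrA ler_wpM2l//.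
  by have /andP[h1 h2] := wP i; exact: le_trans (ltW h1) h2.
have epsk : p2 (1 - k%:R) <= eps by exact: k0P.
exists nu.1; split.
- by apply/eqP => n0; move: q0; rewrite n0 raddf0 ltxx.
- move=> i; apply: (@le_trans _ _ (p2 (1 - k%:R) * p2 (w i * S k))); last first.
    by apply: ler_pM => //; exact: p2_ge0.
  have [->|ie] := eqVneq i e.
    rewrite (ger0_norm (ltW q0)); apply: (le_trans qAh); rewrite /lAh -p2D; apply: p2_le.
    have k00 : 0 <= k%:R :> R by [].
    by rewrite -/S; lra.
  apply: le_trans (mN i ie) _; rewrite /lN -[X in X * p2 _ <= _]p2_1 -!p2D; apply: p2_le.
  by rewrite -/S; lra.
apply: (le_trans xr); apply: (@le_trans _ _ (p2 (1 - k%:R) * p2 (- S k.+1))).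
  rewrite /lrho -p2D; apply: p2_le; have k00 : 0 <= k%:R :> R by [].
  by rewrite -/S; lra.
apply: ler_pM => //; try exact: p2_ge0.
by rewrite /p2 ler_expR mulNr lerN2 ltW.
Qed.

End Slice.

Require Import Defs.
From mathcomp Require Import perm all_classical all_reals all_analysis measurable_realfun.
Import numFieldNormedType.Exports.
Local Open Scope classical_set_scope.
Local Open Scope ring_scope.

(** * The Frostman estimate on slices *)

Lemma cluster_point (R : realType) (d : nat) (x : nat -> 'I_d -> R) (tau : R) :
  (forall n i, `|x n i| <= tau) ->
  exists z : 'I_d -> R, forall del n0, 0 < del ->
    exists2 n, (n0 <= n)%N & forall i, `|x n i - z i| < del.
Proof.
move=> xt.
pose u n : 'rV[R]_d := \row_i x n i.
pose A := [set v : 'rV[R]_d | forall i, `[- tau, tau]%classic (v ord0 i)].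
have cA : compact A.
  by apply: (@rV_compact R d (fun=> `[- tau, tau]%classic)) => i; exact: segment_compact.
have [z [Az cz]] : A `&` cluster (u @ \oo) !=set0.
  apply: cA; exists 0%N => //= n _ i; rewrite /= in_itv/= mxE.
  by rewrite -ler_norml.
exists (fun i => z ord0 i) => del n0 del0.
have [] := cz [set v | exists2 n, (n0 <= n)%N & v = u n] (ball z del).
- by exists n0 => //= n n0n; exists n.
- exact: nbhsx_ballx.
move=> _ [[n n0n ->] bz]; exists n => // i.
case: bz => _ /(_ ord0 i).
by rewrite /ball /= mxE distrC.
Qed.

Lemma common_lower_bound (R : realType) (d : nat) (f : 'I_d -> R) :
  (forall i, 0 < f i) -> exists2 del, 0 < del & forall i, del <= f i.
Proof.
move=> f0; pose s := 1 + \sum_i (f i)^-1.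
have s1 : 1 <= s by rewrite lerDl sumr_ge0// => i _; rewrite invr_ge0 ltW.
exists s^-1 => [|i]; first by rewrite invr_gt0; lra.
rewrite -[leRHS]invrK lef_pV2 ?posrE ?invr_gt0//; last by lra.
rewrite /s (bigD1 i)//= addrCA lerDl addr_ge0// sumr_ge0// => j _.
by rewrite invr_ge0 ltW.
Qed.

Section SliceTheorem.
Context {R : realType} {d : nat} (w : 'I_d -> R) (e i1 : 'I_d).
Context (i1e : i1 != e) (wP : forall i, 0 < w e <= w i) (ws : \sum_i w i = 1).

(** This is what the parameter [t] is for: the Cantor set fits into any prescribed cube around 0. *)
Lemma root_region_bound (t : R) (B : 'M[R]_d) x : 0 <= t -> (2 <= d)%N -> near1 B ->
  node_region (rowform B) lastform w (Spar w t e) t e 0 (rootvec e i1, fun=> 0) x ->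
  forall i, `|x i| <= 2 * p2 (- t).
Proof.
have gen1 (a b c : R) : 0 < c -> a <= c / 2 -> b <= c / 256 -> a + b <= c by lra.
have gen2 (a c : R) : 1 / 2 * a <= c -> a <= 2 * c by lra.
move=> t0 d2 B1 [/= xb xr].
have H := Spar_level i1e wP ws t0.
have [/= /andP[qA _] mN _ _] := root_ok B1 d2 w i1e t0.
have S0 : Spar w t e 0 = 0 by rewrite /Spar expr0n mulr0.
have Ah : 1 / 2 <= rowform B e (rootvec e i1) by apply: le_trans (A_half H 0) qA.
have D2 := level_D H.
have bE i : lb w (Spar w t e) t e 0 i = p2 (- t) * p2 (- 9 - d%:R).
  by rewrite /lb /lT /= S0 -p2D; congr p2; ring.
have p9 : d%:R * p2 (- 9 - d%:R) <= 1 / 512 :> R.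
  rewrite p2B p2N mulrCA; have -> : p2 9 = 512 :> R by rewrite p2_nat; ring.
  rewrite mulrC mul1r ler_piMl ?invr_ge0// ler_pdivrMr ?p2_gt0// mul1r; exact: natr_le_p2.
have pt := p2_gt0 (- t).
have b1 i : lb w (Spar w t e) t e 0 i <= p2 (- t) / 512.
  rewrite bE; apply: ler_wpM2l; first exact: ltW.
  have h : p2 (- 9 - d%:R) <= d%:R * p2 (- 9 - d%:R) :> R by rewrite ler_peMl ?p2_ge0//; lra.
  lra.
have xi i : i != e -> `|x i| <= p2 (- t) / 512.
  by move=> ie; have := xb i ie; have := b1 i => h1 /andP[h2 h3]; rewrite ler_norml; lra.
move=> i; have [->|ie] := eqVneq i e; last by have := xi i ie; lra.
have E : rowform B e (rootvec e i1) * x e = phi (rowform B) lastform (rootvec e i1) x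
    - \sum_(i | i != e) rowform B i (rootvec e i1) * x i.
  by rewrite /phi (bigD1 e)//= /lastform /= mulr0z subr0 addrK.
have hs : `|\sum_(i | i != e) rowform B i (rootvec e i1) * x i| <= p2 (- t) / 256.
  apply: le_trans (ler_norm_sum _ _ _) _.
  apply: (@le_trans _ _ (\sum_(i < d) 2 * (p2 (- t) * p2 (- 9 - d%:R)))).
    rewrite big_mkcond/=; apply: ler_sum => j _; case: ifP => je; last first.
      by rewrite mulr_ge0// mulr_ge0 ?p2_ge0.
    rewrite normrM; apply: ler_pM => //.
      by have := mN j je; rewrite /lN S0 mulr0 subrr p2_0 mulr1.
    by rewrite -(bE j); have /andP[h1 h2] := xb j je; rewrite ger0_norm; lra.
  rewrite sumr_const card_ord -(mulr_natl (2 * _)).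
  by have := ler_wpM2l (ltW pt) p9; lra.
have hr : lrho (Spar w t e) t 0 <= p2 (- t) / 2.
  have -> : p2 (- t) / 2 = p2 (- t - 1) by rewrite p2B p2_1.
  by apply: p2_le; have [_ h _ _ _] := level_facts H 0; move: h; rewrite S0 => h; lra.
have : `|rowform B e (rootvec e i1) * x e| <= p2 (- t).
  rewrite E; apply: le_trans (ler_normB _ _) _.
  exact: gen1 pt (le_trans xr hr) hs.
rewrite normrM => h; have h2 : 1 / 2 * `|x e| <= p2 (- t).
  apply: le_trans h; rewrite ler_wpM2r//; apply: le_trans Ah _; exact: ler_norm.
exact: gen2 h2.
Qed.

(** Compactness: if no finite part of the cover had a large sum, each level [n] would contain a
    point outside the first [n] closed cubes. A cluster point of these lies in all levels, hence is
    singular, yet lies in none of the open cubes. *)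
Lemma slice (s tau : R) : s < d%:R - 1 / (1 + w i1) -> 0 < tau -> exists2 C, 0 < C &
  forall B : 'M[R]_d, B \in unitmx -> near1 B ->
  forall (P : pred nat) (p : nat -> 'I_d -> R) (r : nat -> R), (forall j, P j -> 0 < r j < 1) ->
  (forall x, (forall i, `|x i| <= tau) -> singular w B x ->
     exists2 j, P j & forall i, `|x i - p j i| < r j) ->
  exists m, 1 <= \sum_(j < m | P j) C * r j `^ s.
Proof.
move=> sD tau0.
pose t : R := (Num.truncn (2 / tau)).+1%:R.
have t0 : 0 <= t by [].
have tt : 2 * p2 (- t) <= tau.
  rewrite p2N ler_pdivrMr ?p2_gt0// mulrC -ler_pdivrMr//; apply: le_trans (natr_le_p2 _).
  by apply: ltW; exact: truncnS_gt.
have [C C0 HC] := frostman_tree i1e wP ws t0 sD; exists C => // B uB B1 P p r r01 cov.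
have d2 : (2 <= d)%N.
  by have := level_D (Spar_level i1e wP ws t0); rewrite ler_nat.
have [tr [tr0 trok trnest trcov]] := HC _ _ _ _ (fun ys => rowform_round B1 d2 ys uB)
  (rowform_orth B) (root_ok B1 d2 w i1e t0).
pose reg n := node_region (rowform B) lastform w (Spar w t e) t e n.
apply: contrapT => nosum.
have out n : exists x, (exists2 nu, nu \in tr n & reg n nu x) /\
    forall j, (j < n)%N -> P j -> ~ forall i, `|x i - p j i| <= r j.
  apply: contrapT => h; apply: nosum; exists n.
  apply: (trcov n n (fun j : 'I_n => P j) (fun j => p j) (fun j => r j)) => [j /r01//|nu x nuT xr].
  apply: contrapT => h2; apply: h; exists x; split; first by exists nu.
  by move=> j jn Pj hj; apply: h2; exists (Ordinal jn).
have /choice[x xP] := out.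
have nest n q nu' : nu' \in tr (n + q)%N -> exists2 nu, nu \in tr n &
    forall z, reg (n + q)%N nu' z -> reg n nu z.
  elim: q nu' => [|q IH] nu'; first by rewrite addn0 => h; exists nu'.
  rewrite addnS => /trnest[nu1 nu1T h1].
  by have [nu nuT h] := IH nu1 nu1T; exists nu => // z /h1/h.
have xin n k : (k <= n)%N -> exists2 nu, nu \in tr k & reg k nu (x n).
  move=> kn; have [[nu' nuT' xr] _] := xP n.
  rewrite -(subnKC kn) in nuT' xr; have [nu nuT h] := nest _ _ _ nuT'.
  by exists nu => //; apply: h; move: xr; rewrite subnKC.
have bound z : (exists2 nu, nu \in tr 0%N & reg 0%N nu z) -> forall i, `|z i| <= tau.
  move=> [nu]; rewrite tr0 inE => /eqP -> zr i; apply: le_trans tt.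
  exact: (root_region_bound t0 d2 B1 zr).
have [z zP] := cluster_point (fun n => bound (x n) (xin n 0%N (leq0n n))).
have zin k : exists2 nu, nu \in tr k & reg k nu z.
  apply: region_closed => del del0; have [n kn xz] := zP del k del0.
  by exists (x n); split=> //; have [nu nuT xr] := xin n k kn; exists nu.
have zs : singular w B z.
  apply: (node_singular i1e wP ws t0) => n; have [nu nuT zr] := zin n.
  by exists nu => //; exact: trok.
have [j Pj zj] := cov z (bound z (zin 0%N)) zs.
have [|del del0 delP] := common_lower_bound (f := fun i => r j - `|z i - p j i|).
  by move=> i; rewrite subr_gt0.
have [n jn xz] := zP del j.+1 del0.
have [_ /(_ j jn Pj)] := xP n; apply => i.
have := ler_normD (x n i - z i) (z i - p j i); rewrite addrA subrK.
by have := ltW (xz i); have := delP i; lra.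
Qed.

End SliceTheorem.

(** * Divergence and the chart *)

Section Divergence.
Context {R : realType}.

Lemma unimodular_std n : unimodular (zspan (1%:M : 'M[R]_n)).
Proof. by exists 1%:M; rewrite // det1 normr1. Qed.

Lemma SLdist1_norm n (h : 'M[R]_n) (r : R) : SLdist h 1%:M < r ->
  mxnorm1 h <= expR r + mxnorm1 (1%:M : 'M[R]_n).
Proof.
rewrite /SLdist => hr; set m := Num.max _ _ in hr.
have m0 : 0 <= m by rewrite le_max mxnorm1_ge0.
have : 1 + m <= expR r.
  by rewrite -[X in X <= _]lnK ?ler_expR ?ltW// posrE; lra.
have : mxnorm1 (h - 1%:M) <= m by rewrite /m le_max invmx1 mulmx1 lexx.
have := mxnorm1D (h - 1%:M) 1%:M; rewrite subrK; lra.
Qed.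

(** The distance to the standard lattice is bounded on a compact set, and [SLdist] to the identity
    bounds the entries of a basis. *)
Lemma compact_bounded_basis n (K : set (ulattice R n)) : compact K ->
  exists2 C : R, 0 < C & forall L, K L -> exists h : 'M[R]_n,
    [/\ \det h = 1, (L : set _) = zspan h & mxnorm1 h <= C].
Proof.
move=> cK; pose L0 := ULattice (unimodular_std n).
suff [r rP] : exists r, forall L, K L -> mdist L L0 < r.
  exists (expR r + mxnorm1 (1%:M : 'M[R]_n)); first by rewrite ltr_pwDl ?expR_gt0 ?mxnorm1_ge0.
  move=> L /rP LL0; have [h [dh Lh hL]] := @ulattice_dist_lt R n L L0 1%:M r (det1 _ _) erefl LL0.
  by exists h; split=> //; exact: SLdist1_norm.
apply: contrapT => /forallNP hK.
have /choice[L LP] (m : nat) : exists L, K L /\ m%:R <= mdist L L0.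
  have /existsNP[L /not_implyP[KL /negP]] := hK m%:R.
  by rewrite -leNgt => h; exists L.
have [M [KM cM]] : K `&` cluster (L @ \oo) !=set0.
  by apply: cK; exists 0%N => // m _; case: (LP m).
pose m0 := (Num.truncn (mdist M L0 + 1)).+1.
have [] := cM [set N | exists2 m, (m0 <= m)%N & N = L m] (ball M 1).
- by exists m0 => //= m m0m; exists m.
- exact: nbhsx_ballx.
move=> _ [[m mm ->]]; rewrite ballEmdist /= => ML.
have [_ Lm] := LP m.
have : mdist M L0 + 1 < m%:R.
  by apply: lt_le_trans (truncnS_gt _) _; rewrite ler_nat.
have := @ulattice_dist_triangle R n M (L m) L0; rewrite (ulattice_dist_sym (L m) M).
by move: ML Lm; rewrite -!/(mdist _ _) => *; lra.
Qed.

Section Chart.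
Context {d : nat}.

Definition chart_mx (A : 'M[R]_d) (b : 'rV[R]_d) (z : 'cV[R]_d) : 'M[R]_(d + 1) :=
  block_mx A z b ((b *m invmx A *m z) + ((\det A)^-1)%:M).

(* The row vector whose products with the basis are the integers (v1, k). *)
Lemma chart_row (A : 'M[R]_d) (b : 'rV[R]_d) (z : 'cV[R]_d) (v1 : 'rV[R]_d) (k : R) :
  A \in unitmx -> let p := (v1 *m invmx A *m z) 0 0 - k in
  row_mx (v1 *m invmx A + (\det A * p) *: (b *m invmx A)) (- (\det A * p))%:M *m chart_mx A b z
  = row_mx v1 k%:M.
Proof.
move=> uA p; rewrite /chart_mx mul_row_block mulmxDl -scalemxAl !mulmxKV//.
rewrite !mul_scalar_mx scaleNr addrK mulmxDl scalerDr -scalemxAl.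
congr row_mx; rewrite /p; move: (v1 *m _ *m z) (b *m _ *m z) => Y X.
have dA0 : \det A != 0 by rewrite -unitfE -unitmxE.
by apply/rowP => i; rewrite !ord1 !mxE eqxx !mulr1n; field.
Qed.

Lemma det_chart (A : 'M[R]_d) b z : A \in unitmx -> \det (chart_mx A b z) = 1.
Proof.
move=> uA.
have -> : chart_mx A b z = block_mx 1%:M 0 (b *m invmx A) 1%:M *m block_mx A z 0 ((\det A)^-1)%:M.
  by rewrite mulmx_block !mul1mx !mul0mx !addr0 mulmxKV.
rewrite det_mulmx det_lblock !det1 mul1r det_ublock det_scalar1 mul1r divff//.
by rewrite -unitfE -unitmxE.
Qed.


Lemma singular_divergent (w : 'I_d -> R) (ws : \sum_i w i = 1) (A : 'M[R]_d) b (z : 'cV[R]_d)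
    (L : ulattice R (d + 1)) :
  (forall i, 0 < w i) -> A \in unitmx -> (L : set _) = zspan (chart_mx A b z) ->
  singular w (invmx A) (fun i => z i 0) ->
  divergent (fun t : R => ulattice_act (det_a_flow t ws) L).
Proof.
move=> w0 uA LE zs K cK; have [C C0 HC] := compact_bounded_basis cK.
pose dA := \det A; pose bB := b *m invmx A.
(* [eps * E] will bound each entry of the dual vector [rr] and [C] bounds the basis [h], so [eps]
   makes the entries of the integer vector at most 1/2. *)
pose E := 1 + \sum_i `|dA * bB 0 i| + `|dA|.
have E0 : 0 < E by rewrite /E -addrA ltr_pwDl// addr_ge0// sumr_ge0.
pose eps := (2 * (E * C))^-1.
have eps0 : 0 < eps by rewrite invr_gt0 !mulr_gt0.
have [T0 HT0] := zs eps eps0.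
exists (Num.max 0 T0); split; first exact: num_real.
move=> t; rewrite gt_max => /andP[t0 tT] /= /HC[h [dh hL hC]].
have {HT0} [v [v0 vy vphi]] := HT0 t (ltW tT).
have dc := det_chart b z uA; set g := chart_mx A b z in LE dc.
have uag : a_flow w t *m g \in unitmx by rewrite det1_unitmx// det_mulmx dc det_a_flow// mulr1.
have [c hE] : exists c : 'M[int]_(d + 1), h = a_flow w t *m g *m map_mx intr c.
  apply: zspan_sub; rewrite -hL /ulattice_act /= LE -zspan_mul; exact: subset_refl.
pose V : 'rV[int]_(d + 1) := row_mx v.1 (v.2)%:M.
have V0 : V != 0.
  apply: contra v0 => /eqP V0; have [v1 v2] : v.1 = 0 /\ (v.2)%:M = 0 :> 'rV_1.
    by apply: eq_row_mx; rewrite row_mx0.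
  case: v v1 v2 {vy vphi V V0} => v1 v2 /= -> /rowP/(_ 0); rewrite !mxE eqxx mulr1n => ->.
  by [].
pose p := (map_mx intr v.1 *m invmx A *m z) 0 0 - (v.2)%:~R.
have pE : phi (rowform (invmx A)) lastform v (fun i => z i 0) = p.
  rewrite /phi /p mxE; congr (_ - _); apply: eq_bigr => i _; congr (_ * _).
  by rewrite mxE /= /rowform; apply: eq_bigr => j _; rewrite mxE.
pose xi1 := map_mx intr v.1 *m invmx A + (dA * p) *: bB.
have VE : row_mx xi1 (- (dA * p))%:M *m g = map_mx intr V.
  by rewrite chart_row// map_row_mx; congr row_mx; apply/rowP => i; rewrite !ord1 !mxE eqxx !mulr1n.
have zeta0 : V *m c != 0.
  apply: contra V0 => /eqP Vc.
  have uc : map_mx intr c \in @unitmx R (d + 1).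
    rewrite det1_unitmx//; have := dh; rewrite hE !det_mulmx dc det_a_flow// !mul1r.
    by [].
  have : map_mx intr V *m map_mx intr c = 0 :> 'rV[R]_(d + 1).
    by rewrite -map_mxM Vc map_mx0.
  move/(congr1 (fun M => M *m invmx (map_mx intr c))); rewrite mulmxK// mul0mx => V0.
  apply/eqP/rowP => i; have := congr1 (fun M : 'rV_(d + 1) => M 0 i) V0.
  by rewrite !mxE => /eqP; rewrite intr_eq0 => /eqP.
have [j zj] : exists j, (V *m c) 0 j != 0.
  apply/existsP; rewrite -negb_forall; apply: contra zeta0 => /forallP h0.
  by apply/eqP/rowP => j; rewrite [RHS]mxE; apply/eqP.
(* The dual vector moved by the inverse flow: its products with the basis [a_flow w t *m g] are
   still the integers [V]. *)
pose rr := row_mx xi1 (- (dA * p))%:M *m a_flow w (- t).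
have aa : a_flow w (- t) *m a_flow w t = 1%:M.
  rewrite /a_flow mulmx_diag -diag_const_mx; congr diag_mx; apply/rowP => i.
  rewrite !mxE; case: splitP => l _; rewrite !mxE -expRD ?mulrN ?opprK.
    by rewrite addNr expR0.
  by rewrite subrr expR0.
have rrE : rr *m h = map_mx intr (V *m c).
  rewrite hE /rr -!mulmxA (mulmxA (a_flow w (- t))) aa mul1mx.
  by rewrite mulmxA VE map_mxM.
have pt : `|p| <= eps * expR (- t) by rewrite -pE.
have p1 : `|p| <= eps.
  by apply: (le_trans pt); rewrite ler_piMr ?(ltW eps0)// -expR0 ler_expR oppr_le0 ltW.
have rrb i : `|rr 0 i| <= eps * E.
  rewrite /rr mul_mx_diag mxE; case: (splitP i) => l il.
    have -> : i = lshift 1 l by apply: val_inj.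
    rewrite !row_mxEl [X in _ * X]mxE mulrN normrM (gtr0_norm (expR_gt0 _)).
    have h1 : `|xi1 0 l| <= eps * expR (w l * t) + `|dA * bB 0 l| * eps.
      rewrite mxE; apply: le_trans (ler_normD _ _) _; apply: lerD.
        have := vy l; congr (`|_| <= _).
        by rewrite mxE /rowform; apply: eq_bigr => q _; rewrite mxE.
      by rewrite mxE mulrAC normrM ler_wpM2l.
    have e1 : expR (w l * t) * expR (- (w l * t)) = 1 by rewrite -expRD subrr expR0.
    have e2 : expR (- (w l * t)) <= 1.
      by rewrite -expR0 ler_expR oppr_le0 mulr_ge0// ltW.
    apply: le_trans (ler_wpM2r (expR_ge0 _) h1) _.
    rewrite mulrDl -(mulrA eps) e1 mulr1.
    have hS : `|dA * bB 0 l| <= \sum_i `|dA * bB 0 i| by rewrite (bigD1 l)//= lerDl sumr_ge0.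
    have h2 : `|dA * bB 0 l| * eps * expR (- (w l * t)) <= (\sum_i `|dA * bB 0 i|) * eps.
      apply: (@le_trans _ _ (`|dA * bB 0 l| * eps)); last by rewrite ler_pM2r.
      by apply: ler_piMr => //; apply: mulr_ge0 => //; exact: ltW.
    have h3 : 0 <= `|dA| * eps by apply: mulr_ge0 => //; exact: ltW.
    by rewrite /E !mulrDr mulr1; lra.
  have -> : i = rshift d l by apply: val_inj; rewrite /= il.
  rewrite !row_mxEr !ord1 !mxE eqxx mulr1n opprK normrM normrN normrM (gtr0_norm (expR_gt0 _)).
  have e1 : expR (- t) * expR t = 1 by rewrite -expRD addNr expR0.
  have h1 : `|p| * expR t <= eps.
    by apply: le_trans (ler_wpM2r (expR_ge0 t) pt) _; rewrite -mulrA e1 mulr1.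
  rewrite -mulrA; apply: le_trans (ler_wpM2l (normr_ge0 dA) h1) _.
  rewrite mulrC ler_pM2l// /E lerDr addr_ge0// sumr_ge0//.
have : `|(map_mx intr (V *m c) : 'rV[R]_(d + 1)) 0 j| <= 1 / 2.
  rewrite -rrE mxE; apply: le_trans (ler_norm_sum _ _ _) _.
  apply: (@le_trans _ _ (\sum_i eps * E * `|h i j|)).
    by apply: ler_sum => i _; rewrite normrM ler_wpM2r.
  rewrite -mulr_sumr; apply: (@le_trans _ _ (eps * E * C)).
    apply: ler_wpM2l; first by apply: mulr_ge0; exact: ltW.
    apply: le_trans hC; apply: ler_sum => i _.
    by rewrite (bigD1 j)//= lerDl sumr_ge0.
  by rewrite /eps le_eqVlt; apply/orP; left; apply/eqP; field; rewrite !gt_eqF.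
rewrite mxE -intr_norm => h1; have : 1 <= `|(V *m c) 0 j| by rewrite -gtz0_ge1 normr_gt0.
by rewrite -(ler_int R); lra.
Qed.

End Chart.
End Divergence.

(** * Slicing of covers *)

(** Chebyshev's inequality: a ball has length [2 * rho j], so the weighted sum of indicators has
    integral at most [2 * eps], whereas exceeding the bound everywhere would give at least
    [3 * eps]. *)
Lemma slicing1 (R : realType) (a c rho : nat -> R) (b tau eps : R) :
  0 < tau -> 0 < eps -> (forall j, 0 <= a j) -> (forall j, 0 < rho j) ->
  (forall n, \sum_(j < n) a j * rho j <= eps) ->
  exists2 x, b <= x <= b + tau & forall n, \sum_(j < n | `|x - c j| < rho j) a j <= 3 / tau * eps.
Proof.
move=> tau0 eps0 a0 rho0 sa; apply: contrapT => nx.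
pose mu := @lebesgue_measure R.
pose I : set R := `[b, b + tau]%classic.
pose g (j : nat) : R -> \bar R := fun x => (a j * \1_(ball (c j) (rho j)) x)%:E.
have mI : measurable I by exact: measurable_itv.
have mg j : measurable_fun I (g j).
  apply/measurable_EFinP; apply: measurable_funM => //.
  by apply: measurable_indic; exact: measurable_ball.
have g0 j x : I x -> (0 <= g j x)%E.
  by move=> _; rewrite lee_fin mulr_ge0// indicE.
have key : (\int[mu]_(x in I) (\sum_(0 <= j <oo) g j x) <= (2 * eps)%:E)%E.
  rewrite integral_nneseries//.
  apply: lime_le.
    apply: is_cvg_nneseries => j _ _; apply: integral_ge0 => x; exact: g0.
  apply: nearW => n.
  apply: (@le_trans _ _ (\sum_(0 <= j < n) (2 * (a j * rho j))%:E)%E).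
    apply: lee_sum => j _.
    under eq_integral do rewrite /g EFinM.
    rewrite ge0_integralZl//; last 2 first.
    - apply/measurable_EFinP; apply: measurable_indic; exact: measurable_ball.
    - by rewrite lee_fin.
    rewrite integral_indic//; last exact: measurable_ball.
    have -> : (2 * (a j * rho j))%:E = ((a j)%:E * (rho j *+ 2)%:E)%E.
      by rewrite -EFinM; congr EFin; rewrite mulr2n; ring.
    apply: lee_wpmul2l; first by rewrite lee_fin.
    rewrite -(lebesgue_measure_ball (c j) (ltW (rho0 j))).
    apply: le_measure; rewrite ?inE//; first by apply: measurableI => //; exact: measurable_ball.
    exact: measurable_ball.
  rewrite sumEFin lee_fin -mulr_sumr big_mkord; have := sa n; lra.
have low : ((3 / tau * eps)%:E * mu I <= \int[mu]_(x in I) (\sum_(0 <= j <oo) g j x))%E.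
  rewrite -integral_cst//; apply: ge0_le_integral => //.
  - by move=> x _; rewrite lee_fin mulr_ge0 ?divr_ge0// ltW.
  - exact: (ge0_emeasurable_sum (P := xpredT) (fun j x Ix _ => g0 j x Ix) (fun j _ => mg j)).
  move=> x Ix; rewrite leNgt; apply/negP => hx; apply: nx; exists x.
    by move: Ix; rewrite /I /= in_itv.
  move=> n; rewrite -lee_fin; apply: le_trans (ltW hx).
  apply: le_trans (nneseries_lim_ge n (fun j _ _ => g0 j x Ix)).
  rewrite sumEFin lee_fin big_mkord [leLHS]big_mkcond/=; apply: ler_sum => j _.
  rewrite indicE; case: ifPn => [h|_]; last by rewrite mulr_ge0.
  by rewrite mem_set ?mulr1// /ball /= distrC.
have := le_trans low key.
rewrite /mu lebesgue_measure_itv/= lte_fin ltrDl tau0 -EFinB -EFinM lee_fin.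
have -> : 3 / tau * eps * (b + tau - b) = 3 * eps by field; rewrite gt_eqF.
lra.
Qed.

Lemma slicing (R : realType) (q : nat) (a : nat -> R) (c : nat -> 'I_q -> R) (rho : nat -> R)
    (b : 'I_q -> R) (tau eps : R) :
  0 < tau -> 0 < eps -> (forall j, 0 <= a j) -> (forall j, 0 < rho j) ->
  (forall n, \sum_(j < n) a j * rho j ^+ q <= eps) ->
  exists2 x : 'I_q -> R, forall i, b i <= x i <= b i + tau &
    forall n, \sum_(j < n | [forall i, `|x i - c j i| < rho j]) a j <= (3 / tau) ^+ q * eps.
Proof.
move=> tau0; elim: q a c b eps => [|q IH] a c b eps eps0 a0 rho0 sa.
  exists b => [[]//|n]; rewrite expr0 mul1r; apply: le_trans (sa n).
  rewrite big_mkcond/=; apply: ler_sum => j _; rewrite expr0 mulr1.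
  by case: ifP.
have [|||||x0 x0b hx0] := @slicing1 R (fun j => a j * rho j ^+ q) (fun j => c j ord0)
  rho (b ord0) tau eps.
- by [].
- by [].
- by move=> j; rewrite mulr_ge0// exprn_ge0// ltW.
- by [].
- by move=> n; apply: le_trans (sa n); apply: ler_sum => j _; rewrite exprSr mulrA.
(* Sets missed by the first coordinate get weight 0, so the remaining coordinates only have to deal
   with those that still meet the slice. *)
pose a' j := if `|x0 - c j ord0| < rho j then a j else 0.
have [||||x xb hx] := IH a' (fun j i => c j (lift ord0 i)) (fun i => b (lift ord0 i)) (3 / tau * eps).
- by rewrite mulr_gt0// divr_gt0.
- by move=> j; rewrite /a'; case: ifP.
- by [].
- move=> n; apply: le_trans (hx0 n); rewrite [leRHS]big_mkcond/=.
  by apply: ler_sum => j _; rewrite /a'; case: ifP; rewrite ?mul0r.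
exists (fun i => oapp x x0 (unlift ord0 i)).
  by move=> i; case: unliftP => [j|] ->.
move=> n; rewrite exprSr -mulrA; apply: le_trans (hx n).
rewrite big_mkcond [leRHS]big_mkcond/=; apply: ler_sum => j _.
case: ifPn => [/forallP h|_]; last first.
  by case: ifP => // _; rewrite /a'; case: ifP.
have -> : [forall i, `|x i - c j (lift ord0 i)| < rho j].
  by apply/forallP => i; have := h (lift ord0 i); rewrite liftK.
by rewrite /a'; have := h ord0; rewrite unlift_none /= => ->.
Qed.

(** * Estimates for the chart near the identity *)

Section Near.
Context {R : realType}.

Lemma prod_near (I : Type) (r : seq I) (a b : I -> R) (tau : R) :
  0 <= tau <= 1 -> (forall i, `|b i| <= 1) -> (forall i, `|a i - b i| <= tau) ->
  `|\prod_(i <- r) a i - \prod_(i <- r) b i| <= 2 ^+ size r * tau.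
Proof.
move=> /andP[t0 t1] b1 ab.
have h1 s : `|\prod_(i <- s) b i| <= 1.
  elim: s => [|i s IH]; first by rewrite big_nil normr1.
  by rewrite big_cons normrM mulr_ile1.
(* The sharper constant [2^n - 1] is what carries the induction. *)
suff h s : `|\prod_(i <- s) a i - \prod_(i <- s) b i| <= (2 ^+ size s - 1) * tau.
  by apply: (le_trans (h r)); rewrite ler_wpM2r//; lra.
elim: s => [|i s IH]; first by rewrite !big_nil subrr normr0 mulr_ge0//= expr0 subrr.
rewrite !big_cons (_ : _ - _ = a i * (\prod_(i <- s) a i - \prod_(i <- s) b i)
  + (a i - b i) * \prod_(i <- s) b i); last by ring.
apply: le_trans (ler_normD _ _) _; rewrite !normrM /= exprS.
have ai : `|a i| <= 2.
  rewrite -[a i](subrK (b i)); apply: le_trans (ler_normD _ _) _.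
  by have := ab i; have := b1 i; lra.
have := ler_pM (normr_ge0 _) (normr_ge0 _) ai IH.
have := ler_pM (normr_ge0 _) (normr_ge0 _) (ab i) (h1 s); lra.
Qed.

Lemma det_near d (A : 'M[R]_d) (tau : R) : 0 <= tau <= 1 ->
  (forall i j, `|A i j - (i == j)%:R| <= tau) -> `|\det A - 1| <= (d`! * 2 ^ d)%N%:R * tau.
Proof.
move=> t01 At; rewrite -[X in `|_ - X|](det1 R d) /determinant -sumrB.
apply: le_trans (ler_norm_sum _ _ _) _.
apply: (@le_trans _ _ (\sum_(s : {perm 'I_d}) 2 ^+ d * tau)); last first.
  by rewrite sumr_const card_Sn -(mulr_natl (2 ^+ d * tau)) natrM natrX mulrA.
apply: ler_sum => s _; rewrite -mulrBr normrM normr_sign mul1r.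
have := @prod_near _ (index_enum 'I_d) (fun i => A i (s i)) (fun i => (1%:M : 'M[R]_d) i (s i)) tau t01.
have -> : size (index_enum 'I_d) = d by rewrite /index_enum -enumT size_enum_ord.
apply=> i; rewrite mxE; last exact: At.
by case: (_ == _); rewrite ?normr1 ?normr0.
Qed.

Lemma mxnorm1_1 n : mxnorm1 (1%:M : 'M[R]_n) = n%:R.
Proof.
rewrite /mxnorm1 -[n in RHS]card_ord -sumr_const.
apply: eq_bigr => i _; rewrite (bigD1 i)//= mxE eqxx normr1 big1 ?addr0// => j ji.
by rewrite mxE eq_sym (negPf ji) normr0.
Qed.

Lemma mxnorm1_le n (g : 'M[R]_n) (k : R) : (forall i j, `|g i j| <= k) -> mxnorm1 g <= n%:R ^+ 2 * k.
Proof.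
move=> gk; apply: (@le_trans _ _ (\sum_(i < n) \sum_(j < n) k)).
  by apply: ler_sum => i _; apply: ler_sum => j _.
by rewrite !sumr_const card_ord -mulrnA -(mulr_natl k) natrM -expr2.
Qed.

(** As [g^-1 - 1 = g^-1 (1 - g)], the norm of [g^-1] is at most half of itself plus [n]. *)
Lemma inv_near n (g : 'M[R]_n) : g \in unitmx -> mxnorm1 (g - 1%:M) <= 1 / 2 ->
  mxnorm1 (invmx g) <= 2 * n%:R /\ mxnorm1 (invmx g - 1%:M) <= 2 * n%:R * mxnorm1 (g - 1%:M).
Proof.
move=> ug g2; have E : invmx g - 1%:M = invmx g *m (1%:M - g) by rewrite mulmxBr mulmx1 mulVmx.
have h : mxnorm1 (invmx g - 1%:M) <= mxnorm1 (invmx g) * mxnorm1 (g - 1%:M).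
  by rewrite E -(mxnorm1N (g - _)) opprB; exact: mxnorm1M.
have h1 : mxnorm1 (invmx g) <= 2 * n%:R.
  have := mxnorm1D (invmx g - 1%:M) 1%:M; rewrite subrK mxnorm1_1.
  have := ler_wpM2l (mxnorm1_ge0 (invmx g)) g2; lra.
by split=> //; apply: (le_trans h); rewrite ler_wpM2r// mxnorm1_ge0.
Qed.

Lemma near_chart d (eta : R) : (0 < d)%N -> 0 < eta -> exists2 tau, 0 < tau &
  forall (A : 'M[R]_d) (b : 'rV[R]_d) (z : 'cV[R]_d),
    (forall i j, `|A i j - (i == j)%:R| <= tau) -> (forall j, `|b 0 j| <= tau) ->
    (forall i, `|z i 0| <= tau) ->
  [/\ A \in unitmx, near1 (invmx A) & mxnorm1 (chart_mx A b z - 1%:M) <= eta].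
Proof.
move=> d0 eta0; have dr : 0 < d%:R :> R by rewrite ltr0n.
pose K0 : R := (d`! * 2 ^ d)%N%:R; have K00 : 0 <= K0 by [].
pose Q := (d + 1)%:R ^+ 2 * (1 + 2 * d%:R + 2 * K0).
have Q0 : 0 <= Q.
  by rewrite mulr_ge0 ?exprn_ge0//; lra.
(* The sum of all requirements, so that its inverse [tau] meets each of them. *)
pose X := 1 + 2 * K0 + 2 * d%:R ^+ 2 + 16 * d%:R ^+ 4 + Q / eta.
have d20 : 0 <= d%:R ^+ 2 :> R by exact: exprn_ge0.
have d40 : 0 <= d%:R ^+ 4 :> R by exact: exprn_ge0.
have Qe : 0 <= Q / eta by rewrite divr_ge0// ltW.
have X0 : 0 < X by rewrite /X; lra.
exists X^-1 => [|A b z At bt zt]; first by rewrite invr_gt0.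
set tau := X^-1 in At bt zt.
have tau0 : 0 < tau by rewrite invr_gt0.
have part Y : Y <= X -> Y * tau <= 1 by move=> YX; rewrite /tau ler_pdivrMr// mul1r.
have t1 : tau <= 1 by have := part 1; rewrite mul1r; apply; rewrite /X; lra.
have tK : 2 * K0 * tau <= 1 by apply: part; rewrite /X; lra.
have td2 : 2 * d%:R ^+ 2 * tau <= 1 by apply: part; rewrite /X; lra.
have td4 : 16 * d%:R ^+ 4 * tau <= 1 by apply: part; rewrite /X; lra.
have tQ : Q * tau <= eta.
  have h : Q / eta * tau <= 1 by apply: part; rewrite /X; lra.
  by move: h; rewrite mulrAC ler_pdivrMr// mul1r.
have dn : `|\det A - 1| <= K0 * tau by apply: det_near => //; rewrite (ltW tau0).
have dn2 : 1 / 2 <= \det A by move: dn; rewrite ler_norml => /andP[h _]; lra.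
have uA : A \in unitmx by rewrite unitmxE unitfE gt_eqF//; lra.
have mA : mxnorm1 (A - 1%:M) <= d%:R ^+ 2 * tau.
  by apply: mxnorm1_le => i j; rewrite !mxE; exact: At.
have [|iA1 iA2] := inv_near uA; first lra.
have invn : `|(\det A)^-1 - 1| <= 2 * K0 * tau.
  have dA0 : 0 < \det A by lra.
  have -> : (\det A)^-1 - 1 = (1 - \det A) / \det A by field; rewrite gt_eqF.
  rewrite normrM normfV (gtr0_norm dA0) ler_pdivrMr// distrC.
  apply: (le_trans dn); have := ler_wpM2l (mulr_ge0 K00 (ltW tau0)) dn2; lra.
split=> //.
  move=> i j; apply: (@le_trans _ _ (mxnorm1 (invmx A - 1%:M))).
    by apply: le_trans (mxnorm1_entry _ i j); rewrite !mxE.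
  apply: (le_trans iA2); rewrite ler_pdivlMr; last by rewrite mulr_gt0.
  have h := ler_wpM2l (ltW dr) mA.
  have := ler_wpM2l (ltW dr) h; lra.
apply: (@le_trans _ _ ((d + 1)%:R ^+ 2 * ((1 + 2 * d%:R + 2 * K0) * tau))); last first.
  by rewrite mulrA.
have c1 : tau <= (1 + 2 * d%:R + 2 * K0) * tau by rewrite ler_peMl ?(ltW tau0)//; lra.
apply: mxnorm1_le => i j; rewrite !mxE.
case: splitP => i' ii; rewrite mxE; case: splitP => j' jj.
- apply: le_trans c1; have := At i' j'; congr (`|_ - _%:R| <= _).
  by rewrite -!(inj_eq val_inj) /= ii jj.
- rewrite (_ : (i == j) = false) ?subr0; last first.
    by apply/eqP => ij; have := ltn_ord i'; rewrite -ii ij jj ltnNge leq_addr.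
  by apply: le_trans c1; rewrite ord1; exact: zt.
- rewrite (_ : (i == j) = false) ?subr0; last first.
    by apply/eqP => ij; have := ltn_ord j'; rewrite -jj -ij ii ltnNge leq_addr.
  by apply: le_trans c1; rewrite ord1; exact: bt.
rewrite (_ : (i == j) = true); last first.
  by apply/eqP/val_inj; rewrite /= ii jj !ord1.
rewrite !ord1 mxE [X in _ + X - _]mxE eqxx mulr1n -addrA.
apply: le_trans (ler_normD _ _) _.
suff : `|(b *m invmx A *m z) 0 0| <= 2 * d%:R * tau by move=> h; lra.
rewrite -mulmxA mxE.
have Bz i0 : `|(invmx A *m z) i0 0| <= \sum_j0 `|invmx A i0 j0|.
  rewrite mxE; apply: le_trans (ler_norm_sum _ _ _) _; apply: ler_sum => j0 _.
  by rewrite normrM ler_piMr// (le_trans (zt _)).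
apply: le_trans (ler_norm_sum _ _ _) _.
apply: (@le_trans _ _ (tau * mxnorm1 (invmx A))).
  rewrite /mxnorm1 mulr_sumr; apply: ler_sum => i0 _; rewrite normrM ler_pM//.
by rewrite mulrC ler_wpM2r// ltW.
Qed.

(** [SLdist] is logarithmic, but [expR D - 1] is at most [expR 1 * D] for [D] up to 1; multiplying
    by the bounded matrix [g'] turns the relative error into one on the entries. *)
Lemma chart_lipschitz n (g g' : 'M[R]_n) (D : R) : g \in unitmx -> g' \in unitmx ->
  mxnorm1 (g' - 1%:M) <= 1 -> SLdist g g' <= D -> D <= 1 ->
  forall i j, `|g i j - g' i j| <= n.+1%:R * expR 1 * D.
Proof.
move=> ug ug' g1 gD D1 i j.
have D0 : 0 <= D by apply: le_trans gD; exact: SLdist_ge0.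
set X := mxnorm1 (g *m invmx g' - 1%:M).
have X0 : 0 <= X := mxnorm1_ge0 _.
have XD : X <= expR D - 1.
  have : 1 + X <= expR D; last by lra.
  have h : 0 < 1 + X by rewrite ltr_pwDl.
  rewrite -[1 + X]lnK ?posrE// ler_expR; apply: le_trans gD; rewrite /SLdist ler_ln ?posrE//.
    by rewrite lerD2l le_max lexx.
  by rewrite ltr_pwDl// le_max X0.
have eD : expR D - 1 <= expR 1 * D.
  have h1 : 1 - D <= expR (- D) by have := expR_ge1Dx (- D).
  have h2 : expR D * expR (- D) = 1 by rewrite -expRD subrr expR0.
  have h3 := ler_wpM2l (expR_ge0 D) h1; rewrite h2 in h3.
  have h4 : expR D * D <= expR 1 * D by rewrite ler_wpM2r// ler_expR.
  lra.
have g'n : mxnorm1 g' <= n.+1%:R.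
  have := mxnorm1D (g' - 1%:M) 1%:M; rewrite subrK mxnorm1_1 -[n.+1%:R]natr1; lra.
have E : g - g' = (g *m invmx g' - 1%:M) *m g' by rewrite mulmxBl mulmxKV// mul1mx.
apply: (@le_trans _ _ (mxnorm1 (g - g'))).
  by apply: le_trans (mxnorm1_entry _ i j); rewrite !mxE.
rewrite E; apply: le_trans (mxnorm1M _ _) _; rewrite mulrC -mulrA.
by apply: ler_pM; rewrite ?mxnorm1_ge0//; apply: le_trans XD eD.
Qed.

End Near.

Section Covers.
Context {R : realType} {T : metricType R}.

(** Adding a geometric term to the powers [D j ^ s] gives positive radii even to sets of diameter 0.
    The scale 1 in the premeasure makes all diameters finite. *)
Lemma null_cover (s eps : R) (A : set T) : 0 < s -> hausdorff_measure s A = 0%E -> 0 < eps ->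
  exists U : nat -> set T, exists r : nat -> R,
  [/\ A `<=` \bigcup_j U j, forall j, 0 < r j,
    forall j x y, U j x -> U j y -> mdist x y < r j &
    forall n, \sum_(j < n) r j `^ s <= eps].
Proof.
move=> s0 HA eps0; have e20 : 0 < eps / 2 by rewrite divr_gt0.
have : (hausdorff_premeasure s 1 A < (eps / 2)%:E)%E.
  apply: (@le_lt_trans _ _ (hausdorff_measure s A)); last by rewrite HA lte_fin.
  by apply: ereal_sup_ubound; exists 1 => //=.
move=> /ereal_inf_lt[_ [U [AU Ud] <-] sU].
have Dp j x y : U j x -> U j y -> ((mdist x y)%:E <= diameter (U j))%E.
  by move=> Ux Uy; apply: ereal_sup_ubound; right; exists (x, y).
have D0 j : (0 <= diameter (U j))%E by apply: ereal_sup_ubound; left.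
pose D j := fine (diameter (U j)).
have DE j : diameter (U j) = (D j)%:E.
  by rewrite /D fineK// ge0_fin_numE//; apply: le_lt_trans (Ud j) _; rewrite ltry.
have Dge j : 0 <= D j by rewrite -lee_fin -DE.
pose r j := (D j `^ s + eps / 2 / 2 ^+ j.+1) `^ s^-1.
have pos j : 0 < D j `^ s + eps / 2 / 2 ^+ j.+1.
  by rewrite ltr_wpDl ?powR_ge0// divr_gt0// exprn_gt0.
have rs j : r j `^ s = D j `^ s + eps / 2 / 2 ^+ j.+1.
  by rewrite /r -powRrM mulVf ?gt_eqF// powRr1// ltW.
have Dr j : D j < r j.
  rewrite ltNge; apply/negP => rD.
  have := ge0_ler_powR (ltW s0) _ _ rD; rewrite !nnegrE rs powR_ge0 Dge => /(_ isT isT).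
  by have : 0 < eps / 2 / 2 ^+ j.+1 by [rewrite divr_gt0// exprn_gt0|]; lra.
exists U, r; split=> //.
- by move=> j; rewrite powR_gt0.
- by move=> j x y Ux Uy; apply: le_lt_trans (Dr j); rewrite -lee_fin -DE; exact: Dp.
move=> n; under eq_bigr do rewrite rs.
rewrite big_split/= [leRHS](splitr eps) lerD//.
  rewrite -lee_fin; apply: le_trans (ltW sU).
  apply: le_trans (nneseries_lim_ge n _); last by move=> j _ _; exact: poweR_ge0.
  rewrite -sumEFin big_mkord; apply: lee_sum => j _.
  by rewrite DE poweR_EFin.
rewrite -mulr_sumr; apply: ler_piMr; first exact: ltW.
suff -> : \sum_(j < n) (2 ^+ j.+1)^-1 = 1 - (2 ^+ n)^-1 :> R.
  by rewrite gerBl invr_ge0 exprn_ge0.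
elim: n => [|n IH]; first by rewrite big_ord0 expr0 invr1 subrr.
rewrite big_ord_recr/= IH exprS; field; rewrite expf_neq0//.
Qed.

End Covers.

Lemma near_SLdist (R : realType) (n : nat) (e0 : R) : 0 < e0 -> exists2 eta, 0 < eta <= 1 / 2 &
  forall g : 'M[R]_n, \det g = 1 -> mxnorm1 (g - 1%:M) <= eta -> SLdist g 1%:M < e0.
Proof.
move=> e00; have ee : 0 < expR e0 - 1 by rewrite subr_gt0 -expR0 ltr_expR.
pose k : R := 2 * (1 + 2 * n%:R); have k0 : 0 < k by rewrite /k mulr_gt0// ltr_pwDl// mulr_ge0.
exists (Num.min (1 / 2) ((expR e0 - 1) / k)).
  by rewrite lt_min divr_gt0// divr_gt0//= ge_min lexx.
move=> g dg; rewrite le_min => /andP[h2]; rewrite ler_pdivlMr// => hk.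
have ug := det1_unitmx dg; have [_ ih] := inv_near ug h2.
rewrite /SLdist invmx1 mulmx1 mul1mx -[X in _ < X]expRK ltr_ln ?posrE ?expR_gt0//; last first.
  by rewrite ltr_pwDl// le_max mxnorm1_ge0.
have m0 := mxnorm1_ge0 (g - 1%:M); have nm : 0 <= n%:R * mxnorm1 (g - 1%:M) by rewrite mulr_ge0.
rewrite -ltrBrDl gt_max; rewrite /k in hk.
by apply/andP; split; lra.
Qed.

Theorem corollary1p3 (R : realType) (d : nat) (hd : (2 <= d)%N) (w : 'I_d -> R)
    (w_gt0 : forall i, 0 < w i) (w_sum : \sum_i w i = 1)
    (w_noninc : forall i j : 'I_d, (i <= j)%N -> w j <= w i) :
  (((d + 1)%:R ^+ 2 - 1 - 1 / (1 + w (Ordinal (ltnW hd))))%:E <=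
   hausdorff_dim [set L : ulattice R (d + 1) |
     divergent (fun t : R => ulattice_act (det_a_flow t w_sum) L)])%E.
Proof.
apply: le_ereal_inf_tmp => _ [s [s0 Hs] <-]; rewrite lee_fin leNgt; apply/negP => sN.
set i1 := Ordinal (ltnW hd) in sN.
have d0 : (0 < d)%N by exact: ltnW.
have ed : (d.-1 < d)%N by rewrite prednK.
pose e := Ordinal ed.
have i1e : i1 != e.
  by apply/eqP => /(congr1 val) /= h; have := hd; rewrite -(prednK d0) -h.
have wP i : 0 < w e <= w i.
  by rewrite w_gt0 w_noninc//= -ltnS prednK.
(* [q] counts the entries of [A] and [b]. Since [(d + 1)^2 - 1 = q + d], the exponent left for a
   slice is below [d - 1 / (1 + w i1)]. *)
pose q := ((d + 1) * d)%N; pose s' := s - q%:R.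
have sD : s' < d%:R - 1 / (1 + w i1).
  by move: sN; rewrite /s' /q natrM natrD => sN; lra.
have [e0 e00 local] := @ulattice_dist_local R (d + 1) 1%:M (det1 _ _).
have [eta /andP[eta0 eta12] etaP] := near_SLdist (d + 1) e00.
have [tau tau0 tauP] := near_chart d0 eta0.
have [C C0 CP] := slice i1e wP w_sum sD tau0.
pose Cl : R := (d + 1).+1%:R * expR 1.
have Cl0 : 0 < Cl by rewrite mulr_gt0 ?expR_gt0.
have Cl1 : 1 <= Cl by rewrite /Cl mulr_ege1 ?ler1n// -expR0 ler_expR.
pose B := (3 / tau) ^+ q.
have B0 : 0 < B by rewrite exprn_gt0// divr_gt0.
have Cs0 : 0 < Cl `^ s by rewrite powR_gt0.
(* Both [Cl^s * eps] and [C * B * Cl^s * eps] are below 1: the first forces all radii below 1, as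
   [slice] requires, and the second gives the final contradiction. *)
pose eps := (2 + 2 * Cl `^ s + 2 * (C * B * Cl `^ s))^-1.
have CB0 : 0 < C * B * Cl `^ s by rewrite !mulr_gt0.
have X0 : 0 < 2 + 2 * Cl `^ s + 2 * (C * B * Cl `^ s) by lra.
have eps0 : 0 < eps by rewrite invr_gt0.
have epsX Y : Y < 2 + 2 * Cl `^ s + 2 * (C * B * Cl `^ s) -> Y * eps < 1.
  by move=> h; rewrite /eps ltr_pdivrMr// mul1r.
have [U [r [cov r0 rU rs]]] := null_cover s0 Hs eps0.
pose rho j := Cl * r j.
have rho0 j : 0 < rho j by rewrite mulr_gt0.
have rhos j : rho j `^ s = Cl `^ s * r j `^ s by rewrite powRM// ltW.
have rhosum n : \sum_(j < n) rho j `^ s <= Cl `^ s * eps.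
  by under eq_bigr do rewrite rhos; rewrite -mulr_sumr ler_pM2l.
have rho1 j : rho j < 1.
  rewrite ltNge; apply/negP => h1.
  have h2 : rho j `^ s <= Cl `^ s * eps.
    by apply: le_trans (rhosum j.+1); rewrite big_ord_recr/= lerDr sumr_ge0// => i _; exact: powR_ge0.
  have h3 : Cl `^ s * eps < 1 by apply: epsX; lra.
  have := ge0_ler_powR (ltW s0) _ _ h1; rewrite !nnegrE powR1 ler01 (ltW (rho0 j)) => /(_ isT isT).
  lra.
have r1 j : r j <= 1.
  by apply: le_trans (ltW (rho1 j)); rewrite /rho ler_peMl// ltW.
pose dom (A : 'M[R]_d) (b : 'rV[R]_d) (z : 'cV[R]_d) :=
  [/\ forall i j, `|A i j - (i == j)%:R| <= tau, forall j, `|b 0 j| <= tau &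
     forall i, `|z i 0| <= tau].
(* Only the sets that contain a lattice from the domain of the chart matter; one such matrix, [G j],
   serves as centre. *)
pose good j (g : 'M[R]_(d + 1)) := exists A b z, [/\ dom A b z, g = chart_mx A b z &
  exists2 L : ulattice R (d + 1), U j L & (L : set _) = zspan g].
pose P j : bool := `[< exists g, good j g >].
have /choice[G GP] j : exists g, P j -> good j g.
  by case: (pselect (exists g, good j g)) => [[g hg]|h]; [exists g|exists 1%:M => /asboolP].
have lip j g : P j -> good j g -> forall i k, `|g i k - G j i k| < rho j.
  move=> Pj [A [b [z [[dA db dz] gE [L UL LE]]]]] i k.
  have [A' [b' [z' [[dA' db' dz'] gE' [L' UL' LE']]]]] := GP j Pj.
  have [uA _ nA] := tauP _ _ _ dA db dz; have [uA' _ nA'] := tauP _ _ _ dA' db' dz'.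
  rewrite -gE in nA; rewrite -gE' in nA'.
  have dg : \det g = 1 by rewrite gE det_chart.
  have dg' : \det (G j) = 1 by rewrite gE' det_chart.
  have LL : mdist L L' = SLdist g (G j) by apply: local => //; exact: etaP.
  have := rU j L L' UL UL'; rewrite LL => h.
  have h1 := ltW (lt_le_trans h (r1 j)).
  apply: le_lt_trans (chart_lipschitz (det1_unitmx dg) (det1_unitmx dg') _ (lexx _) h1 i k) _.
    by apply: le_trans nA' _; lra.
  by rewrite /rho ltr_pM2l.
pose c j (i : 'I_q) : R := mxvec (lsubmx (G j)) 0 i.
(* The weight that remains after slicing in [q] coordinates: [rho^s'] times [rho^q] is [rho^s]. *)
pose a j := if P j then rho j `^ s' else 0.
have aq j : a j * rho j ^+ q <= rho j `^ s.
  rewrite /a; case: ifP => _; last by rewrite mul0r powR_ge0.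
  rewrite -powR_mulrn ?(ltW (rho0 j))// -powRD; last first.
    by rewrite (gt_eqF (rho0 j)) implybT.
  by rewrite /s' subrK.
(* The intervals start at the identity over a zero row, so the slice lies in the domain of the
   chart. *)
have [x xb hx] := @slicing R q a c rho (fun i => mxvec (col_mx 1%:M 0) 0 i) tau (Cl `^ s * eps)
  tau0 (mulr_gt0 Cs0 eps0) (fun j => ltac:(rewrite /a; case: ifP => // _; exact: powR_ge0)) rho0
  (fun n => le_trans (ler_sum _ (fun (j : 'I_n) _ => aq j)) (rhosum n)).
pose M : 'M[R]_(d + 1, d) := vec_mx (\row_i x i).
have ME i j : M i j = x (mxvec_index i j) by rewrite /M mxE mxE.
pose A := usubmx M; pose b := dsubmx M.
have MK : col_mx A b = M by exact: vsubmxK.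
have dA i j : `|A i j - (i == j)%:R| <= tau.
  have := xb (mxvec_index (lshift 1 i) j); rewrite mxvecE col_mxEu !mxE.
  by rewrite -/M ler_norml => /andP[h1 h2]; apply/andP; split; lra.
have db j : `|b 0 j| <= tau.
  have := xb (mxvec_index (rshift d 0) j); rewrite mxvecE col_mxEd !mxE.
  by rewrite ler_norml => /andP[h1 h2]; apply/andP; split; lra.
have z0 i : `|(0 : 'cV[R]_d) i 0| <= tau by rewrite mxE normr0 ltW.
have [uA nB _] := tauP A b 0 dA db z0.
pose hitj j := [forall i, `|x i - c j i| < rho j].
have [|||m hm] := CP (invmx A) _ nB (fun j => P j && hitj j)
  (fun j i => G j (lshift 1 i) (rshift d 0)) rho.
- by rewrite unitmx_inv.
- by move=> j _; rewrite rho0 rho1.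
- move=> xz xzt sing.
  pose z : 'cV[R]_d := \col_i xz i.
  have dz i : `|z i 0| <= tau by rewrite mxE.
  pose g := chart_mx A b z.
  have ug : unimodular (zspan g) by exists g => //; rewrite det_chart// normr1.
  pose L := ULattice ug.
  have divL : divergent (fun t : R => ulattice_act (det_a_flow t w_sum) L).
    apply: (@singular_divergent R d w w_sum A b z) => //.
    by rewrite (_ : (fun i => z i 0) = xz)//; apply/funext => i; rewrite mxE.
  have [j _ UjL] := cov L divL.
  have gg : good j g by exists A, b, z; split=> //; exists L.
  have Pj : P j by apply/asboolP; exists g.
  have lg := lip j g Pj gg; exists j.
    rewrite Pj; apply/forallP => i; case: (mxvec_indexP i) => i' j'.
    rewrite /c mxvecE -ME -MK [lsubmx _ _ _]mxE; have := lg i' (lshift 1 j').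
    by rewrite {1}/g /chart_mx block_mxEh row_mxEl.
  move=> i; have := lg (lshift 1 i) (rshift d 0).
  by rewrite {1}/g /chart_mx block_mxEur mxE.
have : \sum_(j < m | P j && hitj j) C * rho j `^ s' <= C * (B * (Cl `^ s * eps)).
  rewrite -mulr_sumr ler_pM2l//; apply: le_trans (hx m).
  rewrite big_mkcond [leRHS]big_mkcond/=; apply: ler_sum => j _.
  rewrite /a -/(hitj j); case: (P j) => /=; case: (hitj j) => //.
have := epsX (C * B * Cl `^ s) _; lra.
Qed.
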